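(* Let $\Omega_1,\Omega_2\subset\mathbb{R}^2$ be the two polygons (warped propellers) built from seven copies of a scalene triangle $T$ as described in the context, and let $\Phi_n\colon L_2(\Omega_n)\to L_2(T)^7$ ($n\in\{1,2\}$) be the unitary maps defined there. Suppose $\beta\in\mathbb{R}$, $\beta\neq0$, and let $\Delta^\beta_{\Omega_n}$ be the Robin Laplacian on $L_2(\Omega_n)$ with boundary coefficient $\beta$. Then there does not exist an invertible operator $\Psi\colon L_2(\Omega_1)\to L_2(\Omega_2)$ of the form $\Psi=\Phi_2^{-1}\,\Phi\,\Phi_1$, where $\Phi\colon L_2(T)^7\to L_2(T)^7$ is of the form $(\Phi u)_k=\sum_{l=1}^7p_{kl}\,u_l$ for some invertible real $7\times7$ matrix $P=(p_{kl})$, which intertwines $\Delta^\beta_{\Omega_1}$ and $\Delta^\beta_{\Omega_2}$.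
   Context: The domains. Let $T\subset\mathbb{R}^2$ be an open scalene triangle with sides $\Gamma_1,\Gamma_2,\Gamma_3$, and let $\rho_j$ be the reflection of $\mathbb{R}^2$ in the line containing $\Gamma_j$. Consider the gluing patterns $E_1=\{(1,2;1),(4,7;1),(1,3;2),(2,5;2),(1,4;3),(3,6;3)\}$ and $E_2=\{(1,2;1),(3,6;1),(1,3;2),(4,7;2),(1,4;3),(2,5;3)\}$. For $n\in\{1,2\}$ let $\tau^{(n)}_1,\dots,\tau^{(n)}_7$ be the isometries of $\mathbb{R}^2$ determined by $\tau^{(n)}_1=\mathrm{id}$ and $\tau^{(n)}_l=\tau^{(n)}_k\circ\rho_j$ for every $(k,l;j)\in E_n$; put $T^{(n)}_k=\tau^{(n)}_k(T)$ and let $\Omega_n$ be the interior of $\bigcup_{k=1}^7\overline{T^{(n)}_k}$. So $(k,l;j)\in E_n$ means that the $k$-th and $l$-th triangles share their sides corresponding to $\Gamma_j$. It is assumed that $T$ is such that, for each $n$, the seven triangles $T^{(n)}_k$ are pairwise disjoint, the six shared sides (without endpoints) lie in $\Omega_n$, and $\partial\Omega_n$ is a simple closed polygonal curve consisting of the remaining nine sides; thus $\Omega_n$ is an open polygon (a Lipschitz domain). The unitary map $\Phi_n\colon L_2(\Omega_n)\to L_2(T)^7$ is $\Phi_n(w)=(w|_{T^{(n)}_1}\circ\tau^{(n)}_1,\dots,w|_{T^{(n)}_7}\circ\tau^{(n)}_7)$. For a polygon $\Omega$ with boundary $\Gamma$ and $\beta\in\mathbb{R}$, the Robin Laplacian $\Delta^\beta_\Omega$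 is the self-adjoint operator on $L_2(\Omega)$ such that $-\Delta^\beta_\Omega$ is associated with the form $a^\beta(u,v)=\int_\Omega\nabla u\cdot\overline{\nabla v}+\beta\int_\Gamma u\,\overline v$, $u,v\in H^1(\Omega)$ (traces and arc-length measure on $\Gamma$); that is, $u\in D(\Delta^\beta_\Omega)$ and $-\Delta^\beta_\Omega u=f$ iff $u\in H^1(\Omega)$, $f\in L_2(\Omega)$ and $a^\beta(u,v)=(f,v)_{L_2(\Omega)}$ for all $v\in H^1(\Omega)$. An operator $\Psi\in\mathcal{L}(L_2(\Omega_1),L_2(\Omega_2))$ intertwines $\Delta^\beta_{\Omega_1}$ and $\Delta^\beta_{\Omega_2}$ if $\Psi(D(\Delta^\beta_{\Omega_1}))\subset D(\Delta^\beta_{\Omega_2})$ and $\Delta^\beta_{\Omega_2}\Psi u=\Psi\Delta^\beta_{\Omega_1}u$ for all $u\in D(\Delta^\beta_{\Omega_1})$ (equivalently, $\Psi$ intertwines the generated semigroups). *)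

(* Defs.v *)
From HB Require Import structures.
From mathcomp Require Import all_boot all_order all_algebra.
From mathcomp Require Import all_classical all_reals all_analysis.
From mathcomp Require Import complex.

Set Implicit Arguments.
Unset Strict Implicit.
Unset Printing Implicit Defensive.

Import Order.TTheory GRing.Theory Num.Theory.
Import numFieldNormedType.Exports.

Local Open Scope classical_set_scope.
Local Open Scope ring_scope.
Local Open Scope complex_scope.

Notation plane R := (R * R)%type (only parsing).

Section Geometry.
Variable R : realType.
Implicit Types p q x : plane R.

Definition dot p q : R := p.1 * q.1 + p.2 * q.2.

Definition enorm p : R := Num.sqrt (dot p p).

Definition seg p q (t : R) : plane R := p + t *: (q - p).

Definition segment p q : set (plane R) := seg p q @` `[0, 1]%classic.

Definition open_segment p q : set (plane R) := seg p q @` `]0, 1[%classic.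

(* Reflection in the line through [p] and [q]: twice the foot of the
   perpendicular from [x], minus [x]. *)
Definition reflection p q x : plane R :=
  2 *: (p + (dot (x - p) (q - p) / dot (q - p) (q - p)) *: (q - p)) - x.

Definition boundary (A : set (plane R)) : set (plane R) := closure A `\` A°.

Definition simple_closed_polygon n (v : 'I_n -> plane R) : Prop :=
  let e i := segment (v i) (v (ordS i)) in
  [/\ injective v,
      forall i, e i `&` e (ordS i) = [set v (ordS i)] &
      forall i j, i != j -> j != ordS i -> i != ordS j -> e i `&` e j = set0].

(* A triangle is given by its vertices; its side with index [j] is the one
   opposite to the vertex [a j]. *)
Definition side_of (a : 'I_3 -> plane R) (j : 'I_3) : plane R * plane R :=
  (a (ordS j), a (ordS (ordS j))).

Definition triangle (a : 'I_3 -> plane R) : set (plane R) :=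
  [set x | exists c : 'I_3 -> R,
     [/\ forall i, 0 < c i, \sum_i c i = 1 & x = \sum_i c i *: a i]].

Definition noncollinear (a : 'I_3 -> plane R) : Prop :=
  let u := a 1 - a 0 in let v := a 2 - a 0 in u.1 * v.2 - u.2 * v.1 != 0.

Definition scalene (a : 'I_3 -> plane R) : Prop :=
  injective (fun j => enorm ((side_of a j).2 - (side_of a j).1)).

End Geometry.

(* [(k, l, j)] : the [k]-th and [l]-th triangles share their sides with index
   [j].  Numerals in ['I_7] and ['I_3] are residues modulo 7 and 3, so the
   labels 7 and 3 are the ordinals 0. *)
Definition pattern := seq ('I_7 * 'I_7 * 'I_3).

Definition E1 : pattern :=
  [:: (1, 2, 1); (4, 7, 1); (1, 3, 2); (2, 5, 2); (1, 4, 3); (3, 6, 3)].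

Definition E2 : pattern :=
  [:: (1, 2, 1); (3, 6, 1); (1, 3, 2); (4, 7, 2); (1, 4, 3); (2, 5, 3)].

Definition shared (E : pattern) (k : 'I_7) (j : 'I_3) : bool :=
  has (fun e => (e.2 == j) && ((e.1.1 == k) || (e.1.2 == k))) E.

Section Gluing.
Variables (R : realType) (a : 'I_3 -> plane R).
Implicit Types (E : pattern) (tau : 'I_7 -> plane R -> plane R).

Definition is_gluing E tau : Prop :=
  tau 1 = id /\
  forall k l j, (k, l, j) \in E ->
    tau l = tau k \o reflection (side_of a j).1 (side_of a j).2.

Definition tile tau (k : 'I_7) : set (plane R) := tau k @` triangle a.

Definition glued tau : set (plane R) :=
  (\bigcup_(k in [set: 'I_7]) closure (tile tau k))°.

Definition tile_side tau (k : 'I_7) (j : 'I_3) : plane R * plane R :=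
  side_of (fun i => tau k (a i)) j.

Definition outer_sides E tau : seq (plane R * plane R) :=
  [seq tile_side tau kj.1 kj.2
     | kj <- enum {: 'I_7 * 'I_3} & ~~ shared E kj.1 kj.2].

Definition admissible E tau : Prop :=
  [/\ forall k l, k != l -> tile tau k `&` tile tau l = set0,
      forall k l j, (k, l, j) \in E ->
        open_segment (tile_side tau k j).1 (tile_side tau k j).2
          `<=` glued tau &
      exists v : 'I_9 -> plane R,
        [/\ simple_closed_polygon v,
            boundary (glued tau) =
              \bigcup_(i in [set: 'I_9]) segment (v i) (v (ordS i)) &
            range (fun i => segment (v i) (v (ordS i))) =
              [set segment s.1 s.2 | s in [set` outer_sides E tau]]]].

End Gluing.

Section ComplexL2.
Variables (R : realType) (d : measure_display) (X : measurableType d).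
Variable mu : {measure set X -> \bar R}.
Implicit Types (A : set X) (f g : X -> R[i]).

Definition cintegral A f : R[i] :=
  Rintegral mu A (fun x => complex.Re (f x)) +i*
  Rintegral mu A (fun x => complex.Im (f x)).

Definition abs2 (z : R[i]) : R := complex.Re z ^+ 2 + complex.Im z ^+ 2.

Definition sqnorm A f : \bar R := (\int[mu]_(x in A) (abs2 (f x))%:E)%E.

Definition L2 A f : Prop :=
  [/\ measurable_fun A (fun x => complex.Re (f x)),
      measurable_fun A (fun x => complex.Im (f x)) &
      (sqnorm A f < +oo)%E].

Definition inner A f g : R[i] := cintegral A (fun x => f x * (g x)^*).

End ComplexL2.

Section PlaneFunctions.
Variable R : realType.
Implicit Types (A B W : set (plane R)) (s : seq (plane R * plane R)).
Implicit Types (f g u v : plane R -> R[i]).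

Definition leb2 := (@lebesgue_measure R \x @lebesgue_measure R)%E.

(* A polygonal curve is given by the list of its sides; integrals for arc length
   are sums over the sides, each parametrised on [0, 1] at constant speed. *)
Definition on_side g (pq : plane R * plane R) : R -> R[i] :=
  g \o seg pq.1 pq.2.

Definition unit_interval : set R := `[0, 1]%classic.

Definition side_length (pq : plane R * plane R) : R := enorm (pq.2 - pq.1).

Definition curve_L2 s g : Prop :=
  forall pq, pq \in s ->
    L2 (@lebesgue_measure R) unit_interval (on_side g pq).

Definition curve_sqnorm s g : \bar R :=
  (\sum_(pq <- s) (side_length pq)%:E *
     sqnorm (@lebesgue_measure R) unit_interval (on_side g pq))%E.

Definition curve_inner s f g : R[i] :=
  \sum_(pq <- s) (side_length pq)%:C *
     inner (@lebesgue_measure R) unit_interval (on_side f pq) (on_side g pq).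

Definition C1 (f : plane R -> R) : Prop :=
  (forall x, differentiable f x) /\
  (forall e : plane R, continuous (fun x => 'D_e f x)).

(* Compactly supported C^1 (rather than smooth) test functions define the same
   first-order weak derivatives. *)
Definition test_function W (phi : plane R -> R) : Prop :=
  [/\ C1 phi, compact (closure [set x | phi x != 0]) &
      closure [set x | phi x != 0] `<=` W].

Definition weak_derivative W (e : plane R) u g : Prop :=
  forall phi, test_function W phi ->
    cintegral leb2 W (fun x => u x * ('D_e phi x)%:C) =
    - cintegral leb2 W (fun x => g x * (phi x)%:C).

Definition dx : plane R := (1, 0).
Definition dy : plane R := (0, 1).

Definition cC1 f : Prop :=
  C1 (fun x => complex.Re (f x)) /\ C1 (fun x => complex.Im (f x)).

Definition cderive (e : plane R) f (x : plane R) : R[i] :=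
  'D_e (fun y => complex.Re (f y)) x +i* 'D_e (fun y => complex.Im (f y)) x.

(* An H^1 function together with its weak gradient and its trace. *)
Record sobolev_data := SobolevData {
  fn : plane R -> R[i];
  fn_x : plane R -> R[i];
  fn_y : plane R -> R[i];
  tr : plane R -> R[i] }.

Implicit Types w z : sobolev_data.

Definition weak_gradient W w : Prop :=
  [/\ L2 leb2 W (fn w), L2 leb2 W (fn_x w), L2 leb2 W (fn_y w),
      weak_derivative W dx (fn w) (fn_x w) &
      weak_derivative W dy (fn w) (fn_y w)].

(* The trace operator is the continuous extension to H^1, for the L_2 norm on
   the boundary curve, of the restriction map on functions that are C^1 up to
   the boundary (these are dense in H^1 of a Lipschitz domain). *)
Definition is_trace W s w : Prop :=
  curve_L2 s (tr w) /\
  exists h : nat -> plane R -> R[i],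
    [/\ forall n, cC1 (h n),
        (fun n => sqnorm leb2 W (h n \- fn w)) @ \oo --> 0%E,
        (fun n => sqnorm leb2 W (cderive dx (h n) \- fn_x w)) @ \oo --> 0%E,
        (fun n => sqnorm leb2 W (cderive dy (h n) \- fn_y w)) @ \oo --> 0%E &
        (fun n => curve_sqnorm s (h n \- tr w)) @ \oo --> 0%E].

Definition H1 W s w : Prop := weak_gradient W w /\ is_trace W s w.

Definition robin_form W s (beta : R) w z : R[i] :=
  cintegral leb2 W (fun x => fn_x w x * (fn_x z x)^* + fn_y w x * (fn_y z x)^*)
  + beta%:C * curve_inner s (tr w) (tr z).

(* The graph of the operator associated with the form, here - Delta^beta. *)
Definition form_operator W s beta u f : Prop :=
  L2 leb2 W f /\
  exists w, [/\ fn w = u, H1 W s w &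
    forall z, H1 W s z -> robin_form W s beta w z = inner leb2 W f (fn z)].

Definition robin_laplacian W s beta u f : Prop :=
  form_operator W s beta u (\- f).

Definition robin_domain W s beta u : Prop :=
  exists f, robin_laplacian W s beta u f.

(* Elements of L_2 are represented by functions, so operators are required to
   respect equality almost everywhere. *)
Definition bounded_operator A B (Psi : (plane R -> R[i]) -> plane R -> R[i]) :=
  [/\ forall u, L2 leb2 A u -> L2 leb2 B (Psi u),
      forall u v, L2 leb2 A u -> L2 leb2 A v ->
        ae_eq leb2 A u v -> ae_eq leb2 B (Psi u) (Psi v),
      forall (c : R[i]) u v, L2 leb2 A u -> L2 leb2 A v ->
        ae_eq leb2 B (Psi (fun x => c * u x + v x))
                     (fun x => c * Psi u x + Psi v x) &
      exists M : R, forall u, L2 leb2 A u ->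
        (sqnorm leb2 B (Psi u) <= M%:E * sqnorm leb2 A u)%E].

Definition invertible_operator A B Psi : Prop :=
  bounded_operator A B Psi /\
  exists Theta, [/\ bounded_operator B A Theta,
    forall u, L2 leb2 A u -> ae_eq leb2 A (Theta (Psi u)) u &
    forall v, L2 leb2 B v -> ae_eq leb2 B (Psi (Theta v)) v].

Definition intertwines_robin W1 s1 W2 s2 beta Psi : Prop :=
  (forall u, robin_domain W1 s1 beta u -> robin_domain W2 s2 beta (Psi u)) /\
  (forall u f g, robin_laplacian W1 s1 beta u f ->
     robin_laplacian W2 s2 beta (Psi u) g -> ae_eq leb2 W2 g (Psi f)).

Definition unfold_tiles (tau : 'I_7 -> plane R -> plane R) u :
  'I_7 -> plane R -> R[i] := fun k => u \o tau k.

Definition mix (P : 'M[R]_7) (U : 'I_7 -> plane R -> R[i]) :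
  'I_7 -> plane R -> R[i] := fun k x => \sum_l (P k l)%:C * U l x.

(* Psi = Phi_2^-1 Phi Phi_1, written as Phi_2 Psi = Phi Phi_1 in L_2(T)^7. *)
Definition transplantation (a : 'I_3 -> plane R) tau1 tau2 (P : 'M[R]_7)
    (Psi : (plane R -> R[i]) -> plane R -> R[i]) : Prop :=
  forall u, L2 leb2 (glued a tau1) u -> forall k,
    ae_eq leb2 (triangle a) (unfold_tiles tau2 (Psi u) k)
                            (mix P (unfold_tiles tau1 u) k).

End PlaneFunctions.

(* Main.v *)
(* Let [b] be a C^1 function on the first domain, supported near an interior
   point of one side of one tile, and satisfying the Robin condition.  If [Psi]
   intertwines, then [Psi b] is in the second Robin domain, with Laplacian
   [Psi (Delta b)], so that <z, Psi (Delta b)> = <Delta z, Psi b> for every Robin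
   test function [z] on the second domain.  Let [z] be supported near the
   corresponding point of a shared side.  In coordinates (s, t) along and across
   the side, [b] is f(s) g(t) with g(t) = (1 + beta t) eta(t) and eta even, while
   [z] is f(s) g(-t).  The pairing is then the integral of f^2 times the jump
   across the side of a Wronskian, which does not vanish because g and its mirror
   image have logarithmic derivatives beta and - beta at 0.  This gives two rules:
   - [P k l = 0] if the side [j] of the tile [k] is shared in the second domain
     and the side [j] of the tile [l] is an outer side of the first one;
   - [P k l = P k' l'] if the tiles [k], [k'] share their sides [j] in the second
     domain and the tiles [l], [l'] share theirs in the first one.
   For the given patterns the first rule yields [P 1 l = 0] for [l <> 1], and
   [P 2 2 = 0]; the second yields [P 1 1 = P 2 2].  So row 1 of [P] vanishes. *)

From HB Require Import structures.
Require Import Defs.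
From mathcomp Require Import all_boot all_order all_algebra.
From mathcomp Require Import all_classical all_reals all_analysis.
From mathcomp Require Import measurable_realfun complex ring lra.
Set Implicit Arguments.
Unset Strict Implicit.
Unset Printing Implicit Defensive.
Import Order.TTheory GRing.Theory Num.Theory.
Import numFieldNormedType.Exports.
Local Open Scope classical_set_scope.
Local Open Scope ring_scope.

(** * Integration in the plane *)

(** No regularity of functions in a Robin domain is ever needed. [Psi b] and [Psi (Delta b)] are
    known almost everywhere from [P], and they are only paired with an explicit [z]. Green's
    identity for an explicit function has to be checked against C^1 functions alone, because an H^1
    function and its trace are by definition joint limits of such functions. With [t] pointing
    inward, the Robin condition at an outer side reads g'(0) = beta g(0). Inside a domain there is
    no condition, so [z] is free to carry the reversed profile; with the profile of [b] itself the
    Wronskian would vanish, and for beta = 0 the profile is even and the two coincide. Reflection in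
    the shared side exchanges g and its mirror image. Hence above the side only tiles that see [b]
    through g contribute, below it only tiles that see [b] through the mirror image, and the two
    contributions must balance. The geometric obstacle is that outer sides are only known to form
    the boundary. One still has to find a point of such a side near which the domain is exactly a
    half-plane. *)

Section MeasurePreserving.
Variable R : realType.
Local Notation mu := (@lebesgue_measure R).
Local Notation mR := (measurableTypeR R).
Local Notation leb2 := (@Defs.leb2 R).

Definition measure_preserving (f : plane R -> plane R) :=
  measurable_fun [set: mR * mR] (f : mR * mR -> mR * mR) /\
  forall A : set (mR * mR), measurable A -> leb2 (f @^-1` A) = leb2 A.

Lemma measure_preserving_comp f g :
  measure_preserving f -> measure_preserving g -> measure_preserving (f \o g).
Proof.
move=> [mf pf] [mg pg]; split; first exact: measurableT_comp.
move=> A mA; rewrite -(pf A mA) -(pg (f @^-1` A)) //.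
by rewrite -[X in measurable X]setTI; exact: mf.
Qed.

Lemma lebesgue_measure_translate (c : R) (A : set R) : measurable A ->
  mu ((fun x => x + c) @^-1` A) = mu A.
Proof.
move=> mA; have mc : measurable_fun setT ((fun x => x + c) : mR -> mR).
  exact: measurable_funD.
pose nu := pushforward mu ((fun x => x + c) : mR -> mR).
change (nu A = mu A).
apply/esym; apply: (@lebesgue_measure_unique _ (nu : measure _ _)) => //= _ [[a b]] _ <-.
rewrite /nu /pushforward /=.
rewrite (_ : _ @^-1` _ = `](a - c), (b - c)]%classic); last first.
  by apply/seteqP; split => x /=; rewrite !in_itv/= ltrBlDr lerBrDr.
rewrite !lebesgue_measure_itv/= !lte_fin ltrD2r; case: ifP => // _.
by rewrite -!EFinB; congr EFin; ring.
Qed.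

(** The two iterated integrals define the same measure. This gives access to slices at fixed second
    coordinate, which are needed for maps that move only the first one. *)
Lemma leb2E (A : set (mR * mR)) : measurable A ->
  leb2 A = (mu \x^ mu)%E A.
Proof.
move=> mA; apply: product_measure_unique => // B C mB mC.
exact: product_measure2E.
Qed.

Lemma measure_preserving_fst (f : R -> R -> R) :
  measurable_fun setT (fun x : mR * mR => f x.1 x.2 : mR) ->
  (forall y (A : set R), measurable A -> mu (f ^~ y @^-1` A) = mu A) ->
  measure_preserving (fun x => (f x.1 x.2, x.2)).
Proof.
move=> mf pf.
have mm : measurable_fun [set: mR * mR] ((fun x => (f x.1 x.2, x.2)) : mR * mR -> mR * mR).
  by apply/measurable_fun_pair => //; exact: measurable_snd.
split=> // A mA.
have mfA : measurable ((fun x : mR * mR => (f x.1 x.2, x.2) : mR * mR) @^-1` A).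
  by rewrite -[X in measurable X]setTI; exact: mm.
rewrite !leb2E// /product_measure2; apply: eq_integral => y _ /=.
rewrite -[RHS](pf y); last exact: measurable_ysection.
by congr (mu _); apply/seteqP; split => x /=; rewrite /ysection/= !inE.
Qed.

Lemma measure_preserving_snd (f : R -> R -> R) :
  measurable_fun setT (fun x : mR * mR => f x.1 x.2 : mR) ->
  (forall x (A : set R), measurable A -> mu (f x @^-1` A) = mu A) ->
  measure_preserving (fun x => (x.1, f x.1 x.2)).
Proof.
move=> mf pf.
have mm : measurable_fun [set: mR * mR] ((fun x => (x.1, f x.1 x.2)) : mR * mR -> mR * mR).
  by apply/measurable_fun_pair => //; exact: measurable_fst.
split=> // A mA.
rewrite /leb2 /product_measure1; apply: eq_integral => x _ /=.
rewrite -[RHS](pf x); last exact: measurable_xsection.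
by congr (mu _); apply/seteqP; split => y /=; rewrite /xsection/= !inE.
Qed.

Let shear_x (c : R -> R) : measurable_fun setT (c : mR -> mR) ->
  measure_preserving (fun x => (x.1 + c x.2, x.2)).
Proof.
move=> mc; apply: (measure_preserving_fst (f := fun x y => x + c y)).
  apply: measurable_funD; first exact: measurable_fst.
  by apply: measurableT_comp => //; exact: measurable_snd.
by move=> y A mA; exact: lebesgue_measure_translate.
Qed.

Let shear_y (c : R -> R) : measurable_fun setT (c : mR -> mR) ->
  measure_preserving (fun x => (x.1, x.2 + c x.1)).
Proof.
move=> mc; apply: (measure_preserving_snd (f := fun x y => y + c x)).
  apply: measurable_funD; first exact: measurable_snd.
  by apply: measurableT_comp => //; exact: measurable_fst.
by move=> y A mA; exact: lebesgue_measure_translate.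
Qed.

Let flip_x : measure_preserving (fun x => (- x.1, x.2)).
Proof.
apply: (measure_preserving_fst (f := fun x y => - x)).
  by apply: measurableT_comp => //; exact: measurable_fst.
by move=> y A mA; exact: lebesgue_measureN.
Qed.

Let flip_y : measure_preserving (fun x => (x.1, - x.2)).
Proof.
apply: (measure_preserving_snd (f := fun x y => - y)).
  by apply: measurableT_comp => //; exact: measurable_snd.
by move=> y A mA; exact: lebesgue_measureN.
Qed.

Definition orthonormal_pair (e n : plane R) :=
  [/\ dot e e = 1, dot n n = 1 & dot e n = 0].

Definition chart (o e n x : plane R) : plane R := o + x.1 *: e + x.2 *: n.

(* A rotation by an angle that is not a multiple of [pi] is a product of three
   shears. *)
Let rotation (c s : R) : c ^+ 2 + s ^+ 2 = 1 ->
  measure_preserving (fun x => (c * x.1 - s * x.2, s * x.1 + c * x.2)).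
Proof.
move=> cs; have [s0|s0] := eqVneq s 0.
  have /orP[/eqP c1|/eqP c1] : (c == 1) || (c == -1).
    by rewrite -eqf_sqr expr1n -cs s0 expr0n/= addr0.
  - rewrite (_ : (fun _ => _) = (fun x => (x.1 + cst 0 x.2, x.2))).
      exact: shear_x.
    by apply/funext => -[x y] /=; rewrite s0 c1; congr pair; ring.
  - rewrite (_ : (fun _ => _) =
      (fun x => (x.1, - x.2)) \o (fun x => (- x.1, x.2))).
      exact: measure_preserving_comp flip_y flip_x.
    by apply/funext => -[x y] /=; rewrite s0 c1; congr pair; ring.
(* Minus the tangent of half the angle. The rotation is the shear by [k] along x, then by [s] along
   y, then by [k] along x. *)
pose k := (c - 1) / s.
have sx : measure_preserving (fun x => (x.1 + k * x.2, x.2)).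
  by apply: (shear_x (c := fun y => k * y)); exact: measurable_funM.
have sy : measure_preserving (fun x => (x.1, x.2 + s * x.1)).
  by apply: (shear_y (c := fun y => s * y)); exact: measurable_funM.
rewrite (_ : (fun _ => _) = (fun x => (x.1 + k * x.2, x.2)) \o
   ((fun x => (x.1, x.2 + s * x.1)) \o (fun x => (x.1 + k * x.2, x.2)))).
  by apply: measure_preserving_comp => //; exact: measure_preserving_comp.
have ks : k * s = c - 1 by rewrite /k mulfVK.
have kc : k * (1 + c) = - s.
  apply: (mulIf s0); rewrite mulrAC ks.
  by rewrite mulNr -expr2 -[s ^+ 2](addKr (c ^+ 2)) cs; ring.
apply/funext => -[x y] /=; congr pair.
  have -> : x + k * y + k * (y + s * (x + k * y)) =
    (1 + k * s) * x + (k * (1 + (1 + k * s))) * y by ring.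
  by rewrite ks (_ : 1 + (1 + (c - 1)) = 1 + c) ?kc; ring.
rewrite (_ : y + _ = s * x + (1 + k * s) * y); last by ring.
by rewrite ks; ring.
Qed.

Let translation (o : plane R) : measure_preserving (fun x => o + x).
Proof.
rewrite (_ : (fun x => _) = (fun x => (x.1 + cst o.1 x.2, x.2)) \o
  (fun x => (x.1, x.2 + cst o.2 x.1))).
  by apply: measure_preserving_comp; [exact: shear_x | exact: shear_y].
by apply/funext => x; rewrite /= /cst [x.1 + _]addrC [x.2 + _]addrC.
Qed.

(** The pair may have either orientation: the chart is a translation after a rotation after,
    possibly, a flip of the second axis. *)
Lemma chart_measure_preserving (o e n : plane R) :
  orthonormal_pair e n -> measure_preserving (chart o e n).
Proof.
case: e n => [e1 e2] [n1 n2] [/=]; rewrite /dot/= => ee nn en.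
have cs : e1 ^+ 2 + e2 ^+ 2 = 1 by rewrite -ee; ring.
(* The determinant; it is 1 or -1 because its square plus that of the scalar product [dot e n] is
   the product of the squared lengths. *)
pose d := e1 * n2 - e2 * n1.
have d2 : d ^+ 2 = 1.
  have : d ^+ 2 + (e1 * n1 + e2 * n2) ^+ 2 = 1.
    by rewrite -[RHS]mulr1 -{1}ee -nn /d; ring.
  by rewrite en expr0n/= addr0.
have n1E : n1 = - d * e2.
  transitivity (n1 * (e1 * e1 + e2 * e2) - e1 * (e1 * n1 + e2 * n2)).
    by rewrite ee en; ring.
  by rewrite /d; ring.
have n2E : n2 = d * e1.
  transitivity (n2 * (e1 * e1 + e2 * e2) - e2 * (e1 * n1 + e2 * n2)).
    by rewrite ee en; ring.
  by rewrite /d; ring.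
have md : measure_preserving (fun x => (x.1, d * x.2)).
  have /orP[/eqP d1|/eqP d1] : (d == 1) || (d == -1).
    by rewrite -eqf_sqr expr1n d2.
  - rewrite (_ : (fun x => _) = (fun x => (x.1 + cst 0 x.2, x.2))).
      exact: shear_x.
    by apply/funext => -[x y] /=; rewrite d1; congr pair; ring.
  - rewrite (_ : (fun x => _) = (fun x => (x.1, - x.2))) //.
    by apply/funext => -[x y] /=; rewrite d1; congr pair; ring.
rewrite (_ : chart _ _ _ = (fun x => o + x) \o
  ((fun x => (e1 * x.1 - e2 * x.2, e2 * x.1 + e1 * x.2)) \o
   (fun x => (x.1, d * x.2)))).
  apply: measure_preserving_comp; first exact: translation.
  by apply: measure_preserving_comp => //; exact: rotation.
apply/funext => -[x y]; rewrite /chart/= -addrA; congr (_ + _).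
by rewrite [LHS]surjective_pairing; congr pair;
  rewrite /= ?n1E ?n2E /GRing.scale /=; ring.
Qed.

End MeasurePreserving.

Section PlaneIntegrals.
Variable R : realType.
Local Notation mu := (@lebesgue_measure R).
Local Notation mR := (measurableTypeR R).
Local Notation leb2 := (@Defs.leb2 R).
Implicit Types (f F : plane R -> R) (A : set (mR * mR)).

(** Measurability refers to the product sigma-algebra, so the open set is written as the union of
    the countably many rational boxes that it contains. *)
Lemma open_plane_measurable (A : set (plane R)) :
  open A -> measurable (A : set (mR * mR)).
Proof.
move=> oA.
pose Q (i : rat * rat * rat * rat) : set (plane R) :=
  `](ratr i.1.1.1), (ratr i.1.1.2)[%classic `*` `](ratr i.1.2), (ratr i.2)[%classic.
pose F i : set (mR * mR) := if `[< Q i `<=` A >] then Q i else set0.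
rewrite (_ : (A : set (mR * mR)) = \bigcup_i F i); last first.
  apply/seteqP; split => [x Ax|x [i _]]; last first.
    by rewrite /F; case: asboolP => // QA /QA.
  have [e /= e0 eA] : exists2 e : R, 0 < e & ball x e `<=` A.
    by have := open_nbhs_nbhs (conj oA Ax); move/nbhs_ballP => [e e0 eA]; exists e.
  have near (y : R) : exists p : rat * rat, ratr p.1 < y < ratr p.2 /\
      (forall z, ratr p.1 < z < ratr p.2 -> `|y - z| < e).
    have [p pP] := @rat_in_itvoo R (y - e) y ltac:(lra).
    have [q qP] := @rat_in_itvoo R y (y + e) ltac:(lra).
    move: pP qP; rewrite !in_itv/= => /andP[? ?] /andP[? ?].
    exists (p, q); split; first exact/andP.
    by move=> z /andP[/= ? ?]; rewrite ltr_norml; apply/andP; split; lra.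
  have [p [px pe]] := near x.1.
  have [q [qx qe]] := near x.2.
  exists (p.1, p.2, q.1, q.2) => //; rewrite /F /Q/=; case: asboolP.
    by move=> _; split; rewrite /= in_itv.
  case=> z [/=]; rewrite !in_itv/= => z1 z2.
  by apply: eA; split => /=; [exact: pe|exact: qe].
apply: countable_bigcupT_measurable => // i; rewrite /F; case: ifP => _ //.
by apply: measurableX.
Qed.

Lemma continuous_plane_measurable f A :
  measurable A -> continuous f -> measurable_fun A (f : mR * mR -> mR).
Proof.
move=> mA /continuousP cf; apply: (measurability _ (RGenOpens.measurableE R)).
move=> _ [_ [a [b ->] <-]]; apply: measurableI => //.
by apply: open_plane_measurable; apply: cf; exact: interval_open.
Qed.

Lemma continuous_plane_integrable f A (a b c d : R) :
  continuous f -> measurable A -> A `<=` `[a, b]%classic `*` `[c, d]%classic ->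
  leb2.-integrable A (EFin \o f).
Proof.
move=> cf mA Aab.
have mbox : measurable (`[a, b]%classic `*` `[c, d]%classic : set (mR * mR)).
  exact: measurableX.
apply: (@integrableS _ _ _ _ _ _ _ mbox mA Aab).
apply: measurable_bounded_integrable => //.
- rewrite [X in (X < _)%E]product_measure1E//= !lebesgue_measure_itv /=.
  by case: ifP => _; case: ifP => _; rewrite ?mule0 ?mul0e -?EFinB -?EFinM ltry.
- exact: continuous_plane_measurable.
- have /compact_bounded[M [_ mrt]] : compact (f @` (`[a, b]%classic `*` `[c, d]%classic)).
    apply: continuous_compact; last first.
      by apply: compact_setX; exact: segment_compact.
    exact: continuous_subspaceT.
  by exists M; split; rewrite ?num_real // => ? ? ? ?; exact: mrt.
Qed.

(** Integrability is not assumed: positive and negative parts are transported separately. *)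
Lemma Rintegral_measure_preserving (T : plane R -> plane R) f A :
  measure_preserving T -> measurable A -> measurable_fun A (f : mR * mR -> mR) ->
  Rintegral leb2 A f = Rintegral leb2 (T @^-1` A) (f \o T).
Proof.
move=> [mT pT] mA mf; rewrite /Rintegral; congr fine.
have key (g : mR * mR -> \bar R) : measurable_fun A g -> (forall x, 0 <= g x)%E ->
    (\int[leb2]_(x in A) g x = \int[leb2]_(x in T @^-1` A) (g (T x)))%E.
  move=> mg g0.
  rewrite -(ge0_integral_pushforward mT leb2 mA mg (in1W g0)).
  by apply: eq_measure_integral => B mB _; exact/esym/pT.
rewrite integralE [RHS]integralE; congr (_ - _)%E.
- rewrite key //; first by apply: eq_integral => x _; rewrite !funeposE.
  by apply: measurable_funepos; exact/measurable_EFinP.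
- rewrite key //; first by apply: eq_integral => x _; rewrite !funenegE.
  by apply: measurable_funeneg; exact/measurable_EFinP.
Qed.

Lemma continuous_slice f (x : R) : continuous f -> continuous (fun t : R => f (x, t)).
Proof.
move=> cf t; apply: (@continuous_comp _ _ _ (fun t : R => (x, t)) f); last exact: cf.
by apply: (@cvg_pair _ _ _ (nbhs t) (nbhs x) (nbhs t) _ _ _ (fun=> x) id); [exact: cvg_cst | exact: cvg_id].
Qed.

(** Fubini, with the inner integral evaluated by the fundamental theorem of calculus. The half-open
    interval fits the condition [c < t] by which a domain is cut off at a side. *)
Lemma Rintegral_box_FTC F f (D : set R) (a b c d : R) : c < d ->
  measurable D -> D `<=` `[a, b]%classic ->
  continuous F -> continuous f ->
  (forall x y : R, is_derive y 1 (fun t : R => F (x, t)) (f (x, y))) ->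
  Rintegral leb2 (D `*` `]c, d]%classic) f =
  \int[mu]_(x in D) (F (x, d) - F (x, c)).
Proof.
move=> cd mD Dab cF cf dF.
have mbox : measurable (D `*` `]c, d]%classic : set (mR * mR)).
  exact: measurableX.
have intf : leb2.-integrable (D `*` `]c, d]%classic) (EFin \o f).
  apply: (continuous_plane_integrable (a := a) (b := b) (c := c) (d := d)) => //.
  by move=> x [/Dab ? ?]; split => //; exact: subset_itv_oc_cc.
rewrite /Rintegral; congr fine.
rewrite integral_mkcond -integral12_prod_meas1; last exact/(integrable_mkcond _ mbox).
rewrite [RHS]integral_mkcond; apply: eq_integral => x _.
rewrite /fubini_F [in RHS]patchE; case: ifPn => xab.
  transitivity (\int[mu]_y ((fun y : mR => (f (x, y))%:E) \_ `]c, d]) y)%E.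
    by apply: eq_integral => y _; rewrite !patchE in_setX xab.
  rewrite -integral_mkcond integral_itv_obnd_cbnd; last first.
    apply/measurable_EFinP/(measurable_funS measurableT) => //.
    by apply: continuous_measurable_fun; exact: continuous_slice.
  rewrite (continuous_FTC2 (F := fun t => F (x, t))) ?EFinB//.
  - by apply: continuous_subspaceT; exact: continuous_slice.
  - have cFx := continuous_slice (x := x) cF.
    split => [y _| |].
    + by have [] := dF x y.
    + by apply: cvg_at_right_filter; exact: cFx.
    + by apply: cvg_at_left_filter; exact: cFx.
  - by move=> y _; rewrite derive1E; have [_ ->] := dF x y.
by rewrite integral0_eq// => y _; rewrite patchE in_setX (negbTE xab).
Qed.

End PlaneIntegrals.

(** * Pairings of square-integrable functions *)

Section L2Pairing.
Context (R : realType) (d : measure_display) (X : measurableType d).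
Variable mu : {measure set X -> \bar R}.
Implicit Types (f g h r : X -> R) (A : set X).

Lemma sqr_integrable A f : measurable A -> measurable_fun A f ->
  (\int[mu]_(x in A) (f x ^+ 2)%:E < +oo)%E ->
  mu.-integrable A (fun x => (f x ^+ 2)%:E).
Proof.
move=> mA mf f2; apply/integrableP; split.
  by apply/measurable_EFinP; exact: measurable_funX.
rewrite (eq_integral (fun x => (f x ^+ 2)%:E)) // => x _.
by rewrite gee0_abs// lee_fin sqr_ge0.
Qed.

Lemma mul_integrable A f g : measurable A ->
  measurable_fun A f -> measurable_fun A g ->
  (\int[mu]_(x in A) (f x ^+ 2)%:E < +oo)%E ->
  (\int[mu]_(x in A) (g x ^+ 2)%:E < +oo)%E ->
  mu.-integrable A (fun x => (f x * g x)%:E).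
Proof.
move=> mA mf mg f2 g2.
apply: (@le_integrable _ _ _ _ _ mA _ (fun x => (f x ^+ 2)%:E + (g x ^+ 2)%:E)%E).
- by apply/measurable_EFinP; exact: measurable_funM.
- move=> x _; rewrite -EFinD /= lee_fin.
  rewrite (ger0_norm (addr_ge0 (sqr_ge0 _) (sqr_ge0 _))) ler_norml.
  by clear; apply/andP; split; nra.
- by apply: integrableD => //; exact: sqr_integrable.
Qed.

(** Young's inequality with a free weight, in place of Cauchy-Schwarz: in a limit argument [c] is
    taken small against the fixed factor [f]. *)
Lemma Rintegral_pairing_bound A f g (c : R) : measurable A -> 0 < c ->
  measurable_fun A f -> measurable_fun A g ->
  (\int[mu]_(x in A) (f x ^+ 2)%:E < +oo)%E ->
  (\int[mu]_(x in A) (g x ^+ 2)%:E < +oo)%E ->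
  `|\int[mu]_(x in A) (f x * g x)| <=
    c * \int[mu]_(x in A) (f x ^+ 2) + c^-1 * \int[mu]_(x in A) (g x ^+ 2).
Proof.
move=> mA c0 mf mg f2 g2.
have If := sqr_integrable mA mf f2.
have Ig := sqr_integrable mA mg g2.
have Ifg := mul_integrable mA mf mg f2 g2.
have Icf : mu.-integrable A (fun x => (c * f x ^+ 2)%:E).
  by apply: (eq_integrable mA _ _ _ (integrableZl mA c If)).
have Icg : mu.-integrable A (fun x => (c^-1 * g x ^+ 2)%:E).
  by apply: (eq_integrable mA _ _ _ (integrableZl mA c^-1 Ig)).
apply: (le_trans (le_normr_Rintegral mA Ifg)).
rewrite -!RintegralZl// -RintegralD//.
apply: le_Rintegral => //.
- exact: integrable_norm Ifg.
- by apply: (eq_integrable mA _ _ _ (integrableD mA Icf Icg)).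
move=> x _ /=; set u := f x; set v := g x.
(* Rescaling [v] clears the quotient: after division by [c] the claim is |u w| <= u^2 + w^2. *)
have [w ->] : exists w, v = c * w.
  by exists (c^-1 * v); rewrite mulrA mulfV ?mul1r ?gt_eqF.
have -> : c * u ^+ 2 + c^-1 * (c * w) ^+ 2 = c * (u ^+ 2 + w ^+ 2).
  by clear - c0; field; rewrite gt_eqF.
rewrite mulrCA ler_norml -mulrN !ler_pM2l//.
by clear; apply/andP; split; nra.
Qed.

(** The functions [h n] themselves need not be square integrable. Eventually [h n - r] is, and
    [g * h n] is split as [g * (h n - r) + g * r]. *)
Lemma Rintegral_pairing_cvg A g r (h : nat -> X -> R) : measurable A ->
  measurable_fun A g -> measurable_fun A r ->
  (forall n, measurable_fun A (h n)) ->
  (\int[mu]_(x in A) (g x ^+ 2)%:E < +oo)%E ->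
  (\int[mu]_(x in A) (r x ^+ 2)%:E < +oo)%E ->
  (fun n => \int[mu]_(x in A) ((h n x - r x) ^+ 2)%:E)%E @ \oo --> 0%E ->
  (fun n => \int[mu]_(x in A) (g x * h n x)) @ \oo -->
    \int[mu]_(x in A) (g x * r x).
Proof.
move=> mA mg mr mh g2 r2 /fine_cvgP[fin cv].
suff main (e : R) : 0 < e -> \forall n \near \oo,
    `|\int[mu]_(x in A) (g x * r x) - \int[mu]_(x in A) (g x * h n x)| < e.
  by apply/cvgrPdist_lt => e; exact: main.
move=> e0.
pose G := \int[mu]_(x in A) (g x ^+ 2).
have G0 : 0 <= G by apply: Rintegral_ge0 => x _; exact: sqr_ge0.
have [c c0 cG] : exists2 c : R, 0 < c & c * G < e / 2.
  (* The summand 1 covers the case [G = 0]. *)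
  clear - G0 e0; exists (e / (2 * (G + 1))).
    by rewrite divr_gt0// mulr_gt0//; lra.
  rewrite [X in _ < X](_ : e / 2 = e / (2 * (G + 1)) * (G + 1)); last by field; lra.
  by rewrite ltr_pM2l ?divr_gt0 ?mulr_gt0//; lra.
have ce : 0 < c * (e / 2) by rewrite mulr_gt0// divr_gt0.
move/cvgrPdist_lt : cv => /(_ _ ce) cv.
near=> n.
have fn : (\int[mu]_(x in A) ((h n x - r x) ^+ 2)%:E)%E \is a fin_num by near: n.
have dn : `|0 - fine (\int[mu]_(x in A) ((h n x - r x) ^+ 2)%:E)%E| < c * (e / 2).
  by near: n.
have mhr : measurable_fun A (fun x => h n x - r x) by exact: measurable_funB.
have hr2 : (\int[mu]_(x in A) ((h n x - r x) ^+ 2)%:E < +oo)%E.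
  by move: fn; rewrite ge0_fin_numE// integral_ge0// => x _; rewrite lee_fin sqr_ge0.
have Igr := mul_integrable mA mg mr g2 r2.
have Ighr := mul_integrable mA mg mhr g2 hr2.
have -> : \int[mu]_(x in A) (g x * h n x) =
    \int[mu]_(x in A) (g x * (h n x - r x)) + \int[mu]_(x in A) (g x * r x).
  rewrite -RintegralD//; apply: eq_Rintegral => x _ /=; clear; ring.
rewrite opprD addrCA subrr addr0 normrN.
apply: (le_lt_trans (Rintegral_pairing_bound mA c0 mg mhr g2 hr2)).
rewrite -/G.
have : c^-1 * \int[mu]_(x in A) ((h n x - r x) ^+ 2) < e / 2.
  rewrite mulrC ltr_pdivrMr// [X in _ < X]mulrC.
  by apply: le_lt_trans dn; rewrite sub0r normrN ler_norm.
clear - cG; lra.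
Unshelve. all: by end_near. Qed.

End L2Pairing.

(** * Bump functions on the line *)

Section Bump.
Variable R : realType.
Implicit Types x y r : R.

(** At 0 the difference quotient is at most [|h| ^+ n.+1] in absolute value, which tends to 0 since
    the exponent is positive. *)
Lemma is_derive_pos_part_exp n x :
  is_derive x 1 (fun y : R => Num.max y 0 ^+ n.+2)
    (n.+2%:R * Num.max x 0 ^+ n.+1).
Proof.
have [x0|x0|->] := ltgtP x 0.
- rewrite expr0n/= mulr0.
  apply: (near_eq_is_derive (f := cst (0 : R) : R -> R)).
  near=> y; rewrite max_r ?expr0n//.
  by apply: ltW; near: y; exact: lt_nbhsl.
-
  apply: (near_eq_is_derive (f := fun y : R => y ^+ n.+2)).
    near=> y; rewrite max_l//.
    by apply: ltW; near: y; exact: lt_nbhsr.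
  have D := is_deriveX n.+2 (is_derive_id x (1 : R)).
  rewrite exprfctE /= in D; apply: (is_derive_eq D).
  by rewrite /GRing.scale/= mulr1.
- rewrite expr0n/= mulr0.
  suff cv : (fun h : R => h^-1 *: (Num.max (h *: (1 : R) + 0) 0 ^+ n.+2 - Num.max 0 0 ^+ n.+2) : R)
     @ 0^' --> (0 : R).
    by split; [apply: cvgP cv | apply: cvg_lim cv].
  suff main (e : R) : 0 < e -> \forall h \near (0 : R)^',
      `|0 - h^-1 *: (Num.max (h *: (1 : R) + 0) 0 ^+ n.+2 - Num.max 0 0 ^+ n.+2)| < e.
    by apply/cvgrPdist_lt => e; exact: main.
  move=> e0; near=> h.
  have h0 : h != 0 by near: h; exact: nbhs_dnbhs_neq.
  have h1 : `|h| < Num.min 1 e.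
    by near: h; apply: dnbhs0_lt; rewrite lt_min ltr01.
  move: h1; rewrite lt_min => /andP[h1 he].
  rewrite sub0r normrN maxxx expr0n/= subr0 addr0 /GRing.scale/= mulr1 normrM normfV.
  rewrite ltr_pdivrMl ?normr_gt0// normrX.
  apply: (@le_lt_trans _ _ (`|h| ^+ n.+2)).
    rewrite lerXn2r ?nnegrE//; case: (leP h 0) => _; rewrite ?normr0 ?normr_ge0//.
  rewrite exprS ltr_pM2l ?normr_gt0//; apply: le_lt_trans he.
  by rewrite exprS ler_piMr// exprn_ile1// ltW.
Unshelve. all: by end_near. Qed.

(** The bump is the cube of the positive part of [r ^+ 2 - x ^+ 2]: the lowest power whose second
    derivative is continuous. *)
Lemma bump_exists (r : R) : 0 < r -> exists f f1 f2 : R -> R,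
  [/\ forall x, is_derive x 1 f (f1 x), forall x, is_derive x 1 f1 (f2 x),
      continuous f2,
      forall x, r <= `|x| -> [/\ f x = 0, f1 x = 0 & f2 x = 0] &
      (forall x, [/\ f (- x) = f x, f1 (- x) = - f1 x & f2 (- x) = f2 x]) /\
      0 < f 0 ].
Proof.
move=> r0; pose p n x : R := Num.max x 0 ^+ n.
pose q x : R := r ^+ 2 - x ^+ 2.
have dq x : is_derive x 1 q (- (2 * x)).
  have D := is_deriveB (is_derive_cst (r ^+ 2) x (1:R)) (is_deriveX 2 (is_derive_id x (1 : R))).
  rewrite exprfctE /= in D; apply: (is_derive_eq D).
  by rewrite /GRing.scale/= mulr1 sub0r.
exists (fun x => p 3%N (q x)), (fun x => (- 6 * x) * p 2%N (q x)),
  (fun x => - 6 * p 2%N (q x) + 24 * x ^+ 2 * p 1%N (q x)).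
split.
- move=> x.
  have D := is_derive1_comp (is_derive_pos_part_exp 1 (q x)) (dq x).
  by apply: (is_derive_eq D); rewrite /p /GRing.scale/=; ring.
- move=> x.
  have D2 := is_derive1_comp (is_derive_pos_part_exp 0 (q x)) (dq x).
  have D := is_deriveM (is_deriveZ (- 6) (is_derive_id x (1 : R))) D2.
  by apply: (is_derive_eq D); rewrite /p /= -[- 6 *: x]/(- 6 * x) /GRing.scale/=; ring.
- have cq : continuous q.
    move=> x; apply: differentiable_continuous; apply/derivable1_diffP.
    by have [] := dq x.
  have cp1 : continuous (fun x => p 1%N (q x)).
    by move=> x; apply: (continuous_max (cq x)); exact: cvg_cst.
  have cp2 : continuous (fun x => p 2%N (q x)) by move=> x; apply: cvgM; exact: cp1.
  move=> x; apply: cvgD; apply: cvgM; [exact: cvg_cst|exact: cp2| |exact: cp1].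
  by apply: cvgM; [exact: cvg_cst|exact: exprn_continuous].
- move=> x rx.
  have pq n : p n.+1 (q x) = 0.
     rewrite /p max_r ?expr0n// /q subr_le0 -(real_normK (num_real x)).
    by rewrite ler_sqr ?nnegrE// ltW.
  by rewrite !pq !mulr0 addr0.
- rewrite /p /q; split=> [x|]; first by rewrite !sqrrN mulrN mulNr.
  by rewrite expr0n/= subr0 exprn_gt0// lt_max exprn_gt0.
Qed.

End Bump.

(** * C^1 functions on the plane *)

Section PlaneC1.
Variable R : realType.
Implicit Types (f g h : plane R -> R) (x v o e n : plane R).

Lemma C1_of_partials f f1 f2 :
  (forall x, is_diff x f (fun v => v.1 * f1 x + v.2 * f2 x)) ->
  continuous f1 -> continuous f2 ->
  C1 f /\ forall v x, 'D_v f x = v.1 * f1 x + v.2 * f2 x.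
Proof.
move=> df c1 c2.
have dfE v x : 'D_v f x = v.1 * f1 x + v.2 * f2 x.
  by rewrite deriveE//; have [_ ->] := df x.
split=> //; split=> [x|v]; first by have [] := df x.
rewrite (_ : (fun x => 'D_v f x) = (fun x => v.1 * f1 x + v.2 * f2 x)).
  move=> x; apply: cvgD; apply: cvgM; try exact: cvg_cst; [exact: c1|exact: c2].
by apply/funext => x; exact: dfE.
Qed.

Lemma C1_deriveE f v x : C1 f ->
  'D_v f x = v.1 * 'D_(dx R) f x + v.2 * 'D_(dy R) f x.
Proof.
move=> [df _]; rewrite !deriveE//.
have -> : v = v.1 *: dx R + v.2 *: dy R :> plane R.
  by rewrite [LHS]surjective_pairing [RHS]surjective_pairing; congr pair;
    rewrite /dx/dy /= /GRing.scale/= !(mulr1, mulr0) ?addr0 ?add0r.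
rewrite linearD !linearZ /= /GRing.scale/= !(mulr1, mulr0, addr0, add0r).
by [].
Qed.

Lemma C1_continuous f : C1 f -> continuous f.
Proof. by move=> [df _] x; exact: differentiable_continuous. Qed.

Lemma derive_locally0 f v (U : set (plane R)) x :
  open U -> (forall y, U y -> f y = 0) -> U x -> 'D_v f x = 0.
Proof.
move=> oU f0 Ux; have fc : \near x, f x = cst 0 x.
  by near=> y; rewrite f0//; near: y; exact: open_nbhs_nbhs.
by rewrite (near_eq_derive v fc) derive_cst.
Unshelve. all: by end_near. Qed.

Lemma C1M f g : C1 f -> C1 g -> C1 (fun x => f x * g x) /\
  forall v x, 'D_v (fun x => f x * g x) x = 'D_v f x * g x + f x * 'D_v g x.
Proof.
move=> cf cg.
have [df pf] := cf; have [dg pg] := cg.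
have dE v x : 'D_v (fun x => f x * g x) x = 'D_v f x * g x + f x * 'D_v g x.
  rewrite (_ : (fun x => _) = f * g) // deriveM; [|exact: diff_derivable..].
  by rewrite /GRing.scale/= addrC mulrC.
split=> //; split=> [x|v].
  exact: (differentiableM (df x) (dg x)).
rewrite (_ : (fun x => 'D_v _ x) = (fun x => 'D_v f x * g x + f x * 'D_v g x)).
  by move=> x; apply: cvgD; apply: cvgM; [exact: pf|exact: C1_continuous|
    exact: C1_continuous|exact: pg].
by apply/funext => x; exact: dE.
Qed.

Lemma chart_lineE o e n (s t k : R) :
  chart o e n (s, k + t) = k *: n + chart o e n (s, t).
Proof. by rewrite /chart /= scalerDl addrCA. Qed.

Lemma is_derive_chart f o e n (s t : R) : C1 f ->
  is_derive t 1 (fun t : R => f (chart o e n (s, t))) ('D_n f (chart o e n (s, t))).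
Proof.
move=> [df _].
have [cv De] : is_derive (chart o e n (s, t)) n f ('D_n f (chart o e n (s, t))).
  by apply/derivableP; exact: diff_derivable.
have E : (fun h : R => h^-1 *: ((fun t : R => f (chart o e n (s, t))) (h *: (1:R) + t) -
   f (chart o e n (s, t)))) =
   (fun h : R => h^-1 *: (f (h *: n + chart o e n (s, t)) - f (chart o e n (s, t)))).
  by apply/funext => h; rewrite -chart_lineE [h *: 1]mulr1.
split; first by rewrite /derivable /= E.
by rewrite /derive /= E.
Qed.

Lemma chart_continuous o e n : continuous (chart o e n).
Proof.
move=> x; rewrite /chart; apply: cvgD.
  apply: cvgD; first exact: cvg_cst.
  by apply: cvgZr_tmp; exact: cvg_fst.
by apply: cvgZr_tmp; exact: cvg_snd.
Qed.

End PlaneC1.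

(** * Functions of bounded support *)

Section RobinTest.
Variable R : realType.
Local Notation mR := (measurableTypeR R).
Local Notation leb2 := (@Defs.leb2 R).
Implicit Types (f g h b lb : plane R -> R) (W A : set (plane R)).
Implicit Types (s : seq (plane R * plane R)) (pq : plane R * plane R).

(** Expressed by [dot x x], which orthonormal charts centred at 0 preserve and whose superlevel sets
    are open, so that derivatives inherit the property. *)
Definition bounded_support f := exists M : R, forall x, M < dot x x -> f x = 0.

Lemma bounded_support_box f : bounded_support f -> exists2 M : R, 0 < M &
  forall x, ~ (`[- M, M]%classic `*` `[- M, M]%classic) x -> f x = 0.
Proof.
move=> [M fM]; exists (`|M| + 1) => [|x nx]; first by have := normr_ge0 M; lra.
apply: fM; apply: contrapT => /negP; rewrite -leNgt /dot => xM; apply: nx.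
have := ler_norm M; have := normr_ge0 M; set m := `|M| => m0 Mm.
by split; rewrite /= in_itv/=; apply/andP; split; nra.
Qed.

Lemma bounded_support_integrable f A : continuous f -> bounded_support f ->
  measurable (A : set (mR * mR)) -> leb2.-integrable A (EFin \o f).
Proof.
move=> cf /bounded_support_box[M M0 fM] mA.
apply: (@integrableS _ _ _ leb2 setT A) => //.
have mB : measurable (`[- M, M]%classic `*` `[- M, M]%classic : set (mR * mR)).
  exact: measurableX.
rewrite (_ : EFin \o f = (EFin \o f) \_ (`[- M, M]%classic `*` `[- M, M]%classic)).
  apply/(integrable_mkcond _ mB).
  by apply: (continuous_plane_integrable cf mB (a := - M) (b := M) (c := - M) (d := M)) => x.
apply/funext => x; rewrite patchE; case: ifPn => // /negP nx /=.
by rewrite fM// => Bx; apply: nx; rewrite inE.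
Qed.

Lemma bounded_supportM f g : bounded_support f -> bounded_support (fun x => f x * g x).
Proof. by move=> [M fM]; exists M => x /fM ->; rewrite mul0r. Qed.

Lemma bounded_support_sqr f A : continuous f -> bounded_support f ->
  measurable (A : set (mR * mR)) -> (\int[leb2]_(x in A) (f x ^+ 2)%:E < +oo)%E.
Proof.
move=> cf sf mA.
have cff : continuous (fun x => f x * f x) by move=> x; apply: cvgM; exact: cf.
have /integrableP[_] := bounded_support_integrable cff (bounded_supportM f sf) mA.
apply: le_lt_trans; apply: ge0_le_integral => //.
- by move=> x _; rewrite lee_fin sqr_ge0.
- apply/measurable_EFinP; apply: measurable_funX.
  exact: continuous_plane_measurable.
- apply: measurableT_comp => //; apply/measurable_EFinP.
  exact: continuous_plane_measurable.
- by move=> x _; rewrite /= lee_fin -expr2 ler_norm.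
Qed.

Lemma dot_continuous : continuous (fun x : plane R => dot x x).
Proof.
by move=> x; rewrite /dot; apply: cvgD; apply: cvgM;
  [exact: cvg_fst|exact: cvg_fst|exact: cvg_snd|exact: cvg_snd].
Qed.

Lemma open_dot_gt (M : R) : open [set x : plane R | M < dot x x].
Proof. by move/continuousP: dot_continuous => /(_ [set y | M < y]); apply; exact: open_gt. Qed.

Lemma bounded_support_derive f v : bounded_support f -> bounded_support (fun x => 'D_v f x).
Proof.
move=> [M fM]; exists M => x Mx.
apply: (@derive_locally0 _ _ _ [set x | M < dot x x]) => //.
exact: open_dot_gt.
Qed.

Lemma chart0_dot (e n x : plane R) : orthonormal_pair e n ->
  dot (chart 0 e n x) (chart 0 e n x) = dot x x.
Proof.
case: e n x => [e1 e2] [n1 n2] [x y]; rewrite /orthonormal_pair /chart /dot/= => -[ee nn en].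
rewrite /GRing.scale/= !add0r.
transitivity (x * x * (e1 * e1 + e2 * e2) + y * y * (n1 * n1 + n2 * n2) +
   2 * x * y * (e1 * n1 + e2 * n2)); first by ring.
by rewrite ee nn en; ring.
Qed.

(** In the chart whose second axis is [n], every slice integrates to a difference of two values of
    [f] off its support. *)
Lemma Rintegral_derive0 f (e n : plane R) : orthonormal_pair e n ->
  C1 f -> bounded_support f -> Rintegral leb2 setT (fun x => 'D_n f x) = 0.
Proof.
move=> en cf bf.
(* Since [M >= 1], also [M ^+ 2] exceeds [M0], so the box of half-width [M] contains the support. *)
have [M0 fM0] := bf; pose M := `|M0| + 1.
have M1 : 1 <= M by rewrite /M; have := normr_ge0 M0; lra.
have fM x : M ^+ 2 <= dot x x -> f x = 0.
  move=> xM; apply: fM0; apply: lt_le_trans xM.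
  by move: M1; rewrite /M; have := ler_norm M0; nra.
have cD : continuous (fun x => 'D_n f x) by have [] := cf.
have mp := chart_measure_preserving 0 en.
rewrite (Rintegral_measure_preserving mp) //; last first.
  exact: continuous_plane_measurable.
rewrite preimage_setT.
pose B : set (mR * mR) := `[- M, M]%classic `*` `]- M, M]%classic.
have -> : \int[leb2]_x ((fun x => 'D_n f x) \o chart 0 e n) x =
    \int[leb2]_(x in B) ((fun x => 'D_n f x) \o chart 0 e n) x.
  rewrite [RHS]Rintegral_mkcond; congr (Rintegral _ _ _); apply/funext => x.
  rewrite patchE; case: ifPn => // /negP nx.
  have DM y : M ^+ 2 <= dot y y -> 'D_n f y = 0.
    move=> yM; have [M' fM'] := bounded_support_derive n bf.
    apply: (@derive_locally0 _ _ _ [set x | M0 < dot x x]) => //.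
      exact: open_dot_gt.
    apply: lt_le_trans yM.
    by move: M1; rewrite /M; have := ler_norm M0; nra.
  apply: DM; rewrite chart0_dot// leNgt; apply/negP => xM; apply: nx.
  rewrite inE /B; move: xM; rewrite /dot => xM.
  by split; rewrite /= in_itv/=; apply/andP; split; nra.
have M0' : - M < M by lra.
have cc := @chart_continuous R 0 e n.
have cF : continuous (f \o chart 0 e n).
  by move=> x; apply: continuous_comp; [exact: cc|exact: C1_continuous].
have cG : continuous ((fun x => 'D_n f x) \o chart 0 e n).
  by move=> x; apply: continuous_comp; [exact: cc|exact: cD].
have mI : measurable (`[- M, M]%classic : set mR) by exact: measurable_itv.
rewrite (Rintegral_box_FTC M0' mI (fun x xM => xM) cF cG (fun x y => is_derive_chart 0 e n x y cf)).
rewrite (@eq_Rintegral _ _ _ _ _ (fun=> 0)); first by rewrite Rintegral_cst// mul0r.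
by move=> x _ /=; rewrite !fM ?subr0// chart0_dot// /dot/=; nra.
Qed.

End RobinTest.

(** * Robin test functions *)

Section RobinTestPairing.
Variable R : realType.
Local Notation mu := (@lebesgue_measure R).
Local Notation mR := (measurableTypeR R).
Local Notation leb2 := (@Defs.leb2 R).
Local Notation dx := (Defs.dx R).
Local Notation dy := (Defs.dy R).
Local Notation I01 := (@unit_interval R).
Implicit Types (f g h b lb u p q r : plane R -> R) (W A : set (plane R)).
Implicit Types (s : seq (plane R * plane R)) (pq : plane R * plane R).

(* Green's identity for [b] with Laplacian [lb].  Testing against C^1 functions
   suffices, as they approximate an [H1] function together with its trace. *)
Definition robin_test W s (beta : R) b lb : Prop :=
  [/\ C1 b, continuous lb, bounded_support b, bounded_support lb &
   forall h, C1 h ->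
     \int[leb2]_(x in W) ('D_dx b x * 'D_dx h x + 'D_dy b x * 'D_dy h x) +
     beta * (\sum_(pq <- s) side_length pq *
        \int[mu]_(t in I01) (b (seg pq.1 pq.2 t) * h (seg pq.1 pq.2 t))) +
     \int[leb2]_(x in W) (lb x * h x) = 0].

Definition real_L2 d (X : measurableType d) (nu : {measure set X -> \bar R})
    (A : set X) (f : X -> R) :=
  measurable_fun A f /\ (\int[nu]_(x in A) (f x ^+ 2)%:E < +oo)%E.

Definition sqdist d (X : measurableType d) (nu : {measure set X -> \bar R})
    (A : set X) (f g : X -> R) : \bar R :=
  (\int[nu]_(x in A) ((f x - g x) ^+ 2)%:E)%E.

(* The real or imaginary part of an element of [H1], with gradient [(p, q)] and
   trace [r]. *)
Definition real_H1 W s u p q r : Prop :=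
  [/\ real_L2 leb2 W u, real_L2 leb2 W p, real_L2 leb2 W q,
      forall pq, pq \in s -> real_L2 mu I01 (r \o seg pq.1 pq.2) &
      exists h : nat -> plane R -> R, (forall n, C1 (h n)) /\
      [/\ (fun n => sqdist leb2 W (h n) u) @ \oo --> 0%E,
          (fun n => sqdist leb2 W (fun x => 'D_dx (h n) x) p) @ \oo --> 0%E,
          (fun n => sqdist leb2 W (fun x => 'D_dy (h n) x) q) @ \oo --> 0%E &
          forall pq, pq \in s -> 0 < side_length pq ->
          (fun n => sqdist mu I01 (h n \o seg pq.1 pq.2) (r \o seg pq.1 pq.2))
             @ \oo --> 0%E]].

Lemma seg_continuous (p q : plane R) : continuous (seg p q).
Proof.
move=> t; rewrite /seg; apply: cvgD; first exact: cvg_cst.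
by apply: cvgZr_tmp; exact: cvg_id.
Qed.

Lemma side_real_L2 f pq : continuous f -> real_L2 mu I01 (f \o seg pq.1 pq.2).
Proof.
move=> cf; have cfs : continuous (f \o seg pq.1 pq.2).
  by move=> t; apply: continuous_comp; [exact: seg_continuous|exact: cf].
have mf : measurable_fun I01 (f \o seg pq.1 pq.2).
  by apply: (measurable_funS measurableT) => //; exact: continuous_measurable_fun.
split=> //.
have cf2 : {within I01, continuous (fun t => (f \o seg pq.1 pq.2) t ^+ 2 : R^o)}.
  by apply: continuous_subspaceT => t; apply: cvgM; exact: cfs.
have /integrableP[_] := continuous_compact_integrable (@segment_compact _ 0 1) cf2.
apply: le_lt_trans; rewrite le_eqVlt; apply/orP; left; apply/eqP; apply: eq_integral => t _.
by rewrite gee0_abs //= lee_fin sqr_ge0.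
Qed.

Lemma C1_real_L2 f v A : C1 f -> bounded_support f ->
  measurable (A : set (mR * mR)) -> real_L2 leb2 A (fun x => 'D_v f x).
Proof.
move=> cf bf mA; have cD : continuous (fun x => 'D_v f x) by have [] := cf.
split; first exact: continuous_plane_measurable.
by apply: bounded_support_sqr => //; exact: bounded_support_derive.
Qed.

(* The directions are kept abstract: unification would otherwise unfold the
   real numbers to compare [dx] with [dy]. *)
Lemma green_pairing (v1 v2 : plane R) W s beta b lb u p q r
    (h : nat -> plane R -> R) :
  measurable (W : set (mR * mR)) ->
  C1 b -> continuous lb -> bounded_support b -> bounded_support lb ->
  (forall h, C1 h ->
     \int[leb2]_(x in W) ('D_v1 b x * 'D_v1 h x + 'D_v2 b x * 'D_v2 h x) +
     beta * (\sum_(pq <- s) side_length pq *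
        \int[mu]_(t in I01) (b (seg pq.1 pq.2 t) * h (seg pq.1 pq.2 t))) +
     \int[leb2]_(x in W) (lb x * h x) = 0) ->
  real_L2 leb2 W u -> real_L2 leb2 W p -> real_L2 leb2 W q ->
  (forall pq, pq \in s -> real_L2 mu I01 (r \o seg pq.1 pq.2)) ->
  (forall n, C1 (h n)) ->
  (fun n => sqdist leb2 W (h n) u) @ \oo --> 0%E ->
  (fun n => sqdist leb2 W (fun x => 'D_v1 (h n) x) p) @ \oo --> 0%E ->
  (fun n => sqdist leb2 W (fun x => 'D_v2 (h n) x) q) @ \oo --> 0%E ->
  (forall pq, pq \in s -> 0 < side_length pq ->
     (fun n => sqdist mu I01 (h n \o seg pq.1 pq.2) (r \o seg pq.1 pq.2))
       @ \oo --> 0%E) ->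
  \int[leb2]_(x in W) ('D_v1 b x * p x + 'D_v2 b x * q x) +
  beta * (\sum_(pq <- s) side_length pq *
     \int[mu]_(t in I01) (b (seg pq.1 pq.2 t) * r (seg pq.1 pq.2 t))) +
  \int[leb2]_(x in W) (lb x * u x) = 0.
Proof.
move=> mW cb clb bb blb green [mu_ u2] [mp p2] [mq q2] rs ch hu hp hq hr.
have [mbx bx2] := C1_real_L2 v1 cb bb mW.
have [mby by2] := C1_real_L2 v2 cb bb mW.
have mlb := continuous_plane_measurable mW clb.
have lb2 := bounded_support_sqr clb blb mW.
have cDx : continuous (fun x => 'D_v1 b x) by exact: cb.2.
have cDy : continuous (fun x => 'D_v2 b x) by exact: cb.2.
rewrite (RintegralD mW (mul_integrable mW mbx mp bx2 p2) (mul_integrable mW mby mq by2 q2)).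
(* Green's identity for [h n], with the gradient term split so that each summand pairs a fixed
   function with a sequence convergent in L_2. *)
pose J n := \int[leb2]_(x in W) ('D_v1 b x * 'D_v1 (h n) x) +
  \int[leb2]_(x in W) ('D_v2 b x * 'D_v2 (h n) x) +
  beta * (\sum_(pq <- s) side_length pq *
     \int[mu]_(t in I01) (b (seg pq.1 pq.2 t) * h n (seg pq.1 pq.2 t))) +
  \int[leb2]_(x in W) (lb x * h n x).
have J0 n : J n = 0.
  have i1 : leb2.-integrable W (EFin \o (fun x => 'D_v1 b x * 'D_v1 (h n) x)).
    apply: bounded_support_integrable mW; last first.
      by apply: bounded_supportM; exact: bounded_support_derive.
    by move=> x; apply: cvgM; [exact: cDx|exact: (ch n).2].
  have i2 : leb2.-integrable W (EFin \o (fun x => 'D_v2 b x * 'D_v2 (h n) x)).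
    apply: bounded_support_integrable mW; last first.
      by apply: bounded_supportM; exact: bounded_support_derive.
    by move=> x; apply: cvgM; [exact: cDy|exact: (ch n).2].
  by rewrite -[RHS](green _ (ch n)) /J (RintegralD mW i1 i2).
have mh n : measurable_fun W (h n : mR * mR -> mR).
  by apply: continuous_plane_measurable mW _; exact: C1_continuous.
have mD v n : measurable_fun W ((fun x => 'D_v (h n) x) : mR * mR -> mR).
  by apply: continuous_plane_measurable mW _; exact: (ch n).2.
have cJ : J @ \oo --> \int[leb2]_(x in W) ('D_v1 b x * p x) +
  \int[leb2]_(x in W) ('D_v2 b x * q x) +
  beta * (\sum_(pq <- s) side_length pq *
     \int[mu]_(t in I01) (b (seg pq.1 pq.2 t) * r (seg pq.1 pq.2 t))) +
  \int[leb2]_(x in W) (lb x * u x).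
  apply: cvgD; last exact: Rintegral_pairing_cvg mW mlb mu_ mh lb2 u2 hu.
  apply: cvgD.
    apply: cvgD.
      exact: Rintegral_pairing_cvg mW mbx mp (mD v1) bx2 p2 hp.
    exact: Rintegral_pairing_cvg mW mby mq (mD v2) by2 q2 hq.
  apply: cvgM; first exact: cvg_cst.
  under eq_fun do rewrite big_seq.
  rewrite big_seq.
  apply: cvg_big => [|pq pqs]; first exact: add_continuous.
  (* On a degenerate side no convergence is known, but its weight in the sum is 0. *)
  have [L0|L0] := eqVneq (side_length pq) 0.
    by under eq_fun do rewrite L0 mul0r; rewrite L0 mul0r; exact: cvg_cst.
  have {}L0 : 0 < side_length pq by rewrite lt_def L0 sqrtr_ge0.
  apply: cvgM; first exact: cvg_cst.
  have [mb b2] := side_real_L2 pq (C1_continuous cb).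
  have [mr r2] := rs _ pqs.
  have mI : measurable (I01 : set mR) by exact: measurable_itv.
  have mhs n : measurable_fun I01 (h n \o seg pq.1 pq.2).
    by have [] := side_real_L2 pq (C1_continuous (ch n)).
  exact: (Rintegral_pairing_cvg mI mb mr mhs b2 r2 (hr _ pqs L0)).
have J00 : J = cst 0 by exact/funext.
rewrite J00 in cJ.
exact: (cvg_unique _ cJ (cvg_cst 0)).
Qed.


Lemma robin_test_pairing W s beta b lb u p q r :
  measurable (W : set (mR * mR)) -> robin_test W s beta b lb ->
  real_H1 W s u p q r ->
  \int[leb2]_(x in W) ('D_dx b x * p x + 'D_dy b x * q x) +
  beta * (\sum_(pq <- s) side_length pq *
     \int[mu]_(t in I01) (b (seg pq.1 pq.2 t) * r (seg pq.1 pq.2 t))) +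
  \int[leb2]_(x in W) (lb x * u x) = 0.
Proof.
move=> mW [cb clb bb blb green] [hu hp hq rs [h [ch [cu cp cq cr]]]].
exact: (green_pairing mW cb clb bb blb green hu hp hq rs ch cu cp cq cr).
Qed.

(** Integration by parts: the derivative of [f * phi] integrates to 0 over the plane, and outside
    [W] both [phi] and its derivative vanish. *)
Lemma weak_derivative_C1 W f (e n : plane R) : open W -> orthonormal_pair e n ->
  C1 f -> bounded_support f ->
  weak_derivative W n (fun x => (f x)%:C%C) (fun x => ('D_n f x)%:C%C).
Proof.
move=> oW en cf bf phi [cphi kphi phiW].
have mW := open_plane_measurable oW.
pose K := closure [set x | phi x != 0].
have phi0 x : ~ K x -> phi x = 0.
  by move=> nK; apply: contrapT => px; apply: nK; apply: subset_closure; exact/eqP.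
have Dphi0 x : ~ K x -> 'D_n phi x = 0.
  move=> nK; apply: (@derive_locally0 _ _ _ (~` K)) => //.
  by apply: closed_openC; exact: closed_closure.
have [cfp dfp] := C1M cf cphi.
have bfp : bounded_support (fun x => f x * phi x) by exact: bounded_supportM.
have := Rintegral_derive0 en cfp bfp.
have cD1 : continuous (fun x => f x * 'D_n phi x).
  by move=> x; apply: cvgM; [exact: C1_continuous|have [_] := cphi; apply].
have cD2 : continuous (fun x => 'D_n f x * phi x).
  by move=> x; apply: cvgM; [have [_] := cf; apply|exact: C1_continuous].
have i1 : leb2.-integrable setT (EFin \o (fun x => f x * 'D_n phi x)).
  by apply: bounded_support_integrable => //; exact: bounded_supportM.
have i2 : leb2.-integrable setT (EFin \o (fun x => 'D_n f x * phi x)).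
  apply: bounded_support_integrable => //; apply: bounded_supportM.
  exact: bounded_support_derive.
have toW (F : plane R -> R) : (forall x, ~ K x -> F x = 0) ->
    \int[leb2]_(x in W) F x = \int[leb2]_x F x.
  move=> F0; rewrite Rintegral_mkcond; congr (Rintegral _ _ _); apply/funext => x.
  rewrite patchE; case: ifPn => // /negP nW; rewrite F0// => Kx.
  by apply: nW; rewrite inE; exact: phiW.
move=> d0.
have : \int[leb2]_x ('D_n f x * phi x + f x * 'D_n phi x) = 0.
  by rewrite -[RHS]d0; apply: eq_Rintegral => x _; rewrite dfp.
rewrite RintegralD// -(toW (fun x => f x * _)); last first.
  by move=> x nK; rewrite Dphi0// mulr0.
rewrite -(toW (fun x => _ * phi x)) => [eq0|x nK]; last by rewrite phi0// mulr0.
have cE (F G : plane R -> R) :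
    cintegral leb2 W (fun x => (F x)%:C%C * (G x)%:C%C) =
    (\int[leb2]_(x in W) (F x * G x))%:C%C.
  rewrite /cintegral; congr (_ +i* _)%C.
    by apply: eq_Rintegral => x _; rewrite /= mulr0 subr0.
  rewrite (@eq_Rintegral _ _ _ _ _ (fun=> 0)); first by rewrite Rintegral_cst// mul0r.
  by move=> x _; rewrite /= mulr0 mul0r addr0.
rewrite !cE -rmorphN; congr (_%:C)%C.
by apply/eqP; rewrite -addr_eq0 addrC; apply/eqP.
Qed.

End RobinTestPairing.

(** * Real and imaginary parts *)

Section ComplexPairing.
Variable R : realType.
Local Notation mu := (@lebesgue_measure R).
Local Notation mR := (measurableTypeR R).
Local Notation leb2 := (@Defs.leb2 R).
Local Notation I01 := (@unit_interval R).
Local Open Scope complex_scope.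
Implicit Types (b lb : plane R -> R) (W A : set (plane R)).
Implicit Types (s : seq (plane R * plane R)) (pq : plane R * plane R) (w z : sobolev_data R).

Lemma ReMconj (z : R[i]) (r : R) :
  complex.Re (z * (r%:C)^*) = complex.Re z * r /\
  complex.Im (z * (r%:C)^*) = complex.Im z * r.
Proof. by case: z => x y /=; split; ring. Qed.

Lemma ReconjM (z : R[i]) (r : R) :
  complex.Re (r%:C * z^*) = r * complex.Re z /\
  complex.Im (r%:C * z^*) = - (r * complex.Im z).
Proof. by case: z => x y /=; split; ring. Qed.

Lemma ReD (z t : R[i]) : complex.Re (z + t) = complex.Re z + complex.Re t.
Proof. by case: z; case: t. Qed.

Lemma ImD (z t : R[i]) : complex.Im (z + t) = complex.Im z + complex.Im t.
Proof. by case: z; case: t. Qed.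

Lemma ReB (z t : R[i]) : complex.Re (z - t) = complex.Re z - complex.Re t.
Proof. by case: z; case: t. Qed.

Lemma ImB (z t : R[i]) : complex.Im (z - t) = complex.Im z - complex.Im t.
Proof. by case: z; case: t. Qed.

Lemma ReIm_sum (I : Type) (r : seq I) (F : I -> R[i]) :
  complex.Re (\sum_(i <- r) F i) = \sum_(i <- r) complex.Re (F i) /\
  complex.Im (\sum_(i <- r) F i) = \sum_(i <- r) complex.Im (F i).
Proof.
elim: r => [|i r [IH1 IH2]]; first by rewrite !big_nil.
by rewrite !big_cons ReD ImD IH1 IH2.
Qed.

(** The Boolean index lets one argument serve real and imaginary parts. *)
Definition component (im : bool) (c : R[i]) : R :=
  if im then complex.Im c else complex.Re c.

Section Components.
Context (d : measure_display) (X : measurableType d).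
Variable nu : {measure set X -> \bar R}.
Implicit Types (D : set X) (f g : X -> R[i]).

Lemma component_sqr_le im (c : R[i]) : component im c ^+ 2 <= abs2 c.
Proof. by case: im; rewrite /abs2 /= ?lerDl ?lerDr sqr_ge0. Qed.

Lemma measurable_abs2 D f : measurable D ->
  (forall im, measurable_fun D (component im \o f)) ->
  measurable_fun D (fun x => abs2 (f x)).
Proof.
by move=> mD mf; apply: measurable_funD; apply: measurable_funX;
  [exact: (mf false)|exact: (mf true)].
Qed.

Lemma L2_component im D f : measurable D -> L2 nu D f ->
  real_L2 nu D (component im \o f).
Proof.
move=> mD [mre mim f2].
have mc i : measurable_fun D (component i \o f) by case: i.
split=> //; apply: le_lt_trans f2; apply: ge0_le_integral => //.
- by move=> x _; rewrite lee_fin sqr_ge0.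
- by apply/measurable_EFinP; apply: measurable_funX.
- by apply/measurable_EFinP; exact: measurable_abs2.
- by move=> x _; rewrite lee_fin component_sqr_le.
Qed.

Lemma sqdist_component im D (h : nat -> X -> R[i]) f : measurable D ->
  (forall i n, measurable_fun D (component i \o h n)) ->
  (forall i, measurable_fun D (component i \o f)) ->
  (fun n => sqnorm nu D (h n \- f)) @ \oo --> 0%E ->
  (fun n => sqdist nu D (component im \o h n) (component im \o f)) @ \oo --> 0%E.
Proof.
move=> mD mh mf cv; apply: (@squeeze_cvge _ _ _ _ (fun=> 0%E)) cv; last exact: cvg_cst.
near=> n; apply/andP; split.
  by apply: integral_ge0 => x _; rewrite lee_fin sqr_ge0.
have compB i x : component i ((h n \- f) x) = component i (h n x) - component i (f x).
  by case: i; rewrite /= ?ReB ?ImB.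
apply: ge0_le_integral => //.
- by move=> x _; rewrite lee_fin sqr_ge0.
- apply/measurable_EFinP; apply: measurable_funX; apply: measurable_funB.
    exact: mh.
  exact: mf.
- apply/measurable_EFinP; apply: measurable_abs2 => // i.
  rewrite (_ : _ \o _ = fun x => component i (h n x) - component i (f x)).
    by apply: measurable_funB; [exact: mh|exact: mf].
  by apply/funext => x; exact: compB.
- by move=> x _; rewrite lee_fin /= -compB component_sqr_le.
Unshelve. all: by end_near. Qed.

End Components.

(** All summands of [curve_sqnorm] are nonnegative, so each is squeezed by the sum; then the
    positive length is divided out. *)
Lemma curve_sqnorm_side s (h : nat -> plane R -> R[i]) pq : pq \in s ->
  0 < side_length pq ->
  (fun n => curve_sqnorm s (h n)) @ \oo --> 0%E ->
  (fun n => sqnorm mu I01 (on_side (h n) pq)) @ \oo --> 0%E.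
Proof.
move=> pqs L0 cv.
have sq0 n pq' : (0 <= sqnorm mu I01 (on_side (h n) pq'))%E.
  by apply: integral_ge0 => t _; rewrite lee_fin addr_ge0// sqr_ge0.
have : (fun n => (side_length pq)%:E * sqnorm mu I01 (on_side (h n) pq))%E @ \oo --> 0%E.
  apply: (@squeeze_cvge _ _ _ _ (fun=> 0%E)) cv; last exact: cvg_cst.
  near=> n; apply/andP; split; first by rewrite mule_ge0// lee_fin ltW.
  rewrite /curve_sqnorm (big_rem pq pqs)/= leeDl//.
  by apply: sume_ge0 => pq' _; rewrite mule_ge0// lee_fin sqrtr_ge0.
move=> /(cvgeZl (y := (side_length pq)^-1%:E)) => /(_ isT).
rewrite mule0; under eq_fun do rewrite muleA -EFinM mulVf ?gt_eqF// mul1e.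
by [].
Unshelve. all: by end_near. Qed.

Lemma H1_component im W s w : measurable (W : set (mR * mR)) -> H1 W s w ->
  real_H1 W s (component im \o fn w) (component im \o fn_x w)
    (component im \o fn_y w) (component im \o tr w).
Proof.
move=> mW [[lw lwx lwy _ _] [ltr [h [ch hu hx hy hr]]]].
have mc (f : plane R -> R[i]) i : L2 leb2 W f ->
    measurable_fun W (component i \o f : mR * mR -> mR).
  by move=> [m1 m2 _]; case: i.
have c1 i n : C1 (component i \o h n) by have [? ?] := ch n; case: i.
have cd i n v : component i \o cderive v (h n) = fun x => 'D_v (component i \o h n) x.
  by case: i.
have mcd i n v : measurable_fun W (component i \o cderive v (h n) : mR * mR -> mR).
  by rewrite cd; apply: continuous_plane_measurable mW _; exact: (c1 i n).2.
have mch i n : measurable_fun W (component i \o h n : mR * mR -> mR).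
  by apply: continuous_plane_measurable mW _; exact: C1_continuous.
have key v (f : plane R -> R[i]) : L2 leb2 W f ->
    (fun n => sqnorm leb2 W (cderive v (h n) \- f)) @ \oo --> 0%E ->
    (fun n => sqdist leb2 W (fun x => 'D_v (component im \o h n) x) (component im \o f))
      @ \oo --> 0%E.
  move=> lf.
  have := @sqdist_component _ _ leb2 im W (fun n => cderive v (h n)) f mW
    (fun i n => mcd i n v) (fun i => mc f i lf).
  move=> H cv; rewrite (_ : (fun n => _) = (fun n => sqdist leb2 W
    (component im \o cderive v (h n)) (component im \o f))); first exact: H.
  by apply/funext => n; rewrite cd.
split; [exact: L2_component mW lw|exact: L2_component mW lwx|
  exact: L2_component mW lwy| |].
  by move=> pq pqs; apply: (L2_component im _ (ltr pq pqs)); exact: measurable_itv.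
exists (fun n => component im \o h n); split; first exact: c1.
split.
- exact: (@sqdist_component _ _ leb2 im W h (fn w) mW mch (fun i => mc _ i lw) hu).
- exact: key lwx hx.
- exact: key lwy hy.
- move=> pq pqs L0.
  have mI : measurable (I01 : set mR) by exact: measurable_itv.
  have := curve_sqnorm_side pqs L0 hr.
  apply: (sqdist_component im mI) => [i n|i].
    by have [] := side_real_L2 pq (C1_continuous (c1 i n)).
  by have [m1 m2 _] := ltr pq pqs; case: i.
Qed.

End ComplexPairing.

(** * The Robin Laplacian on test functions *)

Section RobinLaplacian.
Variable R : realType.
Local Notation mu := (@lebesgue_measure R).
Local Notation leb2 := (@Defs.leb2 R).
Local Notation dx := (Defs.dx R).
Local Notation dy := (Defs.dy R).
Local Notation I01 := (@unit_interval R).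
Local Open Scope complex_scope.
Implicit Types (b lb : plane R -> R) (W A : set (plane R)).
Implicit Types (s : seq (plane R * plane R)) (pq : plane R * plane R) (w z : sobolev_data R).

(** Holds without integrability: positive and negative parts change places, and [fine] sends both
    infinities to 0. *)
Lemma RintegralN d (X : measurableType d) (nu : {measure set X -> \bar R})
    (D : set X) (f : X -> R) :
  Rintegral nu D (fun x => - f x) = - Rintegral nu D f.
Proof.
rewrite /Rintegral integralE [X in _ = - fine X]integralE.
have -> : (fun x => (- f x)%:E)^\+%E = (fun x => (f x)%:E)^\-%E.
  by apply/funext => x; rewrite funeposE funenegE EFinN.
have -> : (fun x => (- f x)%:E)^\-%E = (fun x => (f x)%:E)^\+%E.
  by apply/funext => x; rewrite funeposE funenegE EFinN oppeK.
case: (\int[nu]_(x in D) _)%E => [a| |]; case: (\int[nu]_(x in D) _)%E => [c| |] //=;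
  rewrite ?oppr0 //; ring.
Qed.

Definition C1_data b : sobolev_data R :=
  SobolevData (fun x => (b x)%:C) (fun x => ('D_dx b x)%:C)
    (fun x => ('D_dy b x)%:C) (fun x => (b x)%:C).

Lemma abs2_real (r : R) : abs2 r%:C = r ^+ 2.
Proof. by rewrite /abs2 /= expr0n/= addr0. Qed.

Lemma real_L2_L2 d (X : measurableType d) (nu : {measure set X -> \bar R})
    (D : set X) (f : X -> R) :
  real_L2 nu D f -> L2 nu D (fun x => (f x)%:C).
Proof.
move=> [mf f2]; split; [exact: mf|exact: measurable_cst|].
by rewrite /sqnorm; under eq_integral do rewrite abs2_real.
Qed.

Lemma sqnorm0 d (X : measurableType d) (nu : {measure set X -> \bar R})
    (D : set X) (f : X -> R[i]) : (forall x, f x = 0) -> sqnorm nu D f = 0%E.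
Proof.
move=> f0; rewrite /sqnorm integral0_eq// => x _.
by rewrite f0 /abs2/= expr0n/= addr0.
Qed.

Lemma cC1_real b : C1 b -> cC1 (fun x => (b x)%:C).
Proof.
move=> cb; split=> //=; split=> [x|v]; first exact: differentiable_cst.
rewrite (_ : (fun x => 'D_v _ x) = cst 0); first by move=> x; exact: cvg_cst.
by apply/funext => x; rewrite derive_cst.
Qed.

Lemma cderive_real v b : cderive v (fun x => (b x)%:C) = fun x => ('D_v b x)%:C.
Proof.
apply/funext => x; rewrite /cderive /=; congr (_ +i* _).
exact: derive_cst.
Qed.

Lemma real_L2_C1 b W : open W -> C1 b -> bounded_support b -> real_L2 leb2 W b.
Proof.
move=> /open_plane_measurable mW cb bb; have cb' := C1_continuous cb.
split; first exact: continuous_plane_measurable mW cb'.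
exact: bounded_support_sqr cb' bb mW.
Qed.

Lemma orthonormal_dx : orthonormal_pair dy dx.
Proof. by rewrite /orthonormal_pair /dot /= !(mulr0, mulr1, mul0r, mul1r, addr0, add0r). Qed.

Lemma orthonormal_dy : orthonormal_pair dx dy.
Proof. by rewrite /orthonormal_pair /dot /= !(mulr0, mulr1, mul0r, mul1r, addr0, add0r). Qed.

(** For the trace, the constant sequence [b] is an approximating sequence. *)
Lemma H1_C1_data W s b : open W -> C1 b -> bounded_support b ->
  H1 W s (C1_data b).
Proof.
move=> oW cb bb; have mW := open_plane_measurable oW.
have Dl v : L2 leb2 W (fun x => ('D_v b x)%:C).
  exact/real_L2_L2/C1_real_L2.
split; split.
- exact/real_L2_L2/real_L2_C1.
- exact: Dl.
- exact: Dl.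
- exact: weak_derivative_C1 oW orthonormal_dx cb bb.
- exact: weak_derivative_C1 oW orthonormal_dy cb bb.
- move=> pq _; exact: (real_L2_L2 (side_real_L2 pq (C1_continuous cb))).
- have D0 v : (fun=> sqnorm leb2 W (cderive v (fun x => (b x)%:C) \- (fun x => ('D_v b x)%:C)))
      @ \oo --> 0%E.
    rewrite sqnorm0; first exact: cvg_cst.
    by move=> x; rewrite cderive_real /= subrr.
  exists (fun=> fun x => (b x)%:C); split.
  + by move=> _; exact: cC1_real.
  + rewrite sqnorm0; first exact: cvg_cst.
    by move=> x /=; rewrite subrr.
  + exact: D0.
  + exact: D0.
  + rewrite /curve_sqnorm big1; first exact: cvg_cst.
    by move=> pq _; rewrite sqnorm0 ?mule0// => t; rewrite /on_side /= subrr.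
Qed.

Lemma cintegral_components W (F : plane R -> R[i]) im :
  component im (cintegral leb2 W F) = \int[leb2]_(x in W) component im (F x).
Proof. by case: im. Qed.

Lemma curve_inner_components s (f g : plane R -> R[i]) im :
  component im (curve_inner s f g) = \sum_(pq <- s) side_length pq *
    \int[mu]_(t in I01) component im (f (seg pq.1 pq.2 t) * (g (seg pq.1 pq.2 t))^*).
Proof.
by case: im; [rewrite [LHS](ReIm_sum s _).2|rewrite [LHS](ReIm_sum s _).1];
  apply: eq_bigr => pq _; rewrite /= mul0r ?subr0 ?addr0.
Qed.

Lemma componentD im (z t : R[i]) : component im (z + t) = component im z + component im t.
Proof. by case: im; rewrite /= ?ReD ?ImD. Qed.

Lemma componentZ im (r : R) (z : R[i]) : component im (r%:C * z) = r * component im z.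
Proof. by case: im; case: z => x y /=; ring. Qed.

Lemma componentN im (z : R[i]) : component im (- z) = - component im z.
Proof. by case: im; case: z. Qed.

Lemma component_Mconj im (z : R[i]) (r : R) :
  component im (z * (r%:C)^*) = r * component im z.
Proof. by case: im; [rewrite [LHS](ReMconj z r).2|rewrite [LHS](ReMconj z r).1]; rewrite mulrC. Qed.

Lemma component_conjM im (z : R[i]) (r : R) :
  component im (r%:C * z^*) = (-1) ^+ im * (r * component im z).
Proof.
by case: im; [rewrite [LHS](ReconjM z r).2|rewrite [LHS](ReconjM z r).1];
  rewrite ?expr1 ?expr0 ?mul1r ?mulN1r.
Qed.

Lemma complex_component_eq (z t : R[i]) :
  (forall im, component im z = component im t) -> z = t.
Proof. by case: z t => x y [x' y'] E; have := E false; have := E true; rewrite /= => -> ->. Qed.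

Lemma Rintegral_sign d (X : measurableType d) (nu : {measure set X -> \bar R})
    (D : set X) (f : X -> R) (im : bool) :
  Rintegral nu D (fun x => (-1) ^+ im * f x) = (-1) ^+ im * Rintegral nu D f.
Proof.
case: im; last by rewrite expr0 mul1r; apply: eq_Rintegral => x _; rewrite mul1r.
by rewrite expr1 mulN1r -RintegralN; apply: eq_Rintegral => x _; rewrite mulN1r.
Qed.

(** The real function stands in the argument that is not conjugated, so conjugation puts the same
    sign [(-1) ^+ im] on all terms. *)
Lemma robin_form_real_left W s beta b bx by_ lb z im :
  \int[leb2]_(x in W)
     (bx x * (component im \o fn_x z) x + by_ x * (component im \o fn_y z) x) +
  beta * (\sum_(pq <- s) side_length pq * \int[mu]_(t in I01)
     (b (seg pq.1 pq.2 t) * (component im \o tr z) (seg pq.1 pq.2 t))) +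
  \int[leb2]_(x in W) (lb x * (component im \o fn z) x) = 0 ->
  component im (robin_form W s beta (SobolevData (fun x => (b x)%:C)
    (fun x => (bx x)%:C) (fun x => (by_ x)%:C) (fun x => (b x)%:C)) z) =
  component im (inner leb2 W (\- (fun x => (lb x)%:C)) (fn z)).
Proof.
rewrite /robin_form componentD componentZ /inner !cintegral_components
  curve_inner_components /= => J.
transitivity ((-1) ^+ im * (\int[leb2]_(x in W)
     (bx x * (component im \o fn_x z) x + by_ x * (component im \o fn_y z) x) +
   beta * (\sum_(pq <- s) side_length pq * \int[mu]_(t in I01)
     (b (seg pq.1 pq.2 t) * (component im \o tr z) (seg pq.1 pq.2 t))))).
  rewrite mulrDr -Rintegral_sign; congr (_ + _).
    apply: eq_Rintegral => x _.
    by rewrite componentD !component_conjM -mulrDr.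
  rewrite mulrCA; congr (_ * _); rewrite mulr_sumr; apply: eq_bigr => pq _.
  rewrite mulrCA -Rintegral_sign; congr (_ * _); apply: eq_Rintegral => t _.
  by rewrite component_conjM.
rewrite (_ : _ + _ = - \int[leb2]_(x in W) (lb x * (component im \o fn z) x)).
  rewrite -RintegralN -Rintegral_sign; apply: eq_Rintegral => x _.
  by rewrite mulNr componentN component_conjM /= mulrN.
by apply/eqP; rewrite -addr_eq0; apply/eqP.
Qed.

Lemma robin_form_real_right W s beta b bx by_ w im :
  component im (robin_form W s beta w (SobolevData (fun x => (b x)%:C)
    (fun x => (bx x)%:C) (fun x => (by_ x)%:C) (fun x => (b x)%:C))) =
  \int[leb2]_(x in W)
     (bx x * (component im \o fn_x w) x + by_ x * (component im \o fn_y w) x) +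
  beta * (\sum_(pq <- s) side_length pq * \int[mu]_(t in I01)
     (b (seg pq.1 pq.2 t) * (component im \o tr w) (seg pq.1 pq.2 t))).
Proof.
rewrite /robin_form componentD componentZ !cintegral_components
  curve_inner_components /=; congr (_ + _ * _).
  by apply: eq_Rintegral => x _; rewrite componentD !component_Mconj.
apply: eq_bigr => pq _; congr (_ * _); apply: eq_Rintegral => t _.
by rewrite component_Mconj.
Qed.

Lemma robin_test_laplacian W s beta b lb : open W ->
  robin_test W s beta b lb ->
  robin_laplacian W s beta (fun x => (b x)%:C) (fun x => (lb x)%:C).
Proof.
move=> oW bt; have mW := open_plane_measurable oW.
have [cb clb bb blb _] := bt.
split.
  rewrite (_ : \- _ = fun x => (- lb x)%:C); last first.
    by apply/funext => x /=; rewrite rmorphN.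
  apply: real_L2_L2; split.
    by apply: measurable_funN; exact: continuous_plane_measurable mW clb.
  under eq_integral do rewrite sqrrN.
  exact: bounded_support_sqr clb blb mW.
exists (C1_data b); split; [by []|exact: H1_C1_data|].
move=> z Hz; apply: complex_component_eq => im.
exact: (robin_form_real_left (robin_test_pairing mW bt (H1_component im mW Hz))).
Qed.

(** Symmetry of the operator against an explicit test function: the form at [v] and [b] is evaluated
    once by the equation for [v] and once by Green's identity for [b]. Real parts suffice because
    [P] and the test functions are real. *)
Lemma robin_laplacian_adjoint W s beta b lb v g : open W ->
  robin_test W s beta b lb -> robin_laplacian W s beta v g ->
  \int[leb2]_(x in W) (b x * complex.Re (g x)) =
  \int[leb2]_(x in W) (lb x * complex.Re (v x)).
Proof.
move=> oW bt [_ [w [<- Hw form]]]; have mW := open_plane_measurable oW.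
have [cb _ bb _ _] := bt.
have J := robin_test_pairing mW bt (H1_component false mW Hw).
have E := congr1 (component false) (form _ (H1_C1_data s oW cb bb)).
have E' := esym (robin_form_real_right W s beta b (fun x => 'D_dx b x)
  (fun x => 'D_dy b x) w false).
rewrite [X in X + _]E' [X in X + _]E in J.
move: J; rewrite /inner [X in X + _](cintegral_components W _ false).
have -> : \int[leb2]_(x in W) component false ((\- g) x * ((b x)%:C)^*) =
    - \int[leb2]_(x in W) (b x * complex.Re (g x)).
  rewrite -RintegralN; apply: eq_Rintegral => x _.
  by rewrite component_Mconj componentN mulrN.
by move/eqP; rewrite addrC subr_eq0 => /eqP <-.
Qed.

End RobinLaplacian.

(** * Products of functions of the chart coordinates *)

Section Tensor.
Variable R : realType.
Implicit Types (o e n v x y : plane R) (f g : R -> R) (h : plane R -> R).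

Definition tensor o e n f g x : R := f (dot (x - o) e) * g (dot (x - o) n).

Lemma chart_coord1 o e n x : orthonormal_pair e n -> dot (chart o e n x - o) e = x.1.
Proof.
case: o e n x => [c1 c2] [e1 e2] [n1 n2] [s t] [].
rewrite /chart /dot /= /GRing.scale /= => ee nn en.
transitivity (s * (e1 * e1 + e2 * e2) + t * (e1 * n1 + e2 * n2)); first by ring.
by rewrite ee en; ring.
Qed.

Lemma chart_coord2 o e n x : orthonormal_pair e n -> dot (chart o e n x - o) n = x.2.
Proof.
case: o e n x => [c1 c2] [e1 e2] [n1 n2] [s t] [].
rewrite /chart /dot /= /GRing.scale /= => ee nn en.
transitivity (t * (n1 * n1 + n2 * n2) + s * (e1 * n1 + e2 * n2)); first by ring.
by rewrite nn en; ring.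
Qed.

Lemma chartK o e n x : orthonormal_pair e n ->
  chart o e n (dot (x - o) e, dot (x - o) n) = x.
Proof.
case: o e n x => [c1 c2] [e1 e2] [n1 n2] [x1 x2] [].
rewrite /dot /= => ee nn en.
(* The determinant is 1 or -1, and [n] is that multiple of [e] turned by a right angle. *)
have d2 : (e1 * n2 - e2 * n1) ^+ 2 = 1.
  transitivity ((e1 * e1 + e2 * e2) * (n1 * n1 + n2 * n2) - (e1 * n1 + e2 * n2) ^+ 2).
    by ring.
  by rewrite ee nn en; ring.
have n1E : n1 = - (e1 * n2 - e2 * n1) * e2.
  transitivity (n1 * (e1 * e1 + e2 * e2) - e1 * (e1 * n1 + e2 * n2)).
    by rewrite ee en; ring.
  by ring.
have n2E : n2 = (e1 * n2 - e2 * n1) * e1.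
  transitivity (n2 * (e1 * e1 + e2 * e2) - e2 * (e1 * n1 + e2 * n2)).
    by rewrite ee en; ring.
  by ring.
move: (e1 * n2 - e2 * n1) d2 n1E n2E => d d2 -> ->.
rewrite [LHS]surjective_pairing; congr pair; rewrite /chart /= /GRing.scale /=.
  transitivity (c1 + (x1 - c1) * (e1 ^+ 2 + d ^+ 2 * e2 ^+ 2)
     + (x2 - c2) * e1 * e2 * (1 - d ^+ 2)); first by ring.
  rewrite d2 (_ : e1 ^+ 2 + 1 * e2 ^+ 2 = 1); first by ring.
  by rewrite mul1r -ee; ring.
transitivity (c2 + (x2 - c2) * (d ^+ 2 * e1 ^+ 2 + e2 ^+ 2)
     + (x1 - c1) * e1 * e2 * (1 - d ^+ 2)); first by ring.
rewrite d2 (_ : 1 * e1 ^+ 2 + e2 ^+ 2 = 1); first by ring.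
by rewrite mul1r -ee; ring.
Qed.

Lemma tensor_chart o e n f g x : orthonormal_pair e n ->
  tensor o e n f g (chart o e n x) = f x.1 * g x.2.
Proof. by move=> en; rewrite /tensor chart_coord1// chart_coord2. Qed.

Lemma dot_sub_continuous o e : continuous (fun x : plane R => dot (x - o) e).
Proof.
move=> x; rewrite /dot.
by apply: cvgD; apply: cvgM; try exact: cvg_cst;
  (apply: cvgB; last exact: cvg_cst); [exact: cvg_fst|exact: cvg_snd].
Qed.

Lemma tensor_continuous o e n f g : continuous f -> continuous g ->
  continuous (tensor o e n f g).
Proof.
move=> cf cg x; apply: cvgM.
  by apply: (@continuous_comp _ _ _ (fun x => dot (x - o) e) f);
    [exact: dot_sub_continuous|exact: cf].
by apply: (@continuous_comp _ _ _ (fun x => dot (x - o) n) g);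
    [exact: dot_sub_continuous|exact: cg].
Qed.

Lemma is_diff_dot_sub o e x :
  is_diff x (fun x : plane R => dot (x - o) e) (fun v => dot v e).
Proof.
have d1 : is_diff x (fst : plane R -> R) (fst : plane R -> R).
  have c : continuous (fst : plane R -> R) by move=> y; exact: cvg_fst.
  apply: DiffDef; first exact: linear_differentiable.
  by rewrite diff_lin.
have d2 : is_diff x (snd : plane R -> R) (snd : plane R -> R).
  have c : continuous (snd : plane R -> R) by move=> y; exact: cvg_snd.
  apply: DiffDef; first exact: linear_differentiable.
  by rewrite diff_lin.
have D := is_diffD (is_diffD (is_diffZ e.1 d1) (is_diffZ e.2 d2))
  (is_diff_cst (- dot o e : R) x).
rewrite (_ : (fun x => _) = e.1 \*: (fst : plane R -> R) +
  e.2 \*: (snd : plane R -> R) + cst (- dot o e)); last first.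
  apply/funext => y; rewrite -[RHS]/(e.1 * y.1 + e.2 * y.2 - dot o e) /dot /=.
  by ring.
apply: (is_diff_eq D); apply/funext => y.
rewrite -[LHS]/(e.1 * y.1 + e.2 * y.2 + 0) /dot; ring.
Qed.

Lemma is_derive_diff f (f1 : R) (t : R) : is_derive t 1 f f1 ->
  is_diff t f (fun k : R => k * f1).
Proof.
move=> [df <-]; apply: DiffDef; first exact/derivable1_diffP.
by rewrite deriv1E// derive1E.
Qed.

Lemma tensor_C1 o e n f f1 g g1 :
  (forall t : R, is_derive t 1 f (f1 t)) -> (forall t : R, is_derive t 1 g (g1 t)) ->
  continuous f1 -> continuous g1 ->
  C1 (tensor o e n f g) /\ forall v x, 'D_v (tensor o e n f g) x =
    dot v e * tensor o e n f1 g x + dot v n * tensor o e n f g1 x.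
Proof.
move=> df dg cf1 cg1.
have cf : continuous f.
  by move=> t; apply: differentiable_continuous; have [] := is_derive_diff (df t).
have cg : continuous g.
  by move=> t; apply: differentiable_continuous; have [] := is_derive_diff (dg t).
have [|||C D] := @C1_of_partials _ (tensor o e n f g)
  (fun x => e.1 * tensor o e n f1 g x + n.1 * tensor o e n f g1 x)
  (fun x => e.2 * tensor o e n f1 g x + n.2 * tensor o e n f g1 x).
- move=> x.
  have D1 := is_diff_comp (is_diff_dot_sub o e x) (is_derive_diff (df (dot (x - o) e))).
  have D2 := is_diff_comp (is_diff_dot_sub o n x) (is_derive_diff (dg (dot (x - o) n))).
  have D := is_diffM D1 D2.
  apply: (is_diff_eq D); apply/funext => v.
  rewrite !fctE /tensor /dot /= /GRing.scale /=; ring.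
- by move=> x; apply: cvgD; apply: cvgM; try exact: cvg_cst; exact: tensor_continuous.
- by move=> x; apply: cvgD; apply: cvgM; try exact: cvg_cst; exact: tensor_continuous.
split=> // v x; rewrite D /dot; ring.
Qed.

End Tensor.

(** * Green's identity in a half-box *)

Section Green.
Variable R : realType.
Local Notation mu := (@lebesgue_measure R).
Local Notation mR := (measurableTypeR R).
Local Notation leb2 := (@Defs.leb2 R).
Local Notation dx := (Defs.dx R).
Local Notation dy := (Defs.dy R).
Implicit Types (o e n v x y : plane R) (f g : R -> R) (h : plane R -> R).

(** The integrand is the derivative in [t] of [f s * g t * h (chart o e n (s, t))]. *)
Lemma box_normal_derivative o e n f g g1 h (a b c d : R) : c < d ->
  continuous f -> continuous g1 -> (forall t : R, is_derive t 1 g (g1 t)) -> C1 h ->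
  \int[leb2]_(x in `]a, b]%classic `*` `]c, d]%classic)
    (f x.1 * (g1 x.2 * h (chart o e n x) + g x.2 * 'D_n h (chart o e n x))) =
  \int[mu]_(s in `]a, b]) (f s * g d * h (chart o e n (s, d)) -
    f s * g c * h (chart o e n (s, c))).
Proof.
move=> cd cf cg1 dg ch.
have cg : continuous g.
  by move=> t; apply: differentiable_continuous; have [] := is_derive_diff (dg t).
have c1 (k : R -> R) : continuous k -> continuous (fun x : plane R => k x.1).
  by move=> ck x; apply: (@continuous_comp _ _ _ fst k); [exact: cvg_fst|exact: ck].
have c2 (k : R -> R) : continuous k -> continuous (fun x : plane R => k x.2).
  by move=> ck x; apply: (@continuous_comp _ _ _ snd k); [exact: cvg_snd|exact: ck].
have cc (k : plane R -> R) : continuous k -> continuous (fun x => k (chart o e n x)).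
  move=> ck x; apply: (@continuous_comp _ _ _ (chart o e n) k); last exact: ck.
  exact: chart_continuous.
have cD : continuous (fun x => 'D_n h x) by exact: ch.2.
pose F (x : plane R) := f x.1 * g x.2 * h (chart o e n x).
have mI : measurable (`]a, b]%classic : set mR) by exact: measurable_itv.
apply: (Rintegral_box_FTC (F := F) cd mI (@subset_itv_oc_cc _ _ a b)).
- move=> x; apply: cvgM; last exact: (cc _ (C1_continuous ch)).
  by apply: cvgM; [exact: c1|exact: c2].
- move=> x; apply: cvgM; first exact: c1.
  apply: cvgD; first by apply: cvgM; [exact: c2|exact: (cc _ (C1_continuous ch))].
  by apply: cvgM; [exact: c2|exact: (cc _ cD)].
- move=> s t.
  have D := is_deriveM (is_deriveZ (f s) (dg t)) (is_derive_chart o e n s t ch).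
  apply: (is_derive_eq D).
  rewrite -[LHS]/((f s * g t) * 'D_n h (chart o e n (s, t)) +
    h (chart o e n (s, t)) * (f s * g1 t)) /=; ring.
Qed.

Lemma chart_gradient_dot e n (A B p q : R) :
  (dot dx e * A + dot dx n * B) * p + (dot dy e * A + dot dy n * B) * q =
  A * (e.1 * p + e.2 * q) + B * (n.1 * p + n.2 * q).
Proof. by rewrite /dot /=; ring. Qed.

Lemma Rintegral_chart_box o e n W F (a b c d : R) : orthonormal_pair e n ->
  measurable (W : set (mR * mR)) -> measurable_fun W (F : mR * mR -> mR) ->
  (forall x, W (chart o e n x) -> ~ (`]a, b]%classic `*` `]c, d]%classic) x ->
     F (chart o e n x) = 0) ->
  (forall x, ~ W (chart o e n x) -> (`]a, b]%classic `*` `]c, d]%classic) x ->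
     F (chart o e n x) = 0) ->
  \int[leb2]_(x in W) F x =
  \int[leb2]_(x in `]a, b]%classic `*` `]c, d]%classic) F (chart o e n x).
Proof.
move=> en mW mF F1 F2.
rewrite (Rintegral_measure_preserving (chart_measure_preserving o en) mW mF).
rewrite Rintegral_mkcond [RHS]Rintegral_mkcond; congr (Rintegral _ _ _).
apply/funext => x; rewrite !patchE /=.
case: ifPn => [/set_mem xW|/negP xW]; case: ifPn => [/set_mem xB|/negP xB] //.
  by apply: F1 => // xB'; apply: xB; rewrite inE.
by apply/esym/F2 => // xW'; apply: xW; rewrite inE.
Qed.

(** The Laplacian of [tensor o e n f g] for orthonormal [e] and [n], given by its formula so that
    second derivatives on the plane are avoided. *)
Definition laplacian_tensor o e n f f2 g g2 x :=
  tensor o e n f2 g x + tensor o e n f g2 x.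

(** The parameter [c] covers two situations. For [c = 0] the domain ends at the line t = 0; for
    [c = - d] the condition [c < t] always holds on the box, which then lies in [W], and
    [g1 c = 0]. *)
Lemma chart_green o e n W f f1 f2 g g1 g2 h (a b c d : R) :
  orthonormal_pair e n -> measurable (W : set (mR * mR)) ->
  (forall t : R, is_derive t 1 f (f1 t)) -> (forall t : R, is_derive t 1 f1 (f2 t)) ->
  (forall t : R, is_derive t 1 g (g1 t)) -> (forall t : R, is_derive t 1 g1 (g2 t)) ->
  continuous f2 -> continuous g2 -> a < b -> c < d ->
  (forall s, s <= a \/ b <= s -> [/\ f s = 0, f1 s = 0 & f2 s = 0]) ->
  (forall t, t <= - d \/ d <= t -> [/\ g t = 0, g1 t = 0 & g2 t = 0]) ->
  (forall s t, a < s < b -> - d < t < d -> W (chart o e n (s, t)) <-> c < t) ->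
  C1 h ->
  let B := tensor o e n f g in
  \int[leb2]_(x in W) ('D_dx B x * 'D_dx h x + 'D_dy B x * 'D_dy h x) +
  \int[leb2]_(x in W) (laplacian_tensor o e n f f2 g g2 x * h x) =
  - \int[mu]_(s in `]a, b]) (f s * g1 c * h (chart o e n (s, c))).
Proof.
move=> en mW df df1 dg dg1 cf2 cg2 ab cd f0 g0 WE ch B.
have cont (k k1 : R -> R) : (forall t : R, is_derive t 1 k (k1 t)) -> continuous k.
  by move=> dk t; apply: differentiable_continuous; have [] := is_derive_diff (dk t).
have [cf cf1 cg cg1] := And4 (cont _ _ df) (cont _ _ df1) (cont _ _ dg) (cont _ _ dg1).
have cH := C1_continuous ch.
have cD v : continuous (fun x => 'D_v h x) by exact: ch.2.
have [_ DB] := tensor_C1 o e n df dg cf1 cg1.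
pose G x := tensor o e n f1 g x * 'D_e h x + tensor o e n f g1 x * 'D_n h x.
pose L x := laplacian_tensor o e n f f2 g g2 x * h x.
have -> : \int[leb2]_(x in W) ('D_dx B x * 'D_dx h x + 'D_dy B x * 'D_dy h x) =
    \int[leb2]_(x in W) G x.
  apply: eq_Rintegral => x _.
  by rewrite /B !DB chart_gradient_dot -!C1_deriveE.
have cG : continuous G.
  by move=> x; apply: cvgD; apply: cvgM; (try exact: cD); exact: tensor_continuous.
have cL : continuous L.
  move=> x; apply: cvgM; last exact: cH.
  by apply: cvgD; exact: tensor_continuous.
pose Q : set (mR * mR) := `]a, b]%classic `*` `]c, d]%classic.
(* Where [W] and [Q] disagree, all products that enter the integrands vanish. *)
have dich x : (W (chart o e n x) <-> Q x) \/
    [/\ f1 x.1 * g x.2 = 0, f x.1 * g1 x.2 = 0, f2 x.1 * g x.2 = 0 & f x.1 * g2 x.2 = 0].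
  case: x => s t /=.
  have [sa|sa] := leP s a; first by right; have [-> -> ->] := f0 s (or_introl sa); rewrite !mul0r.
  have [sb|sb] := leP b s; first by right; have [-> -> ->] := f0 s (or_intror sb); rewrite !mul0r.
  have [ta|ta] := leP t (- d); first by right; have [-> -> ->] := g0 t (or_introl ta); rewrite !mulr0.
  have [tb|tb] := leP d t; first by right; have [-> -> ->] := g0 t (or_intror tb); rewrite !mulr0.
  left; rewrite /Q; split.
    move=> /WE; rewrite sa sb ta tb => /(_ isT isT) ct.
    by split; rewrite /= in_itv/= ?sa ?ct ltW.
  case=> /=; rewrite !in_itv/= => _ /andP[ct _].
  by apply/WE; rewrite ?sa ?sb ?ta ?tb.
have toQ F : continuous F ->
    (forall x, [/\ f1 x.1 * g x.2 = 0, f x.1 * g1 x.2 = 0, f2 x.1 * g x.2 = 0 &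
      f x.1 * g2 x.2 = 0] -> F (chart o e n x) = 0) ->
    \int[leb2]_(x in W) F x = \int[leb2]_(x in Q) F (chart o e n x).
  move=> cF F0; apply: (Rintegral_chart_box en mW (continuous_plane_measurable mW cF)).
    by move=> x xW xQ; have [[/(_ xW)]|/F0] := dich x.
  by move=> x xW xQ; have [[_ /(_ xQ)]|/F0] := dich x.
rewrite (toQ G cG); last first.
  by move=> x [z1 z2 _ _]; rewrite /G !tensor_chart// z1 z2 !mul0r addr0.
rewrite (toQ L cL); last first.
  move=> x [_ _ z1 z2].
  by rewrite /L /laplacian_tensor !tensor_chart// z1 z2 addr0 mul0r.
have mQ : measurable Q by apply: measurableX; exact: measurable_itv.
have Qbox : Q `<=` `[a, b]%classic `*` `[c, d]%classic.
  by move=> x [? ?]; split; exact: subset_itv_oc_cc.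
have c1 (k : R -> R) : continuous k -> continuous (fun x : plane R => k x.1).
  by move=> ck x; apply: (@continuous_comp _ _ _ fst k); [exact: cvg_fst|exact: ck].
have c2 (k : R -> R) : continuous k -> continuous (fun x : plane R => k x.2).
  by move=> ck x; apply: (@continuous_comp _ _ _ snd k); [exact: cvg_snd|exact: ck].
have cc (k : plane R -> R) : continuous k -> continuous (fun x => k (chart o e n x)).
  move=> ck x; apply: (@continuous_comp _ _ _ (chart o e n) k); last exact: ck.
  exact: chart_continuous.
(* [K1] is the derivative along [n] of [f * g1 * h] and [K2] the one along [e] of [f1 * g * h];
   their sum is the integrand. *)
pose K1 (x : plane R) := f x.1 * (g2 x.2 * h (chart o e n x) + g1 x.2 * 'D_n h (chart o e n x)).
pose K2 (x : plane R) := g x.2 * (f2 x.1 * h (chart o e n x) + f1 x.1 * 'D_e h (chart o e n x)).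
have cK1 : continuous K1.
  move=> x; apply: cvgM; first exact: c1.
  by apply: cvgD; apply: cvgM; [exact: c2|exact: (cc _ cH)|exact: c2|exact: (cc _ (cD n))].
have cK2 : continuous K2.
  move=> x; apply: cvgM; first exact: c2.
  by apply: cvgD; apply: cvgM; [exact: c1|exact: (cc _ cH)|exact: c1|exact: (cc _ (cD e))].
have intc k : continuous k -> leb2.-integrable Q (EFin \o k).
  by move=> ck; exact: (continuous_plane_integrable ck mQ Qbox).
rewrite -(RintegralD mQ (intc _ (cc _ cG)) (intc _ (cc _ cL))).
transitivity (\int[leb2]_(x in Q) K1 x + \int[leb2]_(x in Q) K2 x).
  rewrite -(RintegralD mQ (intc _ cK1) (intc _ cK2)).
  apply: eq_Rintegral => x _.
  rewrite /G /L /laplacian_tensor !tensor_chart// /K1 /K2; ring.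
have -> : \int[leb2]_(x in Q) K2 x = 0.
  (* The coordinates are exchanged first, since [box_normal_derivative] integrates along the second
     one. The result is 0 because [f1] vanishes at [a] and [b]. *)
  have mp := chart_measure_preserving 0 (orthonormal_dx R).
  rewrite (Rintegral_measure_preserving mp mQ (continuous_plane_measurable mQ cK2)).
  have swapE x : chart 0 dy dx x = (x.2, x.1).
    case: x => x1 x2; rewrite [LHS]surjective_pairing; congr pair;
    by rewrite /chart /= /GRing.scale /= !(mulr0, mulr1) ?add0r ?addr0.
  have -> : chart 0 dy dx @^-1` Q = `]c, d]%classic `*` `]a, b]%classic.
    by apply/seteqP; split => x /=; rewrite swapE => -[].
  have chs s t : chart o e n (s, t) = chart o n e (t, s) by rewrite /chart /= addrAC.
  transitivity (\int[leb2]_(x in `]c, d]%classic `*` `]a, b]%classic)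
    (g x.1 * (f2 x.2 * h (chart o n e x) + f1 x.2 * 'D_e h (chart o n e x)))).
    by apply: eq_Rintegral => -[t s] _; rewrite /= swapE /K2 /= chs.
  rewrite (box_normal_derivative o n e c d ab cg cf2 df1 ch).
  have [_ f1a _] := f0 a (or_introl (lexx a)).
  have [_ f1b _] := f0 b (or_intror (lexx b)).
  rewrite (@eq_Rintegral _ _ _ _ _ (fun=> 0)); first by rewrite Rintegral_cst ?mul0r.
  by move=> t _; rewrite f1a f1b !mulr0 !mul0r subrr.
rewrite addr0 (box_normal_derivative o e n a b cd cf cg2 dg1 ch) -RintegralN.
have [_ g1d _] := g0 d (or_intror (lexx d)).
by apply: eq_Rintegral => s _; rewrite g1d mulr0 mul0r sub0r.
Qed.

End Green.

(** * One-dimensional integrals and the Robin condition *)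

Section Profiles.
Variable R : realType.
Local Notation mu := (@lebesgue_measure R).
Local Notation mR := (measurableTypeR R).
Local Notation I01 := (@unit_interval R).
Implicit Types (o e n v x y : plane R) (f g : R -> R) (h : plane R -> R).

Lemma Rintegral_scale (L : R) (k : R -> R) : 0 < L -> continuous k ->
  L * \int[mu]_(t in I01) k (L * t) = \int[mu]_(s in `[0, L]) k s.
Proof.
move=> L0 ck.
have dF (t : R) : is_derive t 1 (fun t : R => L * t) L.
  have D := is_deriveZ L (is_derive_id t (1 : R)).
  by apply: (is_derive_eq D); rewrite /GRing.scale /= mulr1.
have F'E : (fun t : R => L * t)^`()%classic = cst L.
  by apply/funext => t; rewrite derive1E; have [_ ->] := dF t.
have cF : continuous (fun t : R => L * t).
  by move=> t; apply: cvgM; [exact: cvg_cst|exact: cvg_id].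
have := @integration_by_substitution_increasing R (fun t => L * t) k 0 1 ler01.
rewrite mulr0 mulr1 F'E => subst.
have {}subst : (\int[mu]_(x in `[0%R, L]) (k x)%:E =
    \int[mu]_(x in `[0%R, 1%R]) (((k \o (fun t => L * t)) * cst L) x)%:E)%E.
  apply: subst.
  - by move=> x y _ _ xy; rewrite ltr_pM2l.
  - by move=> x _; exact: cvg_cst.
  - by apply/cvg_ex; exists L; exact: cvg_cst.
  - by apply/cvg_ex; exists L; exact: cvg_cst.
  - split=> [x _| |]; first by have [] := dF x.
      by apply: cvg_at_right_filter; exact: cF.
    by apply: cvg_at_left_filter; exact: cF.
  - exact: continuous_subspaceT.
rewrite [RHS]/Rintegral subst -RintegralZl; last 2 first.
- exact: measurable_itv.
- apply: continuous_compact_integrable; first exact: segment_compact.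
  apply: continuous_subspaceT => t.
  by apply: (@continuous_comp _ _ _ (fun t => L * t) k); [exact: cF|exact: ck].
by rewrite /Rintegral; congr fine; apply: eq_integral => x _; rewrite mulrC.
Qed.

Lemma Rintegral_itv_subset (k : R -> R) (a b c d : R) : c <= a -> b <= d ->
  (forall s, s <= a \/ b <= s -> k s = 0) ->
  \int[mu]_(s in `]a, b]) k s = \int[mu]_(s in `[c, d]) k s.
Proof.
move=> ca bd k0; rewrite Rintegral_mkcond [RHS]Rintegral_mkcond.
congr (Rintegral _ _ _); apply/funext => s; rewrite !patchE.
have kab : (s \in `]a, b]%classic) = false -> k s = 0.
  move=> /negP sab; apply: k0; case: (leP s a) => sa; [by left|right].
  by rewrite leNgt; apply/negP => sb; apply: sab; rewrite inE /= in_itv/= sa ltW.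
case: ifPn => [sab|/negbTE/kab ->]; last by case: ifP.
rewrite ifT//; move: sab; rewrite !inE /= !in_itv /= => /andP[as_ sb].
by rewrite (le_trans ca (ltW as_)) (le_trans sb bd).
Qed.

Lemma Rintegral_gt0 (k : R -> R) (a b s0 : R) : continuous k ->
  (forall s, 0 <= k s) -> 0 < k s0 -> a < s0 < b ->
  0 < \int[mu]_(s in `]a, b]) k s.
Proof.
move=> ck k0 ks0 /andP[as0 sb0].
have [d d0 dk] : exists2 d : R, 0 < d & forall s, `|s0 - s| < d -> k s0 / 2 <= k s.
  have /cvgrPdist_lt /(_ (k s0 / 2)) := ck s0.
  rewrite divr_gt0// => /(_ isT) /nbhs_ballP[d /= d0 dP].
  exists d => // s sd; have := dP s sd; rewrite /= ltr_norml => /andP[_]; lra.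
pose r := Num.min (d / 2) (b - s0).
have r0 : 0 < r by rewrite lt_min divr_gt0// subr_gt0.
have rd : r < d by rewrite /r gt_min; apply/orP; left; lra.
have rb : s0 + r <= b by rewrite -lerBrDl /r ge_min lexx orbT.
have ik A : measurable (A : set mR) -> A `<=` `[a, b]%classic ->
    mu.-integrable A (EFin \o k).
  move=> mA Aab; apply: (@integrableS _ _ _ mu `[a, b]%classic A) => //.
  apply: continuous_compact_integrable; first exact: segment_compact.
  exact: continuous_subspaceT.
pose J : set mR := `]s0, (s0 + r)]%classic.
have mJ : measurable J by exact: measurable_itv.
have Jab : J `<=` `]a, b]%classic.
  by move=> s; rewrite /J /= !in_itv /= => /andP[? ?]; apply/andP; split; lra.
have Jab' : J `<=` `[a, b]%classic.
  by move=> s; rewrite /J /= !in_itv /= => /andP[? ?]; apply/andP; split; lra.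
have muJ : mu J = r%:E.
  by rewrite /J lebesgue_measure_itv /= lte_fin ltrDl r0 -EFinB; congr EFin; ring.
have lower : k s0 / 2 * r <= \int[mu]_(s in J) k s.
  have -> : k s0 / 2 * r = \int[mu]_(s in J) (k s0 / 2).
    rewrite Rintegral_cst//; congr (_ * _).
    by rewrite -[RHS]/(fine (mu J)) muJ.
  apply: le_Rintegral => //.
  - apply: (@integrableS _ _ _ mu `[a, b]%classic J) => //.
    apply: continuous_compact_integrable; first exact: segment_compact.
    by apply: continuous_subspaceT => t; exact: cvg_cst.
  - exact: ik.
  - move=> s; rewrite /J /= in_itv /= => /andP[s1 s2].
    by apply: dk; rewrite ltr_norml; apply/andP; split; lra.
apply: (@lt_le_trans _ _ (k s0 / 2 * r)); first by rewrite mulr_gt0// divr_gt0.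
apply: (le_trans lower).
rewrite /Rintegral; apply: fine_le.
- apply: integrable_fin_num => //; exact: ik.
- apply: integrable_fin_num => //; apply: ik => //; exact: subset_itv_oc_cc.
apply: ge0_subset_integral => //.
  apply/measurable_EFinP/(measurable_funS measurableT) => //.
  exact: continuous_measurable_fun.
by move=> x _; rewrite lee_fin.
Qed.

(** The hypothesis on the boundary term is the Robin condition in weak form: that term cancels the
    flux through the line t = c left over by [chart_green]. *)
Lemma chart_robin_test o e n W s (beta : R) f f1 f2 g g1 g2 (a b c d : R) :
  orthonormal_pair e n -> measurable (W : set (mR * mR)) ->
  (forall t : R, is_derive t 1 f (f1 t)) -> (forall t : R, is_derive t 1 f1 (f2 t)) ->
  (forall t : R, is_derive t 1 g (g1 t)) -> (forall t : R, is_derive t 1 g1 (g2 t)) ->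
  continuous f2 -> continuous g2 -> a < b -> c < d ->
  (forall s, s <= a \/ b <= s -> [/\ f s = 0, f1 s = 0 & f2 s = 0]) ->
  (forall t, t <= - d \/ d <= t -> [/\ g t = 0, g1 t = 0 & g2 t = 0]) ->
  (forall s t, a < s < b -> - d < t < d -> W (chart o e n (s, t)) <-> c < t) ->
  let B := tensor o e n f g in
  (forall h, continuous h -> beta * (\sum_(pq <- s) side_length pq *
     \int[mu]_(t in I01) (B (seg pq.1 pq.2 t) * h (seg pq.1 pq.2 t))) =
   \int[mu]_(s in `]a, b]) (f s * g1 c * h (chart o e n (s, c)))) ->
  robin_test W s beta B (laplacian_tensor o e n f f2 g g2).
Proof.
move=> en mW df df1 dg dg1 cf2 cg2 ab cd f0 g0 WE B bdry.
have cont (k k1 : R -> R) : (forall t : R, is_derive t 1 k (k1 t)) -> continuous k.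
  by move=> dk t; apply: differentiable_continuous; have [] := is_derive_diff (dk t).
have [cf cf1 cg cg1] := And4 (cont _ _ df) (cont _ _ df1) (cont _ _ dg) (cont _ _ dg1).
have [CB _] := tensor_C1 o e n df dg cf1 cg1.
have bs k l : (forall s, s <= a \/ b <= s -> k s = 0) ->
    (forall t, t <= - d \/ d <= t -> l t = 0) -> bounded_support (tensor o e n k l).
  (* From |v + o|^2 <= 2 |v|^2 + 2 |o|^2, with s^2 <= a^2 + b^2 and t^2 <= d^2 on the support. *)
  move=> k0 l0; exists (2 * (a ^+ 2 + b ^+ 2 + d ^+ 2) + 2 * dot o o) => x.
  rewrite -{1 2}(chartK o x en); set s' := dot (x - o) e; set t := dot (x - o) n.
  move=> Mx; rewrite /tensor -/s' -/t.
  have [sa|sa] := leP s' a; first by rewrite k0 ?mul0r//; left.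
  have [sb|sb] := leP b s'; first by rewrite k0 ?mul0r//; right.
  have [ta|ta] := leP t (- d); first by rewrite l0 ?mulr0//; left.
  have [tb|tb] := leP d t; first by rewrite l0 ?mulr0//; right.
  exfalso; move: Mx; rewrite ltNge => /negP; apply.
  have : dot (chart o e n (s', t)) (chart o e n (s', t)) <=
      2 * dot (chart 0 e n (s', t)) (chart 0 e n (s', t)) + 2 * dot o o.
    rewrite /chart /dot /= /GRing.scale /= !add0r.
    have sq2 (u v : R) : (u + v) * (u + v) <= 2 * (v * v) + 2 * (u * u).
      by rewrite -subr_ge0; have := sqr_ge0 (u - v); rewrite expr2; lra.
    have := sq2 o.1 (s' * e.1 + t * n.1); have := sq2 o.2 (s' * e.2 + t * n.2).
    by rewrite !addrA; lra.
  rewrite chart0_dot// => /le_trans; apply; rewrite lerD2r /dot /=.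
  have s2 : s' * s' <= a ^+ 2 + b ^+ 2.
    by clear -sa sb; have [?|?] := leP 0 s'; nra.
  have t2 : t * t <= d ^+ 2 by clear -ta tb; nra.
  by clear -s2 t2; have := sqr_ge0 d; nra.
split=> //.
- by move=> x; apply: cvgD; exact: tensor_continuous.
- by apply: bs => [t /f0[]|t /g0[]].
- have [M1 b1] : bounded_support (tensor o e n f2 g) by apply: bs => [t /f0[]|t /g0[]].
  have [M2 b2] : bounded_support (tensor o e n f g2) by apply: bs => [t /f0[]|t /g0[]].
  exists (Num.max M1 M2) => x; rewrite gt_max => /andP[x1 x2].
  by rewrite /laplacian_tensor b1// b2// addr0.
move=> h ch; rewrite bdry; last exact: C1_continuous.
rewrite addrAC (chart_green en mW df df1 dg dg1 cf2 cg2 ab cd f0 g0 WE ch).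
by rewrite addNr.
Qed.

End Profiles.

(** * Tiles and their sides *)

Section Barycentric.
Variable R : realType.
Implicit Types (o e n p q u v x y : plane R).

Definition cross u v : R := u.1 * v.2 - u.2 * v.1.

Lemma ord3P (j : 'I_3) : [\/ j = 0, j = 1 | j = 2].
Proof.
case: j => [[|[|[|//]]] ij]; [constructor 1|constructor 2|constructor 3]; exact: val_inj.
Qed.

Lemma ordS3_0 : ordS (0 : 'I_3) = 1. Proof. exact: val_inj. Qed.
Lemma ordS3_1 : ordS (1 : 'I_3) = 2. Proof. exact: val_inj. Qed.
Lemma ordS3_2 : ordS (2 : 'I_3) = 0. Proof. exact: val_inj. Qed.
Definition ordS3E := (ordS3_0, ordS3_1, ordS3_2).

Lemma sum3 (V : zmodType) (F : 'I_3 -> V) : \sum_i F i = F 0 + F 1 + F 2.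
Proof.
rewrite !big_ord_recl big_ord0 addr0 addrA.
by congr (F _ + F _ + F _); exact: val_inj.
Qed.

Variable a : 'I_3 -> plane R.
Hypothesis nca : noncollinear a.

Definition area2 : R := cross (a 1 - a 0) (a 2 - a 0).

Lemma area2_neq0 : area2 != 0. Proof. exact: nca. Qed.

(** The ratio of two signed areas: affine in [x], 0 on the line of side [i] and 1 at [a i]. *)
Definition bary (i : 'I_3) x : R :=
  cross (a (ordS (ordS i)) - a (ordS i)) (x - a (ordS i)) / area2.

Lemma bary_sum x : bary 0 x + bary 1 x + bary 2 x = 1.
Proof.
rewrite /bary !ordS3E; move: area2_neq0; rewrite /area2 /cross /=.
case: x (a 0) (a 1) (a 2) => [x1 x2] [a1 a2] [b1 b2] [c1 c2] /= D0.
by field.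
Qed.

Lemma bary_combination x :
  x = bary 0 x *: a 0 + bary 1 x *: a 1 + bary 2 x *: a 2.
Proof.
rewrite /bary !ordS3E; move: area2_neq0; rewrite /area2 /cross /=.
case: x (a 0) (a 1) (a 2) => [x1 x2] [a1 a2] [b1 b2] [c1 c2] /= D0.
by rewrite [RHS]surjective_pairing; congr pair; rewrite /= /GRing.scale /=; field.
Qed.

Lemma bary_affine i x y (t : R) :
  bary i (x + t *: (y - x)) = (1 - t) * bary i x + t * bary i y.
Proof. by rewrite /bary /cross /= /GRing.scale /=; ring. Qed.

Lemma bary_reflect i x y : bary i (2 *: x - y) = 2 * bary i x - bary i y.
Proof. by rewrite /bary /cross /= /GRing.scale /=; ring. Qed.

Lemma bary_vertex i k : bary i (a k) = (i == k)%:R.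
Proof.
rewrite /bary; move: area2_neq0; rewrite /area2 /cross /=.
case: (ord3P i) => ->; case: (ord3P k) => ->; rewrite !ordS3E /= => D0;
  apply/(mulIf D0); rewrite ?mulfVK// ?mul0r ?mul1r; ring.
Qed.

Lemma bary_continuous i : continuous (bary i).
Proof.
move=> x; rewrite /bary /cross; apply: cvgM; last exact: cvg_cst.
apply: cvgB; apply: cvgM; try exact: cvg_cst; apply: cvgB; try exact: cvg_cst;
  [exact: cvg_snd|exact: cvg_fst].
Qed.

Lemma triangleE : triangle a = [set x | forall i, 0 < bary i x].
Proof.
apply/seteqP; split => x /=.
  move=> [c [c0 c1 ->]] i.
  suff -> : bary i (\sum_i c i *: a i) = c i by [].
  have c0E : c 0 = 1 - c 1 - c 2 by rewrite -c1 sum3; ring.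
  have -> : bary i (\sum_i c i *: a i) =
      c 0 * bary i (a 0) + c 1 * bary i (a 1) + c 2 * bary i (a 2).
    by rewrite sum3 c0E /bary /cross /= /GRing.scale /=; ring.
  by rewrite !bary_vertex; case: (ord3P i) => ->; rewrite /= ?mulr0 ?mulr1 ?addr0 ?add0r.
move=> b0; exists (bary^~ x); split => //.
  by rewrite sum3; exact: bary_sum.
by rewrite sum3; exact: bary_combination.
Qed.

End Barycentric.

(** * Isometries and charts along the sides *)

Section SideCharts.
Variable R : realType.
Implicit Types (o e n p q u v x y : plane R) (T : plane R -> plane R).

(** The isometries of the plane, reflections included, in the form for which invariance of the
    integral is at hand. *)
Definition frame T := exists c : plane R * plane R * plane R,
  orthonormal_pair c.1.2 c.2 /\ T = chart c.1.1 c.1.2 c.2.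

Lemma frame_id : frame id.
Proof.
exists (0, dx R, dy R); split; first exact: orthonormal_dy.
apply/funext => -[x y]; rewrite [RHS]surjective_pairing; congr pair;
by rewrite /chart /= /GRing.scale /= !(mulr0, mulr1) ?add0r ?addr0.
Qed.

Lemma chart_comp o e n o' e' n' :
  chart o e n \o chart o' e' n' = chart (chart o e n o')
    (e'.1 *: e + e'.2 *: n) (n'.1 *: e + n'.2 *: n).
Proof.
apply/funext => x; rewrite [LHS]surjective_pairing [RHS]surjective_pairing.
by congr pair; rewrite /chart /= /GRing.scale /=; ring.
Qed.

Lemma orthonormal_comp e n e' n' : orthonormal_pair e n -> orthonormal_pair e' n' ->
  orthonormal_pair (e'.1 *: e + e'.2 *: n) (n'.1 *: e + n'.2 *: n).
Proof.
have key u v : orthonormal_pair e n ->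
    dot (u.1 *: e + u.2 *: n) (v.1 *: e + v.2 *: n) = dot u v.
  case=> ee nn en; transitivity (u.1 * v.1 * dot e e + u.2 * v.2 * dot n n +
    (u.1 * v.2 + u.2 * v.1) * dot e n).
    by rewrite /dot /= /GRing.scale /=; ring.
  by rewrite ee nn en /dot; ring.
by move=> en [ee' nn' en']; split; rewrite key.
Qed.

Lemma frame_comp T T' : frame T -> frame T' -> frame (T \o T').
Proof.
move=> [[[p e] n] [/= en ->]] [[[p' e'] n'] [/= en' ->]].
exists (chart p e n p', e'.1 *: e + e'.2 *: n, n'.1 *: e + n'.2 *: n).
by split; [exact: orthonormal_comp|exact: chart_comp].
Qed.

Lemma frame_inv o e n : orthonormal_pair e n ->
  frame (fun x => (dot (x - o) e, dot (x - o) n)).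
Proof.
(* At the two basis vectors, [chartK] turns orthonormality of the columns [e], [n] into that of the
   rows. *)
move=> en; have K v := chartK 0 v en.
have := K (dx R); have := K (dy R); rewrite !subr0.
rewrite /chart /dot /= /GRing.scale /= !(mul0r, mul1r, add0r, addr0).
move=> [y1 y2] [x1 x2].
exists ((- dot o e, - dot o n), (e.1, n.1), (e.2, n.2)); split.
  by rewrite /orthonormal_pair /dot /=; split;
    [exact: x1|exact: y2|rewrite mulrC [n.1 * _]mulrC; exact: y1].
apply/funext => x; rewrite [RHS]surjective_pairing; congr pair;
by rewrite /chart /dot /= /GRing.scale /=; ring.
Qed.

Variable a : 'I_3 -> plane R.
Hypothesis nca : noncollinear a.

Definition side_len j : R := side_length (side_of a j).
Definition side_dir j : plane R :=
  (side_len j)^-1 *: (a (ordS (ordS j)) - a (ordS j)).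
(** The sign of the area makes it point into the triangle for either orientation of the vertices. *)
Definition side_normal j : plane R :=
  (- (Num.sg (area2 a) * (side_dir j).2), Num.sg (area2 a) * (side_dir j).1).
(* [s] is the arc length along the side, [t] the signed distance to its line,
   positive on the inner side. *)
Definition side_chart j : plane R -> plane R :=
  chart (a (ordS j)) (side_dir j) (side_normal j).

(** If two vertices coincided, one barycentric coordinate would be both 1 and 0 there. *)
Lemma side_vec_dot j : 0 <
  dot (a (ordS (ordS j)) - a (ordS j)) (a (ordS (ordS j)) - a (ordS j)).
Proof.
have [i [ne1 ne2]] : exists i : 'I_3, (i == ordS (ordS j)) /\ (i != ordS j).
  by exists (ordS (ordS j)); split => //; case: (ord3P j) => ->; rewrite !ordS3E.
set v := a _ - _; rewrite lt_def; apply/andP; split; last first.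
  by rewrite /dot addr_ge0// -expr2 sqr_ge0.
apply/negP => /eqP v0.
have [v1 v2] : v.1 = 0 /\ v.2 = 0.
  move/eqP: v0; rewrite /dot -!expr2 paddr_eq0 ?sqr_ge0// !sqrf_eq0.
  by move=> /andP[/eqP ? /eqP ?].
have av : a (ordS (ordS j)) = a (ordS j).
  apply/eqP; rewrite -subr_eq0 -/v; apply/eqP.
  by rewrite [LHS]surjective_pairing v1 v2.
have := bary_vertex nca (ordS (ordS j)) (ordS j); rewrite -av bary_vertex// eqxx.
rewrite -(eqP ne1) (negbTE ne2) => /eqP; apply/negP; exact: oner_neq0.
Qed.

Lemma side_len_gt0 j : 0 < side_len j.
Proof. by rewrite /side_len /side_length /enorm sqrtr_gt0; exact: side_vec_dot. Qed.

Lemma side_vecE j : a (ordS (ordS j)) - a (ordS j) = side_len j *: side_dir j.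
Proof. by rewrite /side_dir scalerA mulfV ?scale1r// gt_eqF// side_len_gt0. Qed.

Lemma dot_side_dir j : dot (side_dir j) (side_dir j) = 1.
Proof.
have L2 : side_len j ^+ 2 =
    dot (a (ordS (ordS j)) - a (ordS j)) (a (ordS (ordS j)) - a (ordS j)).
  by rewrite /side_len /side_length /enorm sqr_sqrtr// ltW// side_vec_dot.
have L0 : side_len j != 0 by rewrite gt_eqF// side_len_gt0.
move: L2; rewrite side_vecE; move: (side_dir j) => e.
have -> : dot (side_len j *: e) (side_len j *: e) = side_len j ^+ 2 * dot e e.
  by rewrite /dot /= /GRing.scale /=; ring.
move=> /eqP; rewrite -[X in X == _]mulr1 => /eqP /mulfI; rewrite expf_neq0// => /(_ isT).
by [].
Qed.

Lemma side_orthonormal j : orthonormal_pair (side_dir j) (side_normal j).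
Proof.
have ee := dot_side_dir j.
have s2 : Num.sg (area2 a) ^+ 2 = 1 by rewrite sqr_sg (area2_neq0 nca).
split=> //; rewrite /side_normal; move: ee s2; move: (Num.sg _) (side_dir j) => s e.
  rewrite /dot /= => ee s2; transitivity (s ^+ 2 * (e.1 * e.1 + e.2 * e.2)); first by ring.
  by rewrite ee s2 mulr1.
by move=> _ _; rewrite /dot /=; ring.
Qed.

Lemma side_chart_frame j : frame (side_chart j).
Proof. by exists (a (ordS j), side_dir j, side_normal j); split => //; exact: side_orthonormal. Qed.

(** The factor is the reciprocal of the height over side [j]. *)
Lemma bary_side_chart j s t :
  bary a j (side_chart j (s, t)) = side_len j / `|area2 a| * t.
Proof.
rewrite /bary side_vecE.
have ee := dot_side_dir j.
have -> : side_chart j (s, t) - a (ordS j) = s *: side_dir j + t *: side_normal j.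
  by rewrite /side_chart /chart /= -(addrA (a (ordS j))) addrAC subrr add0r.
rewrite [in RHS]normrEsg invfM /side_normal.
have sV : (Num.sg (area2 a))^-1 = Num.sg (area2 a).
  have /orP[/eqP ->|/eqP ->] : (Num.sg (area2 a) == 1) || (Num.sg (area2 a) == -1).
    by rewrite -eqf_sqr expr1n sqr_sg (area2_neq0 nca).
  - by rewrite invr1.
  - by rewrite invrN invr1.
rewrite sV; move: (Num.sg _) (side_dir j) ee => sg e ee.
rewrite /cross /= /GRing.scale /=; move: (area2 a)^-1 => D.
transitivity (side_len j * t * sg * dot e e * D); first by rewrite /dot; ring.
by rewrite ee; ring.
Qed.

Lemma side_chart_seg j (t : R) :
  seg (side_of a j).1 (side_of a j).2 t = side_chart j (side_len j * t, 0).
Proof.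
by rewrite /seg /side_of /side_chart /chart /= side_vecE scalerA scale0r addr0 mulrC.
Qed.

Lemma bary_side_gt0 i j s : i != j -> 0 < s < side_len j ->
  0 < bary a i (side_chart j (s, 0)).
Proof.
move=> ij /andP[s0 sL]; have L0 := side_len_gt0 j.
have -> : s = side_len j * (s / side_len j) by rewrite mulrC divfK ?gt_eqF.
have t0 : 0 < s / side_len j by rewrite divr_gt0.
have t1 : s / side_len j < 1 by rewrite ltr_pdivrMr// mul1r.
rewrite -side_chart_seg /seg /side_of /= bary_affine !bary_vertex//.
move: ij t0 t1; move: (_ / _) => t.
case: (ord3P i) => ->; case: (ord3P j) => ->; rewrite !ordS3E /= => // _ t0 t1; lra.
Qed.

Lemma reflection_side_chart j s t :
  reflection (side_of a j).1 (side_of a j).2 (side_chart j (s, t)) = side_chart j (s, - t).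
Proof.
have [ee _ en] := side_orthonormal j; have L0 := side_len_gt0 j.
rewrite /reflection /side_of /= side_vecE.
have -> : side_chart j (s, t) - a (ordS j) = s *: side_dir j + t *: side_normal j.
  by rewrite /side_chart /chart /= -(addrA (a (ordS j))) addrAC subrr add0r.
move: ee en; rewrite /side_chart /chart /=.
move: (side_dir j) (side_normal j) (side_len j) L0 (a (ordS j)) => e n L L0 p ee en.
have -> : dot (s *: e + t *: n) (L *: e) / dot (L *: e) (L *: e) *: (L *: e) = s *: e.
  have -> : dot (s *: e + t *: n) (L *: e) = L * s.
    transitivity (L * s * dot e e + L * t * dot e n).
      by rewrite /dot /= /GRing.scale /=; ring.
    by rewrite ee en; ring.
  have -> : dot (L *: e) (L *: e) = L * L.
    transitivity (L * L * dot e e); first by rewrite /dot /= /GRing.scale /=; ring.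
    by rewrite ee mulr1.
  by rewrite scalerA; congr (_ *: _); field; rewrite gt_eqF.
rewrite [LHS]surjective_pairing [RHS]surjective_pairing.
by congr pair; rewrite /= /GRing.scale /=; ring.
Qed.

Lemma reflection_frame j : frame (reflection (side_of a j).1 (side_of a j).2).
Proof.
have [ee nn en] := side_orthonormal j.
pose e := side_dir j; pose n := side_normal j; pose p := a (ordS j).
have -> : reflection (side_of a j).1 (side_of a j).2 =
    chart p e (- n) \o (fun x => (dot (x - p) e, dot (x - p) n)).
  apply/funext => x; rewrite -{1}(chartK p x (side_orthonormal j)).
  rewrite -/(side_chart j) reflection_side_chart.
  by rewrite /side_chart /chart /= scalerN scaleNr.
apply: frame_comp; last exact: frame_inv (side_orthonormal j).
exists (p, e, - n); split=> //=; split=> //; rewrite -/e -/n in ee nn en *.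
  by rewrite -nn /dot /=; ring.
by apply/eqP; rewrite -oppr_eq0 -en /dot /= eq_sym; apply/eqP; ring.
Qed.

End SideCharts.

Section Frames.
Variable R : realType.
Implicit Types (T S : plane R -> plane R) (x y : plane R).

Lemma frame_continuous T : frame T -> continuous T.
Proof. by move=> [c [_ ->]]; exact: chart_continuous. Qed.

Lemma frame_reflect T x y : frame T -> T (2 *: x - y) = 2 *: T x - T y.
Proof.
move=> [c [_ ->]]; rewrite [LHS]surjective_pairing [RHS]surjective_pairing.
by congr pair; rewrite /chart /= /GRing.scale /=; ring.
Qed.

Lemma frame_seg T x y t : frame T -> T (seg x y t) = seg (T x) (T y) t.
Proof.
move=> [c [_ ->]]; rewrite [LHS]surjective_pairing [RHS]surjective_pairing.
by congr pair; rewrite /seg /chart /= /GRing.scale /=; ring.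
Qed.

Lemma frame_inverse T : frame T -> exists S, [/\ frame S, cancel T S & cancel S T].
Proof.
move=> [c [en ->]].
exists (fun x => (dot (x - c.1.1) c.1.2, dot (x - c.1.1) c.2)); split.
- exact: frame_inv.
- by move=> x; rewrite chart_coord1// chart_coord2// -surjective_pairing.
- by move=> x; exact: chartK.
Qed.

Lemma avoid_finite (l : seq R) (L : R) : 0 < L ->
  exists2 s, 0 < s < L & s \notin l.
Proof.
(* For the induction the claim is strengthened to a whole subinterval that avoids [l]. *)
move=> L0; suff [c [d [[cd c0 dL] av]]] : exists c d : R, [/\ c < d, 0 <= c & d <= L] /\
    forall s, c < s < d -> s \notin l.
  by exists ((c + d) / 2); [|apply: av]; apply/andP; split; lra.
elim: l => [|x l [c [d [[cd c0 dL] av]]]]; first by exists 0, L.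
case: (boolP (c < x < d)) => [/andP[cx xd]|ncxd].
  exists c, x; split; first by split => //; apply: le_trans dL; exact: ltW.
  move=> s /andP[cs sx]; rewrite inE negb_or lt_eqF//= av// cs/=.
  exact: lt_trans xd.
exists c, d; split => // s sd; rewrite inE negb_or av// andbT.
by apply: contraNneq ncxd => <-.
Qed.

Lemma near_lt_continuous (c : plane R -> R) (x : plane R) (v : R) :
  continuous c -> c x < v -> \forall y \near x, c y < v.
Proof. by move=> cc cv; exact: (cvgr_lt _ (cc x) _ cv). Qed.

Lemma near_gt_continuous (c : plane R -> R) (x : plane R) (v : R) :
  continuous c -> v < c x -> \forall y \near x, v < c y.
Proof. by move=> cc cv; exact: (cvgr_gt _ (cc x) _ cv). Qed.

Lemma near_box (s0 t0 : R) (P : set (plane R)) : (\forall x \near (s0, t0), P x) ->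
  exists2 r : R, 0 < r & forall s t, `|s - s0| <= r -> `|t - t0| <= r -> P (s, t).
Proof.
move=> /nbhs_ballP[e /= e0 eP]; exists (e / 2); first by rewrite divr_gt0.
have e2 : e / 2 < e by lra.
move=> s t ss tt; apply: eP; split => /=.
  by rewrite /ball /= distrC; exact: le_lt_trans e2.
by rewrite /ball /= distrC; exact: le_lt_trans e2.
Qed.

Lemma near_point_reflect (x : plane R) (P : set (plane R)) :
  (\forall y \near x, P y) -> \forall y \near x, P (2 *: x - y).
Proof.
move=> /nbhs_ballP[e /= e0 eP]; apply/nbhs_ballP; exists e => // y [/= y1 y2].
apply: eP; split => /=; move: y1 y2; rewrite /ball /= /GRing.scale /= => y1 y2.
  rewrite (_ : x.1 - _ = - (x.1 - y.1)) ?normrN//; ring.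
rewrite (_ : x.2 - _ = - (x.2 - y.2)) ?normrN//; ring.
Qed.

End Frames.

(** * Tiles in barycentric coordinates *)

Section Tiles.
Variable R : realType.
Variable a : 'I_3 -> plane R.
Hypothesis nca : noncollinear a.
Variables tau sigma : 'I_7 -> plane R -> plane R.
Hypothesis ftau : forall k, frame (tau k).
Hypothesis fsigma : forall k, frame (sigma k).
Hypothesis tauK : forall k, cancel (tau k) (sigma k).
Hypothesis sigmaK : forall k, cancel (sigma k) (tau k).
Implicit Types (x y : plane R) (k l m : 'I_7) (i j : 'I_3).

Definition tbary k i x := bary a i (sigma k x).

Lemma tbary_continuous k i : continuous (tbary k i).
Proof.
move=> x; apply: (@continuous_comp _ _ _ (sigma k) (bary a i)).
  exact: frame_continuous.
exact: bary_continuous.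
Qed.

Lemma tbary_reflect k i x y : tbary k i (2 *: x - y) = 2 * tbary k i x - tbary k i y.
Proof. by rewrite /tbary frame_reflect// bary_reflect. Qed.

Lemma tileE k : tile a tau k = [set x | forall i, 0 < tbary k i x].
Proof.
rewrite /tile triangleE//; apply/seteqP; split => x /=.
  by move=> [y ty <-] i; rewrite /tbary tauK.
by move=> tx; exists (sigma k x) => //; rewrite sigmaK.
Qed.

Lemma tile_near k x : tile a tau k x -> \forall y \near x, tile a tau k y.
Proof.
rewrite tileE => /= tx.
apply: (@filter_forall _ _ (fun i => [set y | 0 < tbary k i y]) (nbhs x) _) => i.
exact: (near_gt_continuous (tbary_continuous (k := k) (i := i)) (tx i)).
Qed.

(** A point with nonnegative coordinates enters the tile at once when it moves towards the
    centroid. *)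
Lemma tile_closureE k :
  closure (tile a tau k) = [set x | forall i, 0 <= tbary k i x].
Proof.
apply/seteqP; split => x /=.
  move=> cx i; rewrite leNgt; apply/negP => bx.
  have [y [ty yx]] := cx _ (near_lt_continuous (tbary_continuous (k := k) (i := i)) bx).
  by move: yx; rewrite tileE in ty; move=> /= /lt_trans /(_ (ty i)); rewrite ltxx.
move=> bx B Bx.
pose g : plane R := 3^-1 *: (a 0 + a 1 + a 2).
have gb i : bary a i g = 3^-1.
  have -> : bary a i g = 3^-1 * (bary a i (a 0) + bary a i (a 1) + bary a i (a 2)).
    by rewrite /g /bary /cross /= /GRing.scale /=; field.
  rewrite !bary_vertex//; case: (ord3P i) => ->; rewrite /= ?addr0 ?add0r mulr1//.
pose z (t : R) := tau k (sigma k x + t *: (g - sigma k x)).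
have z0 : z 0 = x by rewrite /z scale0r addr0 sigmaK.
have cz : {for 0, continuous z}.
  apply: (@continuous_comp _ _ _ (fun t : R => sigma k x + t *: (g - sigma k x)) (tau k)).
    by apply: cvgD; [exact: cvg_cst|apply: cvgZr_tmp; exact: cvg_id].
  exact: frame_continuous.
have : nbhs (0 : R) (z @^-1` B) by apply: cz; rewrite z0.
move=> /nbhs_ballP[e /= e0 eB].
pose t := Num.min (e / 2) 1.
have t0 : 0 < t by rewrite lt_min ltr01 divr_gt0.
have t1 : t <= 1 by rewrite ge_min lexx orbT.
have te : t < e by rewrite gt_min; apply/orP; left; lra.
exists (z t); split; last first.
  by apply: eB; rewrite /ball /= sub0r normrN gtr0_norm.
rewrite tileE /= => i; rewrite /tbary /z tauK bary_affine gb.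
have := bx i; rewrite /tbary; move: (bary a i _) => b b0; nra.
Qed.

Lemma tile_sub_closure k x : tile a tau k x -> closure (tile a tau k) x.
Proof. by move=> tx; apply: subset_closure. Qed.

Lemma gluedE x : glued a tau x <->
  \forall y \near x, exists k, closure (tile a tau k) y.
Proof.
split=> [|H]; rewrite /glued /interior /=.
  by apply: filterS => y [k _ ky]; exists k.
by apply: filterS H => y [k ky]; exists k.
Qed.

Lemma tile_glued k x : tile a tau k x -> glued a tau x.
Proof.
move=> /tile_near tx; apply/gluedE; apply: filterS tx => y ty.
by exists k; exact: tile_sub_closure.
Qed.

Lemma glued_open : open (glued a tau).
Proof. exact: open_interior. Qed.

Definition tchart k j := tau k \o side_chart a j.

Lemma tchart_frame k j : frame (tchart k j).
Proof. by apply: frame_comp => //; exact: side_chart_frame. Qed.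

Lemma tbary_tchart k i j x : tbary k i (tchart k j x) = bary a i (side_chart a j x).
Proof. by rewrite /tbary /tchart /= tauK. Qed.

(* The box around [(s0, 0)] meets no side line but that of [j]. *)
Definition good_box j (s0 r : R) := 0 < r /\ forall s t i, `|s - s0| <= r ->
  `|t| <= r -> i != j -> 0 < bary a i (side_chart a j (s, t)).

Lemma good_box_exists j s0 : 0 < s0 < side_len a j -> exists2 r0 : R, 0 < r0 &
  forall r, 0 < r <= r0 -> good_box j s0 r.
Proof.
move=> s0L.
have : \forall x \near (s0, 0 : R), forall i, i != j -> 0 < bary a i (side_chart a j x).
  apply: (@filter_forall _ _ (fun i => [set x | i != j -> 0 < bary a i (side_chart a j x)]) (nbhs (s0, 0)) _) => i.
  have [ij|ij] := boolP (i != j); last by near=> x.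
  have cb : continuous (fun x => bary a i (side_chart a j x)).
    move=> x; apply: (@continuous_comp _ _ _ (side_chart a j) (bary a i)).
      exact: chart_continuous.
    exact: bary_continuous.
  have := near_gt_continuous cb (bary_side_gt0 nca ij s0L).
  by apply: filterS => x xb _.
move=> /near_box[r0 r0_gt0 box]; exists r0 => // r /andP[r_gt0 rr0]; split => // s t i ss tt.
by apply: box; rewrite ?subr0; apply: le_trans rr0.
Unshelve. all: by end_near. Qed.

Lemma bary_side_sign j s t :
  (0 < bary a j (side_chart a j (s, t))) = (0 < t) /\
  (0 <= bary a j (side_chart a j (s, t))) = (0 <= t).
Proof.
rewrite bary_side_chart//.
have c0 : 0 < side_len a j / `|area2 a|.
  by rewrite divr_gt0 ?side_len_gt0// normr_gt0 area2_neq0.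
by rewrite pmulr_rgt0// pmulr_rge0.
Qed.

Section Box.
Variables (j : 'I_3) (s0 r : R).
Hypothesis gb : good_box j s0 r.

Lemma box_triangle s t : `|s - s0| <= r -> `|t| <= r ->
  triangle a (side_chart a j (s, t)) <-> 0 < t.
Proof.
move=> ss tt; rewrite triangleE//=; split=> [/(_ j)|t0 i].
  by rewrite (bary_side_sign j s t).1.
have [->|ij] := eqVneq i j; first by rewrite (bary_side_sign j s t).1.
exact: gb.2.
Qed.

Lemma box_tile k s t : `|s - s0| <= r -> `|t| <= r ->
  tile a tau k (tchart k j (s, t)) <-> 0 < t.
Proof.
move=> ss tt; rewrite -(box_triangle ss tt) tileE triangleE//=.
by split => H i; have := H i; rewrite tbary_tchart.
Qed.

Lemma box_closure k s t : `|s - s0| <= r -> `|t| <= r ->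
  closure (tile a tau k) (tchart k j (s, t)) <-> 0 <= t.
Proof.
move=> ss tt; rewrite tile_closureE /=; split=> [/(_ j)|t0 i].
  by rewrite tbary_tchart (bary_side_sign j s t).2.
rewrite tbary_tchart; have [->|ij] := eqVneq i j; first by rewrite (bary_side_sign j s t).2.
by apply: ltW; exact: gb.2.
Qed.

Lemma near_open_box k s t : `|s - s0| < r -> `|t| < r ->
  \forall x \near tchart k j (s, t), exists s' t',
    [/\ `|s' - s0| < r, `|t'| < r & x = tchart k j (s', t')].
Proof.
move=> ss tt; have [S [fS TS ST]] := frame_inverse (tchart_frame k j).
have cS := frame_continuous fS.
have c1 : continuous (fun x => `|(S x).1 - s0|).
  move=> x; apply: cvg_norm; apply: cvgB; last exact: cvg_cst.
  by apply: (@continuous_comp _ _ _ S fst); [exact: cS|exact: cvg_fst].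
have c2 : continuous (fun x => `|(S x).2|).
  move=> x; apply: cvg_norm.
  by apply: (@continuous_comp _ _ _ S snd); [exact: cS|exact: cvg_snd].
have n1 : \forall x \near tchart k j (s, t), `|(S x).1 - s0| < r.
  by apply: (near_lt_continuous c1); rewrite TS.
have n2 : \forall x \near tchart k j (s, t), `|(S x).2| < r.
  by apply: (near_lt_continuous c2); rewrite TS.
apply: filterS2 n1 n2 => x x1 x2.
by exists (S x).1, (S x).2; split => //; rewrite -surjective_pairing ST.
Qed.

End Box.
End Tiles.

(** * The domain near a shared or an outer side *)

Section LocalTests.
Variable R : realType.
Variable a : 'I_3 -> plane R.
Hypothesis nca : noncollinear a.
Variables tau sigma : 'I_7 -> plane R -> plane R.
Hypothesis ftau : forall k, frame (tau k).
Hypothesis fsigma : forall k, frame (sigma k).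
Hypothesis tauK : forall k, cancel (tau k) (sigma k).
Hypothesis sigmaK : forall k, cancel (sigma k) (tau k).
Hypothesis disj : forall k l, k != l -> tile a tau k `&` tile a tau l = set0.
Variable E : pattern.
Hypothesis outer : forall pq, pq \in outer_sides a E tau ->
  forall t, 0 <= t <= 1 -> ~ glued a tau (seg pq.1 pq.2 t).
Implicit Types (x y : plane R) (k l m : 'I_7) (i j : 'I_3).

Local Notation lchart := (tchart a tau).
Let tcf k j : frame (lchart k j) := tchart_frame nca ftau k j.
Let btile := box_tile nca tauK sigmaK.
Let tcE := tile_closureE nca ftau fsigma tauK sigmaK.
Let tE := tileE nca tauK sigmaK.
Let tnear := tile_near nca fsigma tauK sigmaK.
Let tbt := tbary_tchart a tauK.
Let tbr := tbary_reflect a fsigma.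
Let bclosure := box_closure nca ftau fsigma tauK sigmaK.
Let nbox := near_open_box nca ftau.

Lemma tile_disjoint k m x : k != m -> tile a tau k x -> ~ tile a tau m x.
Proof. by move=> km kx mx; have : set0 x by rewrite -(disj km). Qed.

Lemma tchart_continuous k j : continuous (lchart k j).
Proof. by apply: frame_continuous; exact: tcf. Qed.

Section Shared.
Variables (k k' : 'I_7) (j : 'I_3).
Hypothesis tk' : tau k' = tau k \o reflection (side_of a j).1 (side_of a j).2.

Lemma shared_tchart s t : lchart k' j (s, t) = lchart k j (s, - t).
Proof. by rewrite /tchart tk' /= reflection_side_chart. Qed.

Variables (s0 r : R).
Hypothesis gb : good_box a j s0 r.

(** The closure of tile [k] covers the upper half of the box, that of [k'] the lower half. *)
Lemma shared_box_glued s t : `|s - s0| < r -> `|t| < r ->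
  glued a tau (lchart k j (s, t)).
Proof.
move=> ss tt; apply/gluedE; have H := nbox j k ss tt.
apply: filterS H => x [s' [t' [s1 t1 ->]]].
have [t0|/ltW t0] := leP 0 t'.
  by exists k; apply/(bclosure gb k (ltW s1) (ltW t1)).
exists k'; rewrite -[t']opprK -shared_tchart.
apply/(bclosure gb k' (ltW s1)); first by rewrite normrN ltW.
by rewrite oppr_ge0.
Qed.

Lemma shared_box_disjoint m s t : m != k -> m != k' ->
  `|s - s0| < r -> `|t| < r -> ~ tile a tau m (lchart k j (s, t)).
Proof.
move=> mk mk' ss tt; have [t0|t0|t0] := ltgtP 0 t.
- by apply: (tile_disjoint (k := k)); [rewrite eq_sym|apply/(btile gb k (ltW ss) (ltW tt))].
- apply: (tile_disjoint (k := k')); first by rewrite eq_sym.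
  rewrite -[t]opprK -shared_tchart.
  by apply/(btile gb k' (ltW ss)); rewrite ?normrN ?ltW// oppr_gt0.
(* Tiles are open, so one that contains a point of the side contains points just above it, which
   belong to tile [k]. *)
- rewrite -t0 => /tnear mt.
  have /near_box[e e0 eB] := @tchart_continuous k j (s, 0) _ mt.
  pose d := Num.min e r.
  have d0 : 0 < d by rewrite lt_min e0 gb.1.
  have dd : `|d| = d by rewrite gtr0_norm.
  have /= := eB s d; rewrite subrr normr0 subr0 dd ge_min lexx (ltW e0).
  move=> /(_ isT isT); apply: (tile_disjoint (k := k)); first by rewrite eq_sym.
  by apply/(btile gb k (ltW ss)); rewrite ?dd// ge_min lexx orbT.
Qed.

End Shared.

Section Outer.
Variables (k : 'I_7) (j : 'I_3).
Hypothesis kj : ~~ shared E k j.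

Lemma outer_mem : tile_side a tau k j \in outer_sides a E tau.
Proof.
by apply/mapP; exists (k, j) => //; rewrite mem_filter kj mem_enum.
Qed.

Lemma tile_side_seg l i t : seg (tile_side a tau l i).1 (tile_side a tau l i).2 t =
  lchart l i (side_len a i * t, 0).
Proof. by rewrite /tile_side /= -frame_seg// /tchart /= -side_chart_seg. Qed.

Lemma outer_not_glued s : 0 <= s <= side_len a j -> ~ glued a tau (lchart k j (s, 0)).
Proof.
move=> /andP[s0 sL]; have L0 := side_len_gt0 nca j.
have := outer outer_mem (t := s / side_len a j).
rewrite tile_side_seg (mulrC (side_len a j)) divfK ?gt_eqF//; apply.
by rewrite divr_ge0 ?(ltW L0)//= ler_pdivrMr// mul1r.
Qed.

(** Another tile [m] whose closure reached a point [p] of the side, away from all vertices, would be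
    a half-disc at [p], as is tile [k]. Being disjoint, the two half-discs would fill a
    neighbourhood of [p], and [p] would be interior to the glued set. *)
Lemma outer_point : exists2 s0, 0 < s0 < side_len a j &
  forall m, m != k -> ~ closure (tile a tau m) (lchart k j (s0, 0)).
Proof.
have [S [fS TS ST]] := frame_inverse (tcf k j).
(* First chart coordinates of all vertices of all tiles; avoiding them keeps [p] away from every
   vertex. *)
pose vs := [seq (S (tau mi.1 (a mi.2))).1 | mi <- enum {: 'I_7 * 'I_3}].
have [s0 s0L nv] := avoid_finite vs (side_len_gt0 nca j).
exists s0 => // m mk; set p := lchart k j (s0, 0).
rewrite tcE => /= mp.
have novertex i : p <> tau m (a i).
  move=> pE; move/negP: nv; apply; apply/mapP; exists (m, i); first by rewrite mem_enum.
  by rewrite /= -pE TS.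
have np : ~ glued a tau p.
  by apply: outer_not_glued; case/andP: s0L => /ltW -> /ltW ->.
have kp i : i != j -> 0 < tbary a sigma k i p.
  by move=> ij; rewrite tbt; exact: bary_side_gt0.
have kpj : tbary a sigma k j p = 0 by rewrite tbt bary_side_chart// mulr0.
(* At most one barycentric coordinate of [p] in the tile [m] vanishes, since
   [p] is not a vertex. *)
have one i i' : i != i' -> tbary a sigma m i p = 0 -> 0 < tbary a sigma m i' p.
  move=> ii' z; rewrite lt_def mp andbT; apply/negP => /eqP z'.
  have := bary_combination nca (sigma m p); have := bary_sum nca (sigma m p).
  move: z z'; rewrite /tbary.
  have done_ i'' : sigma m p = a i'' -> False.
    by move=> pa; apply: (novertex i''); rewrite -pa sigmaK.
  case: (ord3P i) ii' => ->; case: (ord3P i') => -> //= _ -> ->;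
    rewrite ?add0r ?addr0 => ->; rewrite ?scale0r ?scale1r ?add0r ?addr0; exact: done_.
have [i0 mi0 mi] : exists2 i0, tbary a sigma m i0 p = 0 &
    forall i, i != i0 -> 0 < tbary a sigma m i p.
  have [all|] := pselect (forall i, 0 < tbary a sigma m i p).
    exfalso.
    (* The open tile [m] would be a neighbourhood of [p], hence meet tile [k], whose closure
       contains [p]. *)
    have /tnear : tile a tau m p by rewrite tE.
    have : closure (tile a tau k) p.
      rewrite tcE => /= i; have [->|/kp/ltW//] := eqVneq i j.
      by rewrite kpj.
    move=> /[apply] -[x [kx mx]].
    by apply: (tile_disjoint (k := m) (m := k)) kx.
  move=> /existsNP[i0 /negP]; rewrite -leNgt => i0p.
  have z : tbary a sigma m i0 p = 0 by apply/eqP; rewrite eq_le i0p mp.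
  by exists i0 => // i ii0; apply: (one i0 i) => //; rewrite eq_sym.
apply: np; apply/gluedE.
have ctb l i : continuous (tbary a sigma l i) by exact: tbary_continuous.
have near_m : \forall x \near p, forall i, i != i0 -> 0 < tbary a sigma m i x.
  apply: (@filter_forall _ _ (fun i => [set x | i != i0 -> 0 < tbary a sigma m i x]) (nbhs p) _) => i.
  have [->|ii0] := eqVneq i i0; first by near=> x.
  by apply: filterS (near_gt_continuous (ctb m i) (mi _ ii0)) => x xb _.
have near_k : \forall x \near p, forall i, i != j -> 0 < tbary a sigma k i x.
  apply: (@filter_forall _ _ (fun i => [set x | i != j -> 0 < tbary a sigma k i x]) (nbhs p) _) => i.
  have [->|ij] := eqVneq i j; first by near=> x.
  by apply: filterS (near_gt_continuous (ctb k i) (kp _ ij)) => x xb _.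
have near_m' := near_point_reflect near_m.
have near_k' := near_point_reflect near_k.
near=> x.
have xm : forall i, i != i0 -> 0 < tbary a sigma m i x by near: x.
have xk : forall i, i != j -> 0 < tbary a sigma k i x by near: x.
have xm' : forall i, i != i0 -> 0 < tbary a sigma m i (2 *: p - x) by near: x.
have xk' : forall i, i != j -> 0 < tbary a sigma k i (2 *: p - x) by near: x.
have [m0|m0] := leP 0 (tbary a sigma m i0 x).
  exists m; rewrite tcE => /= i.
  by have [->//|/xm/ltW] := eqVneq i i0.
have [k0|k0] := leP 0 (tbary a sigma k j x).
  exists k; rewrite tcE => /= i.
  by have [->//|/xk/ltW] := eqVneq i j.
(* If [x] lies strictly beyond both side lines through [p], its mirror image in [p] lies in both
   open tiles. *)
exfalso; apply: (@tile_disjoint m k (2 *: p - x)) => //; rewrite tE => /= i.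
  have [->|/xm'//] := eqVneq i i0.
  by rewrite tbr mi0 mulr0 sub0r oppr_gt0.
have [->|/xk'//] := eqVneq i j.
by rewrite tbr kpj mulr0 sub0r oppr_gt0.
Unshelve. all: by end_near. Qed.

Lemma outer_box : exists2 s0, 0 < s0 < side_len a j & exists2 r0, 0 < r0 &
  forall s t, `|s - s0| <= r0 -> `|t| <= r0 ->
  forall m, m != k -> ~ closure (tile a tau m) (lchart k j (s, t)).
Proof.
have [s0 s0L out] := outer_point; exists s0 => //.
have near_out : \forall x \near lchart k j (s0, 0),
    forall m, m != k -> ~ closure (tile a tau m) x.
  apply: (@filter_forall _ _ (fun m => [set x | m != k -> ~ closure (tile a tau m) x]) (nbhs _) _) => m.
  have [->|mk] := eqVneq m k; first by near=> x.
  have : open (~` closure (tile a tau m)) by apply: closed_openC; exact: closed_closure.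
  move=> oC; have : nbhs (lchart k j (s0, 0)) (~` closure (tile a tau m)).
    by apply: open_nbhs_nbhs; split => //; exact: out.
  by apply: filterS => x xm _.
have /near_box[r0 r00 box] : \forall y \near (s0, 0 : R),
    forall m, m != k -> ~ closure (tile a tau m) (lchart k j y).
  exact: (tchart_continuous near_out).
by exists r0 => // s t ss tt m; apply: box; rewrite ?subr0.
Unshelve. all: by end_near. Qed.

End Outer.
End LocalTests.

(** * Test functions near a side *)

Section LocalTests2.
Variable R : realType.
Local Notation mu := (@lebesgue_measure R).
Local Notation I01 := (@unit_interval R).
Variable a : 'I_3 -> plane R.
Hypothesis nca : noncollinear a.
Variables tau sigma : 'I_7 -> plane R -> plane R.
Hypothesis ftau : forall k, frame (tau k).
Hypothesis fsigma : forall k, frame (sigma k).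
Hypothesis tauK : forall k, cancel (tau k) (sigma k).
Hypothesis sigmaK : forall k, cancel (sigma k) (tau k).
Hypothesis disj : forall k l, k != l -> tile a tau k `&` tile a tau l = set0.
Variable E : pattern.
Hypothesis outer : forall pq, pq \in outer_sides a E tau ->
  forall t, 0 <= t <= 1 -> ~ glued a tau (seg pq.1 pq.2 t).
Implicit Types (x y : plane R) (k l m : 'I_7) (i j : 'I_3).

Local Notation lchart := (tchart a tau).
Let tcf k j : frame (lchart k j) := tchart_frame nca ftau k j.

Definition profile (c r : R) (f f1 f2 : R -> R) :=
  [/\ forall t : R, is_derive t 1 f (f1 t), forall t : R, is_derive t 1 f1 (f2 t),
      continuous f2 &
      forall s, r <= `|s - c| -> [/\ f s = 0, f1 s = 0 & f2 s = 0]].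

Lemma profile_support c r f f1 f2 : profile c r f f1 f2 ->
  forall s, s <= c - r \/ c + r <= s -> [/\ f s = 0, f1 s = 0 & f2 s = 0].
Proof.
move=> [_ _ _ f0] s sr; apply: f0; have := ler_norm (s - c).
have := ler_norm (- (s - c)); rewrite normrN; case: sr => ? ? ?; lra.
Qed.

Lemma in_box (s s0 r : R) : s0 - r < s < s0 + r -> `|s - s0| < r.
Proof. by move=> /andP[? ?]; rewrite ltr_norml; apply/andP; split; lra. Qed.

Variables (s0 r beta : R) (f f1 f2 g g1 g2 : R -> R) (k : 'I_7) (j : 'I_3).
Hypothesis gb : good_box a j s0 r.
Hypothesis pf : profile s0 r f f1 f2.
Hypothesis pg : profile 0 r g g1 g2.

(** The chart is onto the plane, so these values determine [b] and [lb] everywhere. *)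
Definition local_values (b lb : plane R -> R) := forall s t,
  b (lchart k j (s, t)) = f s * g t /\
  lb (lchart k j (s, t)) = f2 s * g t + f s * g2 t.

Lemma local_values_vanish b lb x : local_values b lb ->
  (forall s t, `|s - s0| < r -> `|t| < r -> x <> lchart k j (s, t)) ->
  b x = 0 /\ lb x = 0.
Proof.
move=> lv nx; have [S [_ TS ST]] := frame_inverse (tcf k j).
have xE : x = lchart k j ((S x).1, (S x).2) by rewrite -surjective_pairing ST.
have [-> ->] : b x = f (S x).1 * g (S x).2 /\
    lb x = f2 (S x).1 * g (S x).2 + f (S x).1 * g2 (S x).2.
  by rewrite {1 4}xE; exact: lv.
have [_ _ _ f0] := pf; have [_ _ _ g0] := pg.
have [sr|sr] := leP r `|(S x).1 - s0|.
  by have [-> _ ->] := f0 _ sr; rewrite !mul0r addr0.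
have [tr|tr] := leP r `|(S x).2|.
  by have [] := g0 (S x).2; [rewrite subr0|move=> -> _ ->; rewrite !mulr0 addr0].
by have := nx _ _ sr tr; rewrite -xE.
Qed.

(** Common source of both kinds of test function: [c = 0] at an outer side, [c = - r] when the box
    lies in the domain. *)
Lemma box_test c : - r <= c -> c < r ->
  (forall s t, `|s - s0| < r -> `|t| < r -> glued a tau (lchart k j (s, t)) <-> c < t) ->
  (forall b lb h, local_values b lb -> continuous b -> continuous h ->
     beta * (\sum_(pq <- outer_sides a E tau) side_length pq *
       \int[mu]_(t in I01) (b (seg pq.1 pq.2 t) * h (seg pq.1 pq.2 t))) =
     \int[mu]_(s in `](s0 - r), (s0 + r)]) (f s * g1 c * h (lchart k j (s, c)))) ->
  exists b lb, robin_test (glued a tau) (outer_sides a E tau) beta b lb /\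
    local_values b lb.
Proof.
move=> rc cr WE bdry; have [[[p e] n] [/= en tE]] := tcf k j.
have [df df1 cf2 _] := pf; have [dg dg1 cg2 _] := pg.
exists (tensor p e n f g), (laplacian_tensor p e n f f2 g g2).
have lv : local_values (tensor p e n f g) (laplacian_tensor p e n f f2 g g2).
  by move=> s t; rewrite tE /laplacian_tensor !tensor_chart.
split=> //.
have r0 := gb.1.
have mW := open_plane_measurable (@glued_open _ a tau).
apply: (chart_robin_test (a := s0 - r) (b := s0 + r) (c := c) (d := r) en mW
  df df1 dg dg1 cf2 cg2).
- lra.
- by [].
- exact: profile_support pf.
- move=> t tr; apply: (profile_support pg); rewrite sub0r add0r.
  exact: tr.
- move=> s t ss tt; rewrite -tE; apply: WE; first exact: in_box.
  by rewrite -[t]subr0; apply: in_box; rewrite sub0r add0r.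
- move=> h ch; rewrite (bdry _ _ h lv) //; first by rewrite tE.
  have cont (u u1 : R -> R) : (forall t : R, is_derive t 1 u (u1 t)) -> continuous u.
    by move=> du t; apply: differentiable_continuous; have [] := is_derive_diff (du t).
  exact: tensor_continuous (cont _ _ df) (cont _ _ dg).
Qed.

(** The support avoids the boundary, so the Robin condition is void and any profile [g] is
    allowed. *)
Lemma shared_test k' :
  tau k' = tau k \o reflection (side_of a j).1 (side_of a j).2 ->
  exists b lb, [/\ robin_test (glued a tau) (outer_sides a E tau) beta b lb,
    local_values b lb &
    forall m x, m != k -> m != k' -> tile a tau m x -> b x = 0 /\ lb x = 0].
Proof.
move=> tk'; have r0 := gb.1.
have inW s t : `|s - s0| < r -> `|t| < r -> glued a tau (lchart k j (s, t)).
  exact: (shared_box_glued nca ftau fsigma tauK sigmaK tk' gb).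
have [||||b [lb [bt lv]]] := @box_test (- r).
- by [].
- lra.
- move=> s t ss tt; split=> [_|_]; last exact: inW.
  by move: tt; rewrite ltr_norml => /andP[].
- move=> b lb h lv cb ch.
  have [_ g1r _] : [/\ g (- r) = 0, g1 (- r) = 0 & g2 (- r) = 0].
    by have [_ _ _ g0] := pg; apply: g0; rewrite subr0 normrN ler_norm.
  rewrite big_seq big1 ?mulr0.
    rewrite (@eq_Rintegral _ _ _ _ _ (fun=> 0)); last by move=> s _; rewrite g1r mulr0 mul0r.
    by rewrite Rintegral_cst ?mul0r//; exact: measurable_itv.
  move=> pq pqs; rewrite (@eq_Rintegral _ _ _ _ _ (fun=> 0)).
    by rewrite Rintegral_cst ?mul0r ?mulr0//; exact: measurable_itv.
  move=> t; rewrite inE /unit_interval /= in_itv /= => t01.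
  have [|-> _] := @local_values_vanish b lb (seg pq.1 pq.2 t) lv; last by rewrite mul0r.
  by move=> s' t' ss tt E'; apply: (outer pqs t01); rewrite E'; exact: inW.
exists b, lb; split=> // m x mk mk' mx.
apply: (local_values_vanish lv) => s t ss tt xE.
apply: (shared_box_disjoint nca ftau fsigma tauK sigmaK disj tk' gb mk mk' ss tt).
by rewrite -/(lchart _ _) -xE.
Qed.

Lemma frame_side_length (T : plane R -> plane R) (p q : plane R) : frame T -> side_length (T p, T q) =
  side_length (p, q).
Proof.
move=> [[[c e] n] [/= [ee nn en] ->]]; rewrite /side_length /enorm /=; congr Num.sqrt.
have -> : chart c e n q - chart c e n p = (q - p).1 *: e + (q - p).2 *: n.
  rewrite [LHS]surjective_pairing [RHS]surjective_pairing.
  by congr pair; rewrite /chart /= /GRing.scale /=; ring.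
move: (q - p) => v.
transitivity (v.1 * v.1 * dot e e + v.2 * v.2 * dot n n + 2 * v.1 * v.2 * dot e n).
  by rewrite /dot /= /GRing.scale /=; ring.
by rewrite ee nn en /dot; ring.
Qed.

(** As [t] points inward, the outer normal derivative is - g'(0), and [g1 0 = beta * g 0] is the
    Robin condition on the side. *)
Lemma outer_test : ~~ shared E k j ->
  (forall s t, `|s - s0| <= r -> `|t| <= r ->
    forall m, m != k -> ~ closure (tile a tau m) (lchart k j (s, t))) ->
  r <= s0 -> s0 + r <= side_len a j -> g1 0 = beta * g 0 ->
  exists b lb, [/\ robin_test (glued a tau) (outer_sides a E tau) beta b lb,
    local_values b lb &
    forall m x, m != k -> tile a tau m x -> b x = 0 /\ lb x = 0].
Proof.
move=> kj avoid rs0 s0L robin; have r0 := gb.1.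
have bt := box_tile nca tauK sigmaK gb k.
have bc := box_closure nca ftau fsigma tauK sigmaK gb k.
have [df _ _ _] := pf.
have cf : continuous f.
  by move=> t; apply: differentiable_continuous; have [] := is_derive_diff (df t).
have [||||b [lb [btest lv]]] := @box_test 0.
- lra.
- lra.
- move=> s t ss tt; split=> [|t0]; last first.
    apply: (tile_glued nca fsigma tauK sigmaK (k := k)).
    by apply/bt => //; exact: ltW.
  move=> /gluedE gn; rewrite ltNge; apply/negP => t0.
  have cT := frame_continuous (tcf k j).
  have /near_box[e e0 eB] := cT (s, t) _ gn.
  have tt' : - r < t by move: tt; rewrite ltr_norml => /andP[].
  (* For t = 0 the point is in the closure of tile [k]. Moving down by [d] leaves that closure but
     neither the box nor the neighbourhood that the tiles cover. *)
  pose d := Num.min e (r + t).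
  have d0 : 0 < d by rewrite lt_min e0; lra.
  have de : d <= e by rewrite ge_min lexx.
  have dr : d <= r + t by rewrite ge_min lexx orbT.
  have t1 : `|t - d| <= r by rewrite ler_norml; apply/andP; split; lra.
  have /= := eB s (t - d); rewrite subrr normr0 addrAC subrr add0r normrN gtr0_norm//.
  move=> /(_ (ltW e0) de) [m mc].
  have [mk|mk] := eqVneq m k; last exact: (avoid _ _ (ltW ss) t1 m mk mc).
  by move: mc; rewrite mk => /(bc _ _ (ltW ss) t1); lra.
- move=> b lb h lv cb ch.
  have L0 := side_len_gt0 nca j.
  (* Only the index pair [(k, j)] contributes: the other sides of tile [k] miss the box by
     [good_box], those of other tiles by the avoidance hypothesis. *)
  rewrite /outer_sides big_map big_filter big_enum_cond (bigD1 (k, j)) //=.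
  rewrite [X in _ + X]big1 ?addr0; last first.
    move=> [k1 j1] /andP[_ ne]; rewrite (@eq_Rintegral _ _ _ _ _ (fun=> 0)).
      by rewrite Rintegral_cst ?mul0r ?mulr0//; exact: measurable_itv.
    move=> t; rewrite inE /unit_interval /= in_itv /= => t01.
    have [|-> _] := @local_values_vanish b lb
      (seg (tile_side a tau k1 j1).1 (tile_side a tau k1 j1).2 t) lv; last first.
      by rewrite mul0r.
    move=> s' t' ss tt sE; have L10 := side_len_gt0 nca j1.
    have b0 : bary a j1 (sigma k1 (lchart k j (s', t'))) = 0.
      rewrite -sE tile_side_seg// /tchart /= tauK.
      by rewrite bary_side_chart// mulr0.
    have [k1k|k1k] := eqVneq k1 k.
      have j1j : j1 != j by apply: contraNneq ne => ->; rewrite k1k.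
      move: b0; rewrite k1k /tchart /= tauK => b0.
      by have := gb.2 s' t' j1 (ltW ss) (ltW tt) j1j; rewrite b0 ltxx.
    apply: (avoid s' t' (ltW ss) (ltW tt) k1 k1k).
    rewrite -sE tile_side_seg// (tile_closureE nca ftau fsigma tauK sigmaK) /= => i.
    rewrite /tbary /tchart /= tauK -side_chart_seg//.
    have /andP[t0 t1] := t01.
    rewrite /seg /side_of /= bary_affine !bary_vertex//.
    by rewrite addr_ge0// mulr_ge0 ?ler0n ?subr_ge0.
  have -> : side_length (tile_side a tau k j) = side_len a j.
    exact: (frame_side_length (a (ordS j)) (a (ordS (ordS j))) (ftau k)).
  pose u (s : R) := f s * g1 0 * h (lchart k j (s, 0)).
  have cu : continuous u.
    move=> s; apply: cvgM; first by apply: cvgM; [exact: cf|exact: cvg_cst].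
    apply: (@continuous_comp _ _ _ (fun s : R => lchart k j (s, 0)) h); last exact: ch.
    apply: (@continuous_comp _ _ _ (fun s : R => (s, 0)) (lchart k j)).
      by apply: (@cvg_pair _ _ _ (nbhs s) (nbhs s) (nbhs 0) _ _ _ id (fun=> 0));
        [exact: cvg_id|exact: cvg_cst].
    exact: (frame_continuous (tcf k j)).
  rewrite -[RHS]/(\int[mu]_(s in `](s0 - r), (s0 + r)]) u s).
  (* The support of [f] lies within the side, so the integral extends to the whole side and is then
     rescaled to the unit interval. *)
  rewrite (@Rintegral_itv_subset _ u _ _ 0 (side_len a j)); last first.
  - move=> s sr; have [fs _ _] := profile_support pf sr.
    by rewrite /u fs !mul0r.
  - exact: s0L.
  - by rewrite subr_ge0.
  rewrite -(Rintegral_scale L0 cu) mulrCA; congr (_ * _).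
  rewrite -RintegralZl.
  - apply: eq_Rintegral => t _.
    rewrite -[seg _ _ t]/(seg (tile_side a tau k j).1 (tile_side a tau k j).2 t).
    rewrite tile_side_seg// /u robin.
    by have [-> _] := lv (side_len a j * t) 0; ring.
  - exact: measurable_itv.
  - apply: continuous_compact_integrable; first exact: segment_compact.
    apply: continuous_subspaceT => t; apply: cvgM.
      apply: (@continuous_comp _ _ _ (seg (tile_side a tau k j).1 (tile_side a tau k j).2) b).
        exact: seg_continuous.
      exact: cb.
    apply: (@continuous_comp _ _ _ (seg (tile_side a tau k j).1 (tile_side a tau k j).2) h).
      exact: seg_continuous.
    exact: ch.
exists b, lb; split=> // m x mk mx.
apply: (local_values_vanish lv) => s t ss tt xE.
apply: (avoid s t (ltW ss) (ltW tt) m mk).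
by apply: subset_closure; rewrite -xE.
Qed.

End LocalTests2.

(** * Coefficients of an intertwining transplantation *)

Section AlmostEverywhere.
Variable R : realType.
Local Notation mu := (@lebesgue_measure R).
Local Notation mR := (measurableTypeR R).
Local Notation leb2 := (@Defs.leb2 R).

Lemma frame_measure_preserving (T : plane R -> plane R) :
  frame T -> measure_preserving T.
Proof. by move=> [c [en ->]]; exact: chart_measure_preserving. Qed.

Lemma ae_measure_preserving (T : plane R -> plane R) (P : plane R -> Prop) :
  measure_preserving T -> {ae leb2, forall x, P x} -> {ae leb2, forall x, P (T x)}.
Proof.
move=> [mT pT] [A [mA A0 PA]]; exists (T @^-1` A); split.
- by rewrite -[X in measurable X]setTI; exact: mT.
- by rewrite [LHS]pT.
- by move=> x nP; apply: PA.
Qed.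

Lemma ae_leb2_mono (P Q : plane R -> Prop) : (forall x, P x -> Q x) ->
  {ae leb2, forall x, P x} -> {ae leb2, forall x, Q x}.
Proof.
move=> PQ [A [mA A0 PA]]; exists A; split=> // x nQ.
by apply: PA => /PQ; exact: nQ.
Qed.

Lemma ae_leb2_and (P Q : plane R -> Prop) : {ae leb2, forall x, P x} ->
  {ae leb2, forall x, Q x} -> {ae leb2, forall x, P x /\ Q x}.
Proof.
move=> aP aQ; have := negligibleU aP aQ.
by apply: negligibleS => x /= /not_andP.
Qed.

Lemma ae_snd_neq0 : {ae leb2, forall x : plane R, x.2 != 0}.
Proof.
exists ([set: mR] `*` [set (0 : R)]); split.
- by apply: measurableX => //; exact: measurable_set1.
- rewrite [LHS]product_measure1E //.
  by rewrite [X in (_ * X)%E](lebesgue_measure_set1 0) mule0.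
- by move=> x /= /negP; rewrite negbK => /eqP x0; split.
Qed.

Lemma flip_frame : frame (fun x : plane R => (x.1, - x.2)).
Proof.
exists (0, dx R, - dy R); split=> /=.
  have [ee nn en] := orthonormal_dy R.
  split=> //; rewrite /dot /= ?oppr0 !(mulr0, mul0r, mulr1, mulrN, mulNr, opprK, addr0, add0r, oppr0)//.
apply/funext => x; rewrite [RHS]surjective_pairing; congr pair;
by rewrite /chart /= /GRing.scale /= ?oppr0 !(mulr0, mulr1, mulrN) ?add0r ?addr0.
Qed.

End AlmostEverywhere.

(** * The jump of the Wronskian across a shared side *)

Section Core.
Variable R : realType.
Local Notation mu := (@lebesgue_measure R).
Local Notation mR := (measurableTypeR R).
Local Notation leb2 := (@Defs.leb2 R).
Variable a : 'I_3 -> plane R.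
Hypothesis nca : noncollinear a.
Variables tau1 tau2 sigma2 : 'I_7 -> plane R -> plane R.
Hypothesis ftau2 : forall k, frame (tau2 k).
Hypothesis fsigma2 : forall k, frame (sigma2 k).
Hypothesis tauK2 : forall k, cancel (tau2 k) (sigma2 k).
Hypothesis sigmaK2 : forall k, cancel (sigma2 k) (tau2 k).
Variables (s1 s2 : seq (plane R * plane R)) (beta : R).
Local Notation W1 := (glued a tau1).
Local Notation W2 := (glued a tau2).
Variables (Psi : (plane R -> R[i]) -> plane R -> R[i]) (P : 'M[R]_7).
Hypothesis transP : transplantation a tau1 tau2 P Psi.
Hypothesis inter : intertwines_robin W1 s1 W2 s2 beta Psi.
Hypothesis PsiL2 : forall u, L2 leb2 W1 u -> L2 leb2 W2 (Psi u).

Variables (k k' : 'I_7) (j : 'I_3).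
Hypothesis tk' : tau2 k' = tau2 k \o reflection (side_of a j).1 (side_of a j).2.
Variables (s0 r : R) (f f1 f2 g g1 g2 gm gm1 gm2 : R -> R).
Hypothesis gb : good_box a j s0 r.
Hypothesis pf : profile s0 r f f1 f2.
Hypothesis pg : profile 0 r g g1 g2.
Hypothesis pgm : profile 0 r gm gm1 gm2.
Hypothesis gmE : forall t, g (- t) = gm t /\ g2 (- t) = gm2 t.
Hypothesis wronskian : gm 0 * g1 0 - gm1 0 * g 0 != 0.
Hypothesis f_s0 : f s0 != 0.

Variables (b lb bz lbz : plane R -> R) (eps del : 'I_7 -> R).
Hypothesis btest : robin_test W1 s1 beta b lb.
(** [eps] marks the tiles that see [b] through [g], [del] those that see it through the mirror image
    [gm]. An outer side gives one marked tile; a shared side gives one of each kind. *)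
Hypothesis bvalues : forall m s t, `|s - s0| < r -> 0 < t < r ->
  b (tau1 m (side_chart a j (s, t))) = f s * (eps m * g t + del m * gm t) /\
  lb (tau1 m (side_chart a j (s, t))) =
    f2 s * (eps m * g t + del m * gm t) + f s * (eps m * g2 t + del m * gm2 t).
Hypothesis ztest : robin_test W2 s2 beta bz lbz.
Hypothesis zvalues : local_values a tau2 f f2 gm gm2 k j bz lbz.

(* Green's identity for [bz] against the transplanted [b], read in the chart of
   the shared side, has integrand [gamma * D] below and [alpha * D] above it. *)
Let D (x : plane R) : R := f x.1 ^+ 2 * (gm x.2 * g2 x.2 - gm2 x.2 * g x.2).
Let alpha := \sum_m P k m * eps m.
Let gamma := \sum_m P k' m * del m.
Let H : set (mR * mR) := [set x | 0 < x.2].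

Lemma transplanted_value (q : 'I_7) (F : plane R -> R) (x : plane R) :
  complex.Re (mix P (unfold_tiles tau1 (fun x => (F x)%:C%C)) q x) =
  \sum_m P q m * F (tau1 m x).
Proof.
rewrite /mix (ReIm_sum _ _).1; apply: eq_bigr => m _.
by rewrite /unfold_tiles /= mul0r subr0.
Qed.

Lemma robin_test_L2 : L2 leb2 W1 (fun x => (b x)%:C%C) /\ L2 leb2 W1 (fun x => (lb x)%:C%C).
Proof.
have [cb clb bb blb _] := btest; have oW := @glued_open _ a tau1.
have mW := open_plane_measurable oW.
split; first exact/real_L2_L2/real_L2_C1.
apply: real_L2_L2; split; first exact: continuous_plane_measurable mW clb.
exact: bounded_support_sqr clb blb mW.
Qed.

Let cont (u u1 : R -> R) : (forall t : R, is_derive t 1 u (u1 t)) -> continuous u.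
Proof. by move=> du t; apply: differentiable_continuous; have [] := is_derive_diff (du t). Qed.

Lemma D_continuous : continuous D.
Proof.
have [df _ _ _] := pf; have [dg _ cg2 _] := pg; have [dgm _ cgm2 _] := pgm.
have c1 (u : R -> R) : continuous u -> continuous (fun x : plane R => u x.1).
  by move=> ck x; apply: (@continuous_comp _ _ _ fst u); [exact: cvg_fst|exact: ck].
have c2 (u : R -> R) : continuous u -> continuous (fun x : plane R => u x.2).
  by move=> ck x; apply: (@continuous_comp _ _ _ snd u); [exact: cvg_snd|exact: ck].
move=> x; apply: cvgM; first by apply: cvgM; exact: (c1 _ (cont df)).
apply: cvgB; apply: cvgM.
- exact: (c2 _ (cont dgm)).
- exact: (c2 _ cg2).
- exact: (c2 _ cgm2).
- exact: (c2 _ (cont dg)).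
Qed.

Lemma D_outside (x : plane R) : ~ (`|x.1 - s0| < r /\ `|x.2| < r) -> D x = 0.
Proof.
have [_ _ _ f0] := pf; have [_ _ _ g0] := pg.
move=> nx; rewrite /D; have [sr|sr] := leP r `|x.1 - s0|.
  by have [-> _ _] := f0 _ sr; rewrite expr0n/= mul0r.
have [tr|tr] := leP r `|x.2|; last by exfalso; exact: nx.
by have [|-> _ ->] := g0 x.2; [rewrite subr0|rewrite !mulr0 subrr mulr0].
Qed.

(** Above the side the [del] part has the profile [gm] of [bz] itself and drops out of the
    antisymmetric expression. Below it, reflection exchanges [g] and [gm], so there the [eps] part
    drops out. The terms with [f2] cancel on both sides. *)
Lemma ae_core g0 :
  robin_laplacian W2 s2 beta (Psi (fun x => (b x)%:C%C)) g0 ->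
  {ae leb2, forall x, W2 (tchart a tau2 k j x) ->
     bz (tchart a tau2 k j x) * complex.Re (g0 (tchart a tau2 k j x)) -
     lbz (tchart a tau2 k j x) *
       complex.Re (Psi (fun x => (b x)%:C%C) (tchart a tau2 k j x)) =
     gamma * D x + (alpha - gamma) * (D \_ H) x}.
Proof.
move=> rl; have [lb1 llb1] := robin_test_L2.
have rl1 := robin_test_laplacian (@glued_open _ a tau1) btest.
have fT : frame (tchart a tau2 k j) by exact: tchart_frame.
have fS := side_chart_frame nca j.
(* A point [(s, t)] below the side is read in tile [k'] at [(s, - t)]. *)
have fSf := frame_comp fS (flip_frame R).
have pull T Q : frame T -> {ae leb2, forall x, Q x} -> {ae leb2, forall x, Q (T x)}.
  by move=> /frame_measure_preserving; exact: ae_measure_preserving.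
have A1 := pull _ _ fS (transP lb1 k).
have A2 := pull _ _ fS (transP llb1 k).
have B1 := pull _ _ fSf (transP lb1 k').
have B2 := pull _ _ fSf (transP llb1 k').
have C := pull _ _ fT (inter.2 _ _ _ rl1 rl).
have N := ae_snd_neq0 R.
have AE := ae_leb2_and A1 (ae_leb2_and A2 (ae_leb2_and B1
  (ae_leb2_and B2 (ae_leb2_and C N)))).
apply: (ae_leb2_mono _ AE) => -[s t] [a1 [a2 [b1 [b2 [c n]]]]] Wx.
have [bzE lbzE] := zvalues s t.
have [[/= ss tt]|nb] := pselect (`|(s, t).1 - s0| < r /\ `|(s, t).2| < r); last first.
  have D0 := D_outside nb.
  have -> : (D \_ H) (s, t) = 0 by rewrite patchE D0; case: ifP.
  rewrite bzE lbzE D0 !mulr0 addr0.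
  have [_ _ _ f0] := pf; have [_ _ _ gm0] := pgm.
  have [sr|sr] := leP r `|s - s0|.
    by have [-> _ ->] := f0 _ sr; rewrite !mul0r !addr0 !mul0r subr0.
  have [tr|tr] := leP r `|t|; last by exfalso; apply: nb.
  have [|-> _ ->] := gm0 t; first by rewrite subr0.
  by rewrite !mulr0 !addr0 !mul0r subr0.
have sumE (q : 'I_7) (A p p' : R) : \sum_m P q m * (A * (eps m * p + del m * p')) =
    A * ((\sum_m P q m * eps m) * p + (\sum_m P q m * del m) * p').
  by rewrite !mulr_suml -big_split /= mulr_sumr; apply: eq_bigr => m _; ring.
have sumE2 (q : 'I_7) (A A' p p' v v' : R) :
    \sum_m P q m * (A * (eps m * p + del m * p') + A' * (eps m * v + del m * v')) =
    A * ((\sum_m P q m * eps m) * p + (\sum_m P q m * del m) * p') +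
    A' * ((\sum_m P q m * eps m) * v + (\sum_m P q m * del m) * v').
  by rewrite -!sumE -big_split /=; apply: eq_bigr => m _; ring.
have btri := box_triangle nca gb (ltW ss).
have gE := c Wx.
have [t0|t0|t0] := ltgtP t 0; last by move: n; rewrite /= t0 eqxx.
- have tt' : `|- t| < r by rewrite normrN.
  have t0' : 0 < - t < r by rewrite oppr_gt0 t0 -ltr0_norm.
  have tri : triangle a (side_chart a j (s, - t)) by apply/(btri _ (ltW tt')); case/andP: t0'.
  have TE : tchart a tau2 k j (s, t) = tau2 k' (side_chart a j (s, - t)).
    by rewrite -[RHS]/(tchart a tau2 k' j (s, - t)) (shared_tchart nca tk') opprK.
  have uE : complex.Re (Psi (fun x => (b x)%:C%C) (tchart a tau2 k j (s, t))) =
      \sum_m P k' m * b (tau1 m (side_chart a j (s, - t))).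
    rewrite TE -transplanted_value; congr complex.Re; exact: (b1 tri).
  have lE : complex.Re (g0 (tchart a tau2 k j (s, t))) =
      \sum_m P k' m * lb (tau1 m (side_chart a j (s, - t))).
    rewrite gE TE -transplanted_value; congr complex.Re; exact: (b2 tri).
  have -> : (D \_ H) (s, t) = 0 by rewrite patchE ifF//; apply/negP; rewrite inE /H /=; lra.
  rewrite uE lE bzE lbzE.
  under eq_bigr => m _ do rewrite (bvalues m ss t0').2.
  under [X in _ - _ * X]eq_bigr => m _ do rewrite (bvalues m ss t0').1.
  rewrite sumE sumE2 -/gamma /D /=.
  have [<- <-] := gmE t; have [gg gg2] := gmE (- t); rewrite !opprK in gg gg2.
  rewrite -gg -gg2; ring.
- have t0' : 0 < t < r by rewrite t0 -[X in X < r]gtr0_norm.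
  have tri : triangle a (side_chart a j (s, t)) by apply/(btri _ (ltW tt)).
  have uE : complex.Re (Psi (fun x => (b x)%:C%C) (tchart a tau2 k j (s, t))) =
      \sum_m P k m * b (tau1 m (side_chart a j (s, t))).
    rewrite -transplanted_value; congr complex.Re; exact: (a1 tri).
  have lE : complex.Re (g0 (tchart a tau2 k j (s, t))) =
      \sum_m P k m * lb (tau1 m (side_chart a j (s, t))).
    rewrite gE -transplanted_value; congr complex.Re; exact: (a2 tri).
  have -> : (D \_ H) (s, t) = D (s, t) by rewrite patchE ifT// inE.
  rewrite uE lE bzE lbzE.
  under eq_bigr => m _ do rewrite (bvalues m ss t0').2.
  under [X in _ - _ * X]eq_bigr => m _ do rewrite (bvalues m ss t0').1.
  by rewrite sumE sumE2 -/alpha /D /=; ring.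
Qed.

Let w (t : R) : R := gm t * g1 t - gm1 t * g t.

Let box (c d : R) : set (mR * mR) := `](s0 - r), (s0 + r)]%classic `*` `]c, d]%classic.

(** [D] is [f ^+ 2] times the derivative in [t] of the Wronskian [w]. *)
Lemma D_box_integral c d : c < d ->
  \int[leb2]_(x in box c d) D x =
  \int[mu]_(s in `](s0 - r), (s0 + r)]) (f s ^+ 2 * w d - f s ^+ 2 * w c).
Proof.
move=> cd; have [df _ _ _] := pf; have [dg dg1 cg2 _] := pg; have [dgm dgm1 cgm2 _] := pgm.
have mI : measurable (`](s0 - r), (s0 + r)]%classic : set mR) by exact: measurable_itv.
have c1 (u : R -> R) : continuous u -> continuous (fun x : plane R => u x.1).
  by move=> ck x; apply: (@continuous_comp _ _ _ fst u); [exact: cvg_fst|exact: ck].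
have c2 (u : R -> R) : continuous u -> continuous (fun x : plane R => u x.2).
  by move=> ck x; apply: (@continuous_comp _ _ _ snd u); [exact: cvg_snd|exact: ck].
have cw : continuous w.
  by move=> t; apply: cvgB; apply: cvgM; [exact: (cont dgm)|exact: (cont dg1)|
    exact: (cont dgm1)|exact: (cont dg)].
apply: (Rintegral_box_FTC (F := fun x => f x.1 ^+ 2 * w x.2) cd mI
  (@subset_itv_oc_cc _ _ (s0 - r) (s0 + r))).
- move=> x; apply: cvgM; last exact: (c2 _ cw).
  by apply: cvgM; exact: (c1 _ (cont df)).
- exact: D_continuous.
- move=> s t.
  have Dw := is_deriveB (is_deriveM (dgm t) (dg1 t)) (is_deriveM (dgm1 t) (dg t)).
  apply: (is_derive_eq (is_deriveZ (f s ^+ 2) Dw)).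
  rewrite -[LHS]/(f s ^+ 2 * ((gm t * g2 t + g1 t * gm1 t) -
    (gm1 t * g1 t + g t * gm2 t))) /D /=; ring.
Qed.

Lemma w_edge (t : R) : r <= `|t| -> w t = 0.
Proof.
have [_ _ _ g0] := pg; have [_ _ _ gm0] := pgm.
move=> tr; rewrite /w; have [|gt0 _ _] := g0 t; first by rewrite subr0.
by have [|gmt0 _ _] := gm0 t; [rewrite subr0|rewrite gt0 gmt0 mul0r mulr0 subrr].
Qed.

(** Symmetry makes the integral of [gamma * D + (alpha - gamma) * (D \_ H)] vanish. Over the whole
    box [D] integrates to 0, as [w] vanishes at both ends; over the upper half it leaves [- w 0]
    times the integral of [f ^+ 2], which is not 0. *)
Lemma transplantation_coefficients : alpha = gamma.
Proof.
have r0 := gb.1; have [lb1 llb1] := robin_test_L2.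
have oW1 := @glued_open _ a tau1; have oW2 := @glued_open _ a tau2.
have mW2 := open_plane_measurable oW2.
have rl1 := robin_test_laplacian oW1 btest.
have [g0 rl] := inter.1 _ (ex_intro _ _ rl1).
have adj := robin_laplacian_adjoint oW2 ztest rl.
have [cz clz bbz blz _] := ztest.
have [mz z2] := real_L2_C1 oW2 cz bbz.
have mlz := continuous_plane_measurable mW2 clz.
have lz2 := bounded_support_sqr clz blz mW2.
have [mp p2] := L2_component false mW2 (PsiL2 lb1).
have [mg' g'2] := L2_component false mW2 rl.1.
have gN x : component false ((\- g0) x) = - complex.Re (g0 x) by rewrite componentN.
have mg0 : measurable_fun W2 ((fun x => complex.Re (g0 x)) : mR * mR -> mR).
  rewrite (_ : (fun x => _) = \- (component false \o \- g0)).
    exact: measurable_funN.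
  by apply/funext => x; rewrite /= -[X in - X]/(component false ((\- g0) x)) gN opprK.
have g02 : (\int[leb2]_(x in W2) (complex.Re (g0 x) ^+ 2)%:E < +oo)%E.
  move: g'2; under eq_integral => x _ do rewrite -[(component false \o \- g0) x]/(component false ((\- g0) x)) gN sqrrN.
  by [].
pose G x := bz x * complex.Re (g0 x) - lbz x * complex.Re (Psi (fun x => (b x)%:C%C) x).
have mG : measurable_fun W2 (G : mR * mR -> mR).
  by apply: measurable_funB; apply: measurable_funM.
have G0 : \int[leb2]_(x in W2) G x = 0.
  rewrite (RintegralB mW2 (mul_integrable mW2 mz mg0 z2 g02)
    (mul_integrable mW2 mlz mp lz2 p2)).
  by apply/eqP; rewrite subr_eq0; apply/eqP.
pose T := tchart a tau2 k j.
have fT : frame T by exact: tchart_frame.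
have mpT := frame_measure_preserving fT.
pose V : set (mR * mR) := T @^-1` W2.
have mV : measurable V by rewrite -[X in measurable X]setTI; exact: mpT.1.
pose K x := gamma * D x + (alpha - gamma) * (D \_ H) x.
have mH : measurable H.
  apply: open_plane_measurable.
  have -> : H = (snd : plane R -> R) @^-1` [set t | 0 < t] by [].
  apply: open_comp; last exact: open_gt.
  by move=> x _; exact: cvg_snd.
have mD A : measurable (A : set (mR * mR)) -> measurable_fun A (D : mR * mR -> mR).
  by move=> mA; exact: continuous_plane_measurable mA D_continuous.
have mDH : measurable_fun setT (D \_ H : mR * mR -> mR).
  by apply/(measurable_restrictT _ mH); exact: mD.
have mK A : measurable (A : set (mR * mR)) -> measurable_fun A (K : mR * mR -> mR).
  move=> mA; apply: measurable_funD; apply: measurable_funM => //.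
    exact: mD.
  exact: (measurable_funS measurableT _ mDH).
have K0 : \int[leb2]_(x in V) K x = 0.
  rewrite -[RHS]G0 (Rintegral_measure_preserving mpT mW2 mG).
  rewrite /Rintegral; congr fine; apply: ae_eq_integral => //.
  - by apply/measurable_EFinP; exact: mK.
  - apply/measurable_EFinP; apply: (measurable_comp mW2) => //.
      by move=> x [y Vy <-].
    exact: (measurable_funS measurableT _ mpT.1).
  - apply: ae_leb2_mono (ae_core rl) => x xE Vx.
    by congr EFin; rewrite /K -(xE Vx).
have Kout x : ~ (`|x.1 - s0| < r /\ `|x.2| < r) -> K x = 0.
  move=> /D_outside D0; rewrite /K D0 patchE D0; case: ifP => _; rewrite !mulr0 addr0//.
pose Q := box (- r) r.
have mQ : measurable Q by apply: measurableX; exact: measurable_itv.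
(* [K] vanishes off the open box, which lies in both [Q] and [V]. *)
have KQ : \int[leb2]_(x in Q) K x = 0.
  rewrite -[RHS]K0 Rintegral_mkcond [RHS]Rintegral_mkcond; congr (Rintegral _ _ _).
  apply/funext => x; rewrite !patchE.
  have [[x1 x2]|nx] := pselect (`|x.1 - s0| < r /\ `|x.2| < r); last first.
    by rewrite Kout//; case: ifP; case: ifP.
  rewrite !ifT//; rewrite inE.
    rewrite /V /= /T [x]surjective_pairing.
    exact: (shared_box_glued nca ftau2 fsigma2 tauK2 sigmaK2 tk' gb x1 x2).
  by move: x1 x2; rewrite /Q /box !ltr_norml => /andP[? ?] /andP[? ?]; split;
    rewrite /= in_itv/=; apply/andP; split; lra.
have intD A : measurable (A : set (mR * mR)) -> A `<=` Q -> leb2.-integrable A (EFin \o D).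
  move=> mA AQ; apply: (continuous_plane_integrable D_continuous mA
    (a := s0 - r) (b := s0 + r) (c := - r) (d := r)).
  by move=> x /AQ [? ?]; split; exact: subset_itv_oc_cc.
have intDH : leb2.-integrable Q (EFin \o (D \_ H)).
  apply: (le_integrable mQ _ _ (intD Q mQ (fun x h => h))).
    by apply/measurable_EFinP; exact: (measurable_funS measurableT _ mDH).
  by move=> x _ /=; rewrite lee_fin patchE; case: ifP => _; rewrite ?normr0.
have QH : Q `&` H = box 0 r.
  apply/seteqP; split=> [x [[x1 x2] x0]|x [x1 x2]].
    by split => //; move: x2 x0; rewrite /= !in_itv/= /H /= => /andP[_ ->] ->.
  move: x2; rewrite /= in_itv/= => /andP[x20 x2r].
  by split => //; split => //; rewrite /= in_itv/= x2r andbT; lra.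
move: KQ; rewrite /K RintegralD//; last 2 first.
- by apply: (eq_integrable mQ _ _ _ (integrableZl mQ gamma (intD Q mQ (fun x h => h)))).
- by apply: (eq_integrable mQ _ _ _ (integrableZl mQ (alpha - gamma) intDH)).
rewrite RintegralZl//; last exact: intD.
rewrite RintegralZl//.
rewrite -[X in _ * X + _]/(\int[leb2]_(x in box (- r) r) D x) D_box_integral; last lra.
rewrite -Rintegral_mkcondr QH D_box_integral//.
have wr : w r = 0 by apply: w_edge; rewrite ler_norm.
have wr' : w (- r) = 0 by apply: w_edge; rewrite normrN ler_norm.
have [df _ _ _] := pf; have cf := cont df.
have cf2 : continuous (fun s => f s ^+ 2 : R) by move=> s; apply: cvgM; exact: cf.
rewrite (@eq_Rintegral _ _ _ mu _ (fun=> 0)); last first.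
  by move=> s _; rewrite wr wr' mulr0 subrr.
rewrite Rintegral_cst; last exact: measurable_itv.
rewrite (@eq_Rintegral _ _ _ mu _ (fun s => - (w 0) * f s ^+ 2)); last first.
  by move=> s _; rewrite wr; ring.
rewrite RintegralZl; last 2 first.
- exact: measurable_itv.
- apply: (@integrableS _ _ _ mu `[s0 - r, s0 + r]%classic) => //.
    exact: subset_itv_oc_cc.
  apply: continuous_compact_integrable; first exact: segment_compact.
  exact: continuous_subspaceT.
have J0 : 0 < \int[mu]_(s in `](s0 - r), (s0 + r)]) (f s ^+ 2).
  apply: (Rintegral_gt0 cf2 (s0 := s0)).
  - by move=> s; exact: sqr_ge0.
  - by rewrite exprn_even_gt0.
  - by rewrite ltrBlDr !ltrDl r0.
have w0 : w 0 != 0 by exact: wronskian.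
move=> /eqP; rewrite mul0r mulr0 add0r !mulf_eq0 oppr_eq0 (negbTE w0) (gt_eqF J0).
by rewrite !orbF subr_eq0 => /eqP.
Qed.

End Core.

(** * Choice of the profiles *)

Section RobinProfiles.
Variable R : realType.

Lemma bump_profile (c r : R) : 0 < r ->
  exists f f1 f2, profile c r f f1 f2 /\ f c != 0.
Proof.
move=> /bump_exists[f [f1 [f2 [df df1 cf2 f0 [_ fpos]]]]].
have sh (u u1 : R -> R) : (forall x : R, is_derive x 1 u (u1 x)) ->
    forall t : R, is_derive t 1 (fun s => u (s - c)) (u1 (t - c)).
  move=> du t.
  have d1 : is_derive t 1 (fun s : R => s - c) 1.
    by apply: (is_derive_eq (is_deriveB (is_derive_id t 1) (is_derive_cst c t 1))); rewrite subr0.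
  have du' : is_derive ((fun s : R => s - c) t) 1 u (u1 (t - c)) := du _.
  by have := @is_derive1_comp _ u (fun s : R => s - c) t _ _ du' d1; rewrite mulr1.
exists (fun s => f (s - c)), (fun s => f1 (s - c)), (fun s => f2 (s - c)).
split; last by rewrite subrr gt_eqF.
split=> [||s|s sr]; [exact: sh|exact: sh| |exact: f0].
apply: (@continuous_comp _ _ _ (fun s : R => s - c) f2); last exact: cf2.
by apply: cvgB; [exact: cvg_id|exact: cvg_cst].
Qed.

(* The witness is [g t = eta t * (1 + beta * t)] with [eta] an even bump; the
   Wronskian at 0 is then [2 * beta * eta 0 ^+ 2]. *)
Lemma robin_profile (beta r : R) : beta != 0 -> 0 < r ->
  exists g g1 g2 gm gm1 gm2 : R -> R,
    [/\ profile 0 r g g1 g2, profile 0 r gm gm1 gm2,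
        forall t, g (- t) = gm t /\ g2 (- t) = gm2 t,
        g1 0 = beta * g 0 & gm 0 * g1 0 - gm1 0 * g 0 != 0].
Proof.
move=> b0 /bump_exists[f [f1 [f2 [df df1 cf2 f0 [even fpos]]]]].
pose lin (b t : R) := 1 + b * t.
have dlin b (t : R) : is_derive t 1 (lin b) b.
  have := is_deriveD (is_derive_cst (1 : R) t 1) (is_deriveZ b (is_derive_id t 1)).
  by move=> H; apply: (is_derive_eq H); rewrite add0r /GRing.scale /= mulr1.
pose G b t := f t * lin b t.
pose G1 b t := f1 t * lin b t + b * f t.
pose G2 b t := f2 t * lin b t + 2 * b * f1 t.
have pG b : profile 0 r (G b) (G1 b) (G2 b).
  split=> [t|t|t|t].
  - apply: (is_derive_eq (is_deriveM (df t) (dlin b t))).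
    by rewrite /G1 /GRing.scale /=; ring.
  - apply: (is_derive_eq (is_deriveD (is_deriveM (df1 t) (dlin b t)) (is_deriveZ b (df t)))).
    by rewrite /G2 /GRing.scale /=; ring.
  - have cf1 : continuous f1.
      by move=> x; apply: differentiable_continuous; have [] := is_derive_diff (df1 x).
    have clin : continuous (lin b).
      by move=> x; apply: differentiable_continuous; have [] := is_derive_diff (dlin b x).
    apply: cvgD; apply: cvgM; [exact: cf2|exact: clin|exact: cvg_cst|exact: cf1].
  - by rewrite subr0 => /f0[ft f1t f2t]; rewrite /G /G1 /G2 ft f1t f2t !(mul0r, mulr0) addr0.
have f10 : f1 0 = 0 by have [_ + _] := even 0; rewrite oppr0; lra.
exists (G beta), (G1 beta), (G2 beta), (G (- beta)), (G1 (- beta)), (G2 (- beta)).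
split=> //.
- move=> t; have [e e1 e2] := even t.
  by rewrite /G /G2 /lin e e1 e2; split; ring.
- by rewrite /G1 /G /lin f10; ring.
- have -> : G (- beta) 0 * G1 beta 0 - G1 (- beta) 0 * G beta 0 = 2 * beta * f 0 ^+ 2.
    by rewrite /G1 /G /lin f10; ring.
  by rewrite !mulf_neq0 ?pnatr_eq0// ?gt_eqF.
Qed.

End RobinProfiles.

(** * Consequences of the gluing patterns *)

Section Pieces.
Variables (R : realType) (a : 'I_3 -> plane R).
Hypothesis nca : noncollinear a.

Lemma ord7P (k : 'I_7) : k \in [:: 0; 1; 2; 3; 4; 5; 6].
Proof. by case: k; do 7! [case=> //]. Qed.

(** Each pattern is a tree rooted at tile 1 with edges directed away from it, so every tile map is a
    product of reflections. *)
Lemma gluing_frames E tau : is_gluing a E tau -> E = E1 \/ E = E2 ->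
  forall k, frame (tau k).
Proof.
move=> [t1 tE] EE.
have F1 : frame (tau 1) by rewrite t1; exact: frame_id.
have step k l j : (k, l, j) \in E -> frame (tau k) -> frame (tau l).
  by move=> /tE -> fk; apply: frame_comp fk _; exact: reflection_frame.
have F2 : frame (tau 2) by apply: (step 1 2 1) => //; case: EE => ->.
have F3 : frame (tau 3) by apply: (step 1 3 2) => //; case: EE => ->.
have F4 : frame (tau 4) by apply: (step 1 4 3) => //; case: EE => ->.
have F5 : frame (tau 5).
  by case: EE => EE; [apply: (step 2 5 2)|apply: (step 2 5 3)] => //; rewrite EE.
have F6 : frame (tau 6).
  by case: EE => EE; [apply: (step 3 6 3)|apply: (step 3 6 1)] => //; rewrite EE.
have F0 : frame (tau 0).
  rewrite (_ : 0 = 7 :> 'I_7); last exact: val_inj.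
  by case: EE => EE; [apply: (step 4 7 1)|apply: (step 4 7 2)] => //; rewrite EE.
move=> k; have := ord7P k; rewrite !inE.
by do 6! [move=> /orP[/eqP->//|]]; move=> /eqP->.
Qed.

(** The outer sides make up the boundary, and an open set does not meet its boundary. *)
Lemma admissible_outer E tau : admissible a E tau ->
  forall pq, pq \in outer_sides a E tau ->
  forall t, 0 <= t <= 1 -> ~ glued a tau (seg pq.1 pq.2 t).
Proof.
move=> [_ _ [v [_ bd rg]]] pq pqs t t01 gt.
have : [set segment s.1 s.2 | s in [set` outer_sides a E tau]] (segment pq.1 pq.2).
  by exists pq.
rewrite -rg => -[i _ iE].
have : boundary (glued a tau) (seg pq.1 pq.2 t).
  rewrite bd; exists i => //; rewrite iE; exists t => //.
by move=> [_]; apply; have := @glued_open _ a tau; rewrite openE; apply.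
Qed.

End Pieces.

(** * The two rules for the entries of P *)

Section Vanishing.
Variables (R : realType) (a : 'I_3 -> plane R).
Hypothesis nca : noncollinear a.
Variables tau1 sigma1 tau2 sigma2 : 'I_7 -> plane R -> plane R.
Hypothesis ftau1 : forall k, frame (tau1 k).
Hypothesis fsigma1 : forall k, frame (sigma1 k).
Hypothesis tauK1 : forall k, cancel (tau1 k) (sigma1 k).
Hypothesis sigmaK1 : forall k, cancel (sigma1 k) (tau1 k).
Hypothesis ftau2 : forall k, frame (tau2 k).
Hypothesis fsigma2 : forall k, frame (sigma2 k).
Hypothesis tauK2 : forall k, cancel (tau2 k) (sigma2 k).
Hypothesis sigmaK2 : forall k, cancel (sigma2 k) (tau2 k).
Variables F1 F2 : pattern.
Hypothesis disj1 : forall k l, k != l -> tile a tau1 k `&` tile a tau1 l = set0.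
Hypothesis disj2 : forall k l, k != l -> tile a tau2 k `&` tile a tau2 l = set0.
Hypothesis outer1 : forall pq, pq \in outer_sides a F1 tau1 ->
  forall t, 0 <= t <= 1 -> ~ glued a tau1 (seg pq.1 pq.2 t).
Hypothesis outer2 : forall pq, pq \in outer_sides a F2 tau2 ->
  forall t, 0 <= t <= 1 -> ~ glued a tau2 (seg pq.1 pq.2 t).
Variable beta : R.
Hypothesis beta0 : beta != 0.
Local Notation W1 := (glued a tau1).
Local Notation W2 := (glued a tau2).
Local Notation leb2 := (@Defs.leb2 R).
Variables (Psi : (plane R -> R[i]) -> plane R -> R[i]) (P : 'M[R]_7).
Hypothesis transP : transplantation a tau1 tau2 P Psi.
Hypothesis inter : intertwines_robin W1 (outer_sides a F1 tau1)
  W2 (outer_sides a F2 tau2) beta Psi.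
Hypothesis PsiL2 : forall u, L2 leb2 W1 u -> L2 leb2 W2 (Psi u).

Variables (k k' : 'I_7) (j : 'I_3).
Hypothesis tk' : tau2 k' = tau2 k \o reflection (side_of a j).1 (side_of a j).2.

Let in_tile s0 r (gb : good_box a j s0 r) m s t : `|s - s0| < r -> 0 < t < r ->
  tile a tau1 m (tau1 m (side_chart a j (s, t))).
Proof.
move=> ss /andP[t0 tr].
apply/(box_tile nca tauK1 sigmaK1 gb m (ltW ss)) => //.
by rewrite ltW// gtr0_norm.
Qed.

(** Only tile [l] sees [b], and it does so through [g]: the sum over [eps] is [P k l] and the one
    over [del] is 0. *)
Lemma outer_coefficient l : ~~ shared F1 l j -> P k l = 0.
Proof.
move=> lj.
have [s0 s0L [r1 r10 avoid]] :=
  outer_box nca ftau1 fsigma1 tauK1 sigmaK1 disj1 outer1 lj.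
have [r2 r20 gbr] := good_box_exists nca s0L.
have [s00 s0l] := andP s0L.
(* Small enough to avoid other tiles and other side lines, and to stay between the endpoints of the
   side. *)
pose r := Num.min (Num.min r1 r2) (Num.min s0 (side_len a j - s0)).
have r0 : 0 < r by rewrite !lt_min r10 r20 s00 subr_gt0.
have [rr1 rr2] : r <= r1 /\ r <= r2 by split; rewrite !ge_min lexx ?orbT.
have rs0 : r <= s0 by rewrite !ge_min lexx ?orbT.
have rL : s0 + r <= side_len a j by rewrite -lerBrDl !ge_min lexx ?orbT.
have gb : good_box a j s0 r by apply: gbr; rewrite r0.
have [f [f1 [f2 [pf fs0]]]] := bump_profile s0 r0.
have [g [g1 [g2 [gm [gm1 [gm2 [pg pgm gmE robin wr]]]]]]] := robin_profile beta0 r0.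
have [b [lb [bt lv b0]]] := outer_test nca ftau1 fsigma1 tauK1 sigmaK1 gb pf pg lj
  (fun s t ss tt => avoid s t (le_trans ss rr1) (le_trans tt rr1)) rs0 rL robin.
have [bz [lbz [zt zv _]]] := shared_test nca ftau2 fsigma2 tauK2 sigmaK2 disj2 outer2
  beta gb pf pgm tk'.
have := transplantation_coefficients nca ftau2 fsigma2 tauK2 sigmaK2 transP inter PsiL2
  tk' gb pf pg pgm gmE wr fs0 (eps := fun m => (m == l)%:R) (del := fun=> 0) bt _ zt zv.
rewrite (bigD1 l)//= eqxx mulr1 [in X in _ + X = _]big1 ?addr0; last first.
  by move=> m /negbTE ->; rewrite mulr0.
rewrite big1; last by move=> m _; rewrite mulr0.
apply=> m s t ss tr; have mt := in_tile gb m ss tr.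
have [ml|ml] := eqVneq m l.
  by have := lv s t; rewrite /tchart /= -ml mul1r mul0r addr0 mul1r mul0r addr0.
by have [-> ->] := b0 _ _ ml mt; rewrite !(mul0r, mulr0, addr0).
Qed.

(** Tile [l] sees [b] through [g] and tile [l'], across the side, through the mirror image; the two
    sums are [P k l] and [P k' l']. *)
Lemma shared_coefficient l l' : l != l' ->
  tau1 l' = tau1 l \o reflection (side_of a j).1 (side_of a j).2 -> P k l = P k' l'.
Proof.
move=> ll' tl'; have L0 := side_len_gt0 nca j.
pose s0 := side_len a j / 2.
have s0L : 0 < s0 < side_len a j by rewrite /s0; apply/andP; split; lra.
have [r r0 /(_ r) gb] := good_box_exists nca s0L.
rewrite r0 lexx in gb; have {}gb := gb isT.
have [f [f1 [f2 [pf fs0]]]] := bump_profile s0 r0.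
have [g [g1 [g2 [gm [gm1 [gm2 [pg pgm gmE robin wr]]]]]]] := robin_profile beta0 r0.
have [b [lb [bt lv b0]]] := shared_test nca ftau1 fsigma1 tauK1 sigmaK1 disj1 outer1
  beta gb pf pg tl'.
have [bz [lbz [zt zv _]]] := shared_test nca ftau2 fsigma2 tauK2 sigmaK2 disj2 outer2
  beta gb pf pgm tk'.
have := transplantation_coefficients nca ftau2 fsigma2 tauK2 sigmaK2 transP inter PsiL2
  tk' gb pf pg pgm gmE wr fs0 (eps := fun m => (m == l)%:R)
  (del := fun m => (m == l')%:R) bt _ zt zv.
rewrite (bigD1 l)//= eqxx mulr1 [in X in _ + X = _]big1 ?addr0; last first.
  by move=> m /negbTE ->; rewrite mulr0.
rewrite (bigD1 l')//= eqxx mulr1 [in X in _ = _ + X]big1 ?addr0; last first.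
  by move=> m /negbTE ->; rewrite mulr0.
apply=> m s t ss tr; have mt := in_tile gb m ss tr.
have [ml|ml] := eqVneq m l.
  have := lv s t; rewrite /tchart /= -ml => -[-> ->].
  by rewrite ml (negbTE ll') !(mul1r, mul0r, addr0).
have [ml'|ml'] := eqVneq m l'.
  have := lv s (- t); have [-> ->] := gmE t.
  rewrite -[tchart a tau1 l j (s, - t)](shared_tchart nca tl') /tchart /= -ml' => -[-> ->].
  by rewrite !(mul1r, mul0r, add0r).
by have [-> ->] := b0 _ _ ml ml' mt; rewrite !(mul0r, mulr0, addr0).
Qed.

End Vanishing.

Theorem theorem7p4 (R : realType) (a : 'I_3 -> plane R)
    (tau1 tau2 : 'I_7 -> plane R -> plane R) (beta : R) :
  noncollinear a -> scalene a ->
  is_gluing a E1 tau1 -> is_gluing a E2 tau2 ->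
  admissible a E1 tau1 -> admissible a E2 tau2 ->
  beta != 0 ->
  ~ exists Psi : (plane R -> R[i]) -> plane R -> R[i],
      [/\ invertible_operator (glued a tau1) (glued a tau2) Psi,
          exists P : 'M[R]_7, P \in unitmx /\ transplantation a tau1 tau2 P Psi &
          intertwines_robin (glued a tau1) (outer_sides a E1 tau1)
                            (glued a tau2) (outer_sides a E2 tau2) beta Psi].
Proof.
move=> nca _ gl1 gl2 ad1 ad2 beta0 [Psi [[[PsiL2 _ _ _] _] [P [uP trP]] inter]].
have ft1 := gluing_frames nca gl1 (or_introl erefl).
have ft2 := gluing_frames nca gl2 (or_intror erefl).
have /choice[si1 si1P] := fun k => frame_inverse (ft1 k).
have /choice[si2 si2P] := fun k => frame_inverse (ft2 k).
have [disj1 _ _] := ad1; have [disj2 _ _] := ad2.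
have out1 := admissible_outer ad1; have out2 := admissible_outer ad2.
have fs1 k : frame (si1 k) by have [] := si1P k.
have tK1 k : cancel (tau1 k) (si1 k) by have [] := si1P k.
have sK1 k : cancel (si1 k) (tau1 k) by have [] := si1P k.
have fs2 k : frame (si2 k) by have [] := si2P k.
have tK2 k : cancel (tau2 k) (si2 k) by have [] := si2P k.
have sK2 k : cancel (si2 k) (tau2 k) by have [] := si2P k.
have tau1E := gl1.2; have tau2E := gl2.2.
have zero k k' j l : (k, k', j) \in E2 -> ~~ shared E1 l j -> P k l = 0.
  move=> /tau2E tk'; exact: (outer_coefficient nca ft1 fs1 tK1 sK1 ft2 fs2 tK2 sK2
    disj1 disj2 out1 out2 beta0 trP inter PsiL2 tk').
(* Tile 1 has no outer side in [E1], so the first rule cannot reach [P 1 1]. But sides 1 join tiles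
   1 and 2 in both patterns, and side 3 of tile 2 is outer in [E1] while shared in [E2]. *)
have P11 : P 1 1 = P 2 2.
  apply: (shared_coefficient nca ft1 fs1 tK1 sK1 ft2 fs2 tK2 sK2 disj1 disj2 out1 out2
    beta0 trP inter PsiL2 (j := 1)) => //; [exact: tau2E|exact: tau1E].
(* In [E2] all three sides of tile 1 are shared, so any outer side in [E1] of a tile other than 1
   may be used. *)
have row0 l : P 1 l = 0.
  have := ord7P l; rewrite !inE; move=> /orP[/eqP->|]; first exact: (zero 1 3 2).
  move=> /orP[/eqP->|]; first by rewrite P11; exact: (zero 2 5 3).
  move=> /orP[/eqP->|]; first exact: (zero 1 4 3).
  move=> /orP[/eqP->|]; first exact: (zero 1 2 1).
  move=> /orP[/eqP->|]; first exact: (zero 1 3 2).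
  by move=> /orP[/eqP->|/eqP->]; exact: (zero 1 2 1).
have /matrixP/(_ 1 1) := mulmxV uP.
rewrite !mxE eqxx big1; first by move/eqP; rewrite eq_sym oner_eq0.
by move=> l _; rewrite row0 mul0r.
Qed.
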